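(* Let $0<\beta<1$. Then for every $n\ge2$, every $\rho\in\mathrm{Irr}(\mathrm{U}_n)$ with $\rho(1)>2^{\frac8\beta n^2\log n}$, and every element $g$ of $\mathrm{U}_n$ which is $(\beta,\epsilon)$-spread for $\epsilon=\rho(1)^{-\frac18\beta(2-\beta)/n^2}$, we have $$|\rho(g)|\le\rho(1)^{1-\frac{\beta(2-\beta)}{8}}.$$
   Context: $\mathrm{Irr}(\mathrm{U}_n)$ is the set of irreducible (continuous, finite-dimensional complex) characters of $\mathrm{U}_n$. For $0<\beta<1$ and $\epsilon>0$, an element $g\in\mathrm{U}_n$ is $(\beta,\epsilon)$-spread if at most $(1-\beta)n$ of the eigenvalues of $g$ (counted with multiplicity) lie in any arc of diameter $2\epsilon$ of the unit circle $\mathrm{U}_1$, the diameter of an arc being its arc length (angle). Here $\log$ is the base-$2$ logarithm. *)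

(* Defs.v *)
From HB Require Import structures.
From mathcomp Require Import all_boot all_order all_algebra.
From mathcomp Require Import complex.
From mathcomp Require Import all_classical all_reals all_analysis.

Set Implicit Arguments.
Unset Strict Implicit.
Unset Printing Implicit Defensive.

Import Order.TTheory GRing.Theory Num.Theory numFieldNormedType.Exports.

Local Open Scope classical_set_scope.
Local Open Scope ring_scope.
Local Open Scope complex_scope.

(* The unitary group U_n is the set of matrices g : 'M[R[i]]_n such that
   g \is unitarymx. As in mxrepresentation, a representation of U_n is a
   function on all matrices of which only the values on U_n matter, and it
   acts on row vectors, by right multiplication. *)

Section Representations.
Variables (R : realType) (n d : nat).
Implicit Type r : 'M[R[i]]_n -> 'M[R[i]]_d.

Definition Un_repr r :=
  r 1%:M = 1%:M /\
  {in unitarymx &, {morph r : x y / x *m y >-> x *m y}}.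

(* The alias R[i]^o carries the topology of the complex modulus, and matrices
   over it carry the entrywise topology. *)
Definition Un_continuous r :=
  {within [set g : 'M[R[i]^o]_n | g \is unitarymx],
    continuous (r : 'M[R[i]^o]_n -> 'M[R[i]^o]_d)}.

Definition Un_module r (V : 'M[R[i]]_d) :=
  forall g, g \is unitarymx -> stablemx V (r g).

(* Same formulation as mxsimple and mx_irreducible; the condition 1%:M != 0
   excludes d = 0. *)
Definition Un_irreducible r :=
  (1%:M : 'M[R[i]]_d) != 0 /\
  forall V : 'M[R[i]]_d, Un_module r V -> V != 0 -> row_full V.

End Representations.

(* Irr(U_n). Only the values of chi on U_n are constrained. *)
Definition irr_Un (R : realType) (n : nat) : set ('M[R[i]]_n -> R[i]) :=
  [set chi | exists d (r : 'M[R[i]]_n -> 'M[R[i]]_d),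
    [/\ Un_repr r, Un_continuous r, Un_irreducible r &
        {in unitarymx, forall g, chi g = \tr (r g)}]].

(* The degree chi(1) as an element of R. *)
Definition char_degree (R : realType) (n : nat) (chi : 'M[R[i]]_n -> R[i]) : R :=
  complex.Re (chi 1%:M).

Lemma char_degreeE (R : realType) (n : nat) (chi : 'M[R[i]]_n -> R[i]) :
  irr_Un chi -> chi 1%:M = (char_degree chi)%:C.
Proof.
case=> d [r [[r1 _] _ _ chiE]].
have U1 : (1%:M : 'M[R[i]]_n) \is unitarymx.
  by apply/unitarymxP; rewrite trmx1 map_mx1 mulmx1.
by rewrite /char_degree chiE // r1 mxtrace1 -(rmorph_nat (real_complex R)).
Qed.

(* The closed arc of U_1 of length l starting at angle a; it is the whole
   circle when l >= 2 pi. *)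
Definition arc (R : realType) (a l : R) : set R[i] :=
  [set (cos t +i* sin t) | t in `[a, a + l]].

(* The eigenvalues listed with (algebraic) multiplicity, in some order. *)
Definition eigenvalues (R : realType) (n : nat) (g : 'M[R[i]]_n) : seq R[i] :=
  sval (closed_field_poly_normal (char_poly g)).

Lemma eigenvaluesP (R : realType) (n : nat) (g : 'M[R[i]]_n) :
  char_poly g = \prod_(z <- eigenvalues g) ('X - z%:P).
Proof.
rewrite /eigenvalues; case: closed_field_poly_normal => s /= {1}->.
by rewrite (monicP (char_poly_monic g)) scale1r.
Qed.

Definition spread (R : realType) (n : nat) (beta eps : R) (g : 'M[R[i]]_n) :=
  forall a : R,
    (count (mem (arc a (eps *+ 2))) (eigenvalues g))%:R <= (1 - beta) * n%:R.

Definition log2 (R : realType) (x : R) : R := ln x / ln 2.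

(* Main.v *)
Require Import Defs.
From HB Require Import structures.
From mathcomp Require Import all_boot all_order all_algebra.
From mathcomp Require Import all_fingroup.
From mathcomp Require Import cyclic separable cyclotomic.
From mathcomp Require Import complex.
From mathcomp Require Import all_classical all_reals all_analysis.
From mathcomp Require Import ring lra zify.

Set Implicit Arguments.
Unset Strict Implicit.
Unset Printing Implicit Defensive.

Import Order.TTheory GRing.Theory Num.Theory numFieldNormedType.Exports.

Local Open Scope ring_scope.

(** An irreducible character of U_n takes very small values, compared with its
    degree D, at elements whose eigenvalues are spread out. The proof combines
    Weyl's character formula with a Laplace expansion of the numerator.

    Weyl's formula ([character_schur]) says that, up to a power of the
    determinant, rho is a Schur polynomial: with z_1, ..., z_n the eigenvalues
    and l_1 > ... > l_n a strictly decreasing sequence of natural numbers,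
      rho * prod_(i < j) (z_i - z_j) = det (z_i ^ l_j),
    and D = prod_(i < j) (l_i - l_j) / (j - i). It is proved in two stages. The
    analytic stage ([weights_of_rep]) diagonalises the torus, which gives the
    weights, and differentiates the representation along explicit curves to get
    a representation of the Lie algebra of all n x n matrices; for this a
    continuous representation has to be shown Lipschitz first. The algebraic
    stage ([weyl_character]) follows the proof of Kac: the Casimir operator acts
    by a scalar, hence all exponents that occur in rho * prod (z_i - z_j) have
    the same Euclidean norm, and the strictly decreasing ones are dominated by
    the highest one, so that only one orbit of exponents under permutations is
    left.

    For the bound, cut the eigenvalues into two parts of sizes k and m that are
    at distance at least delta = eps / (2 n) from one another ([cluster_split]).
    Expanding the determinant along the first k rows ([schur_laplace]) gives
      |rho(g)| * prod |z_a - z_b| <= sum_J N(l_J) * N(l_J'),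
    where z_a and z_b run over the two parts, J over the k-subsets of the
    exponents, J' is the complement of J, and N(l_J) is the dimension attached
    to the exponents in J: a Schur polynomial has nonnegative coefficients, so
    its modulus on the torus is at most its value at 1 ([norm_schur]).

    The product N(l_J) N(l_J') is at most n ^ (k m) D / X, where X is the
    product of the distances |l_i - l_j|, i in J, j not in J. This X is large:
    each distance inside J is at most twice the product of the distances to a
    common third point outside of J, so the distances inside J and J' are
    controlled by those across, and the latter carry a fixed proportion of log D
    ([ln_schur_pair]). The hypothesis on D makes all factors n ^ (k m)
    negligible, and the constants are collected in [exponent_bound]. *)
(** * Schur polynomials as sums over interlacing patterns *)

Section Schur.
Variable R : comNzRingType.
Implicit Types (l : nat -> nat) (t : nat -> R).

Definition powmx n l t : 'M[R]_n := \matrix_(i, j) t i ^+ l j.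

Definition vdm n t : R := \prod_(j < n) \prod_(i < j) (t i - t j).

Definition sdec n l := forall i j, (i < j < n)%N -> (l j < l i)%N.

(** Sequences of exponents live on nat, so that variables can be dropped
    without changing types; the default value 0 is never used. *)
Definition natfun n M (m : {ffun 'I_n -> 'I_M}) (j : nat) : nat :=
  oapp (fun i => val (m i)) 0%N (insub j).

(** The branching rule, taken as a definition: peeling off the last variable
    leaves the exponents m_0 > m_1 > ... that interlace with l. In this form a
    Schur polynomial visibly has nonnegative coefficients, which the quotient
    of determinants does not show. *)
Fixpoint schur n l t : R :=
  if n is n'.+1 then
    \sum_(m : {ffun 'I_n' -> 'I_(l 0%N)} | [forall j : 'I_n', (l j.+1 <= m j < l j)%N])
      t n' ^+ l n' * \prod_(j < n') t n' ^+ (l j - (m j).+1)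
        * schur n' (natfun m) t
  else 1.

Lemma natfunE n M (m : {ffun 'I_n -> 'I_M}) (i : 'I_n) : natfun m i = m i.
Proof. by rewrite /natfun valK. Qed.

Lemma sdec_interlace n l (m : {ffun 'I_n -> 'I_(l 0%N)}) :
  [forall j : 'I_n, (l j.+1 <= m j < l j)%N] -> sdec n.+1 l -> sdec n (natfun m).
Proof.
move=> /forallP mP lP i j /andP[ij jn].
have iN := ltn_trans ij jn.
have /= := natfunE m (Ordinal jn); have /= := natfunE m (Ordinal iN) => -> ->.
have /andP[_ /= h1] := mP (Ordinal jn); have /andP[/= h2 _] := mP (Ordinal iN).
apply: (leq_trans h1); apply: leq_trans h2.
have [->//|neq] := eqVneq j i.+1.
by apply/ltnW/lP; lia.
Qed.

Lemma telescope_geo (x y : R) a b L : (b <= a)%N -> (a <= L)%N ->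
  x ^+ a - x ^+ b * y ^+ (a - b) =
  (x - y) * \sum_(m < L | (b <= m < a)%N) x ^+ m * y ^+ (a - m.+1).
Proof.
move=> ba aL.
have -> : \sum_(m < L | (b <= m < a)%N) x ^+ m * y ^+ (a - m.+1) =
          \sum_(b <= m < a) x ^+ m * y ^+ (a - m.+1).
  rewrite (big_nat_widen _ _ L) //= big_geq_mkord.
  by apply: eq_bigl => i; rewrite andbC.
rewrite mulr_sumr.
have := @telescope_sumr R b a (fun m => x ^+ m * y ^+ (a - m)) ba.
rewrite subnn expr0 mulr1 => <-.
apply: eq_big_nat => i /andP[bi ia].
have -> : (a - i = (a - i.+1).+1)%N by lia.
by rewrite !exprS; ring.
Qed.

(** Subtract from each column the multiple of the next one that clears the last
    row: the other entries become t_i ^ a - t_i ^ b * t_n ^ (a - b), divisible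
    by t_i - t_n, and multilinearity turns the geometric quotients into a sum
    over interlacing exponents. *)
Lemma det_powmx_rec n l t : sdec n.+1 l ->
  \det (powmx n.+1 l t) = (\prod_(i < n) (t i - t n)) *
    \sum_(m : {ffun 'I_n -> 'I_(l 0%N)} | [forall j : 'I_n, (l j.+1 <= m j < l j)%N])
      t n ^+ l n * \prod_(j < n) t n ^+ (l j - (m j).+1)
        * \det (powmx n (natfun m) t).
Proof.
move=> lP.
have lS (j : 'I_n) : (l j.+1 < l j)%N by apply: lP; rewrite !ltnS leqnn ltn_ord.
have l0 (j : 'I_n) : (l j <= l 0)%N.
  case: j => -[|j] //= jn; apply/ltnW/lP; lia.
(* Multiplication by U subtracts c j times column j+1 from column j. *)
pose c (j : nat) := if (j < n)%N then t n ^+ (l j - l j.+1) else 0.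
pose U : 'M[R]_n.+1 :=
  \matrix_(i, j) ((i == j)%:R - (i == j.+1 :> nat)%:R * c j).
have detU : \det U = 1.
  rewrite det_trig.
    apply: big1 => i _; rewrite mxE eqxx.
    have -> : (i == i.+1 :> nat) = false by lia.
    by rewrite mul0r subr0.
  apply/is_trig_mxP => i j ij; rewrite mxE.
  have -> : (i == j) = false by rewrite -val_eqE /=; lia.
  have -> : (i == j.+1 :> nat) = false by lia.
  by rewrite mul0r subr0.
pose B := powmx n.+1 l t *m U.
have BE i j : B i j = t i ^+ l j - t i ^+ l j.+1 * c j.
  rewrite /B mxE.
  under eq_bigr => k _ do rewrite !mxE mulrBr.
  rewrite sumrB; congr (_ - _).
    rewrite (bigD1 j) //= eqxx mulr1 big1 ?addr0 // => k /negPf ->.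
    by rewrite mulr0.
  case: (ltnP j n) => jn; last first.
    rewrite /c ltnNge jn /= mulr0; apply: big1 => k _.
    by rewrite mulr0 mulr0.
  have jn' : (j.+1 < n.+1)%N by [].
  rewrite (bigD1 (Ordinal jn')) //= eqxx mul1r big1 ?addr0 // => k.
  rewrite -val_eqE /= => /negPf ->.
  by rewrite mul0r mulr0.
have detB : \det (powmx n.+1 l t) = \det B by rewrite det_mulmx detU mulr1.
rewrite detB (expand_det_row _ ord_max) big_ord_recr /= big1 ?add0r; last first.
  move=> j _; rewrite BE /c /= ltn_ord -exprD subnKC ?subrr ?mul0r //.
  exact: ltnW.
have -> : B ord_max ord_max = t n ^+ l n.
  by rewrite BE /c /= ltnn mulr0 subr0.
rewrite /cofactor -signr_odd oddD addbb expr0 mul1r.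
pose S i (j : 'I_n) : R := \sum_(m < l 0%N | (l j.+1 <= m < l j)%N)
   t i ^+ m * t n ^+ (l j - m.+1).
have -> : \det (row' ord_max (col' ord_max B)) =
   \prod_(i < n) (t i - t n) * \det (\matrix_(i < n, j < n) S i j).
  rewrite big_distrr /=; apply: eq_bigr => s _.
  rewrite [RHS]mulrCA -big_split /=; congr (_ * _).
  apply: eq_bigr => i _.
  transitivity (B (lift ord_max i) (lift ord_max (s i))).
    by rewrite [LHS]mxE [LHS]mxE.
  rewrite [in RHS]mxE BE !lift_max /c ltn_ord (@telescope_geo _ _ _ _ (l 0%N)) //.
  exact: ltnW.
rewrite mulrCA; congr (_ * _).
rewrite -det_tr.
have -> : \det (\matrix_(i, j) S i j)^T =
   \sum_(m : {ffun 'I_n -> 'I_(l 0%N)} | [forall j : 'I_n, (l j.+1 <= m j < l j)%N])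
      \prod_(j < n) t n ^+ (l j - (m j).+1) * \det (powmx n (natfun m) t)^T.
  transitivity (\sum_(s : 'S_n) \sum_(m : {ffun 'I_n -> 'I_(l 0%N)}
     | [forall j : 'I_n, (l j.+1 <= m j < l j)%N])
      (-1) ^+ s * \prod_(j < n) (t (s j) ^+ m j * t n ^+ (l j - (m j).+1))).
    apply: eq_bigr => s _; rewrite -mulr_sumr; congr (_ * _).
    under eq_bigr => j _ do rewrite !mxE /S.
    rewrite bigA_distr_big_dep; apply: eq_bigl => m.
    by apply/familyP/forallP => h j; apply: h.
  rewrite exchange_big; apply: eq_bigr => m _ /=.
  rewrite big_distrr /=; apply: eq_bigr => s _.
  rewrite big_split /= [RHS]mulrCA; congr (_ * _).
  rewrite mulrC; congr (_ * _).
  by apply: eq_bigr => j _; rewrite !mxE natfunE.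
rewrite mulr_sumr; apply: eq_bigr => m _.
by rewrite det_tr mulrA.
Qed.

Lemma det_powmx n l t : sdec n l -> \det (powmx n l t) = vdm n t * schur n l t.
Proof.
elim: n l => [|n IH] l lP; first by rewrite det_mx00 /vdm big_ord0 mulr1.
rewrite det_powmx_rec // /vdm big_ord_recr /= [in RHS]mulrAC [RHS]mulrC.
congr (_ * _); rewrite mulr_sumr; apply: eq_bigr => m mP.
by rewrite (IH _ (sdec_interlace mP lP)) mulrCA.
Qed.

(** The exponents n-1, ..., 1, 0 admit a single interlacing sequence. *)
Lemma schur_delta n l t : (forall j, (j < n)%N -> l j = (n.-1 - j)%N) ->
  schur n l t = 1.
Proof.
elim: n l => [|n IH] l lE //=.
have lS (j : 'I_n) : l j = (l j.+1).+1.
  have jn := ltn_ord j; rewrite !lE ?ltnS //; lia.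
have l0 : l 0%N = n by rewrite lE // subn0.
have hb (j : 'I_n) : (l j.+1 < l 0)%N.
  have jn := ltn_ord j; rewrite !lE ?ltnS //; lia.
rewrite (big_pred1 [ffun j => Ordinal (hb j)]) => [|m].
  rewrite lE // subnn expr0 mul1r big1 => [|j _]; last first.
    by rewrite ffunE /= lS subnn expr0.
  rewrite mul1r IH // => j jn.
  rewrite (natfunE _ (Ordinal jn)) ffunE /= lE //=; lia.
apply/forallP/eqP => [mP|-> j]; last by rewrite ffunE /= lS leqnn ltnSn.
apply/ffunP => j; apply/val_inj; rewrite ffunE /=.
have := mP j; rewrite lS; lia.
Qed.

(** The Vandermonde formula is the case of [det_powmx] in which the Schur
    polynomial is 1. *)
Lemma vdm_det n t : vdm n t = \det (powmx n (fun j => n.-1 - j)%N t).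
Proof.
rewrite det_powmx ?schur_delta ?mulr1 // => i j /andP[ij jn]; lia.
Qed.

Lemma eq_schur n l t t' : (forall i, (i < n)%N -> t i = t' i) ->
  schur n l t = schur n l t'.
Proof.
elim: n l => [|n IH] l tt' //=.
apply: eq_bigr => m _; rewrite !tt' // IH // => i ni.
by apply: tt'; apply: ltnW.
Qed.

Lemma eq_vdm n t t' : (forall i, (i < n)%N -> t i = t' i) -> vdm n t = vdm n t'.
Proof.
move=> tt'; apply: eq_bigr => j _; apply: eq_bigr => i _.
by rewrite !tt' // (ltn_trans (ltn_ord i)).
Qed.

End Schur.

Lemma rmorph_schur (R S : comNzRingType) (f : {rmorphism R -> S}) n l t :
  f (schur n l t) = schur n l (f \o t).
Proof.
elim: n l => [|n IH] l /=; first exact: rmorph1.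
rewrite rmorph_sum; apply: eq_bigr => m _.
rewrite !rmorphM rmorphXn rmorph_prod IH; congr (_ * _ * _).
by apply: eq_bigr => j _; rewrite rmorphXn.
Qed.

Lemma rmorph_vdm (R S : comNzRingType) (f : {rmorphism R -> S}) n t :
  f (vdm n t) = vdm n (f \o t).
Proof.
rewrite rmorph_prod; apply: eq_bigr => j _; rewrite rmorph_prod.
by apply: eq_bigr => i _; rewrite rmorphB.
Qed.

(** Every monomial has modulus 1 and coefficient 1. *)
Lemma norm_schur (R : numDomainType) n l (t : nat -> R) :
  (forall i, (i < n)%N -> `|t i| = 1) ->
  `|schur n l t| <= schur n l (fun=> 1).
Proof.
elim: n l => [|n IH] l t1 /=; first by rewrite normr1.
apply: (le_trans (ler_norm_sum _ _ _)); apply: ler_sum => m _.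
rewrite !normrM normr_prod normrX t1 // expr1n.
under eq_bigr => j _ do rewrite normrX t1 // expr1n.
rewrite big1_eq [X in _ <= _ * X * _]big1 ?mul1r => [|j _]; last first.
  by rewrite expr1n.
by apply: IH => i ni; apply: t1; apply: ltnW.
Qed.

Lemma prod_triangle (R : comNzRingType) n (F : nat -> nat -> R) :
  \prod_(i < n) \prod_(j < n | (i < j)%N) F i j =
  \prod_(j < n) \prod_(i < j) F i j.
Proof.
rewrite (exchange_big_dep predT) //=; apply: eq_bigr => j _.
by rewrite (big_ord_widen_cond n predT (fun i => F i j)) 1?ltnW.
Qed.

(** The principal specialisation t_i = X^i turns both determinants into
    Vandermonde determinants; dividing by powers of 1 - X and setting X = 1
    gives the number of patterns. *)
Lemma schur1 n l : sdec n l ->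
  schur n l (fun=> 1 : int) * \prod_(j < n) \prod_(i < j) (j%:Z - i%:Z) =
  \prod_(j < n) \prod_(i < j) ((l i)%:Z - (l j)%:Z).
Proof.
move=> lP; pose t (i : nat) : {poly int} := 'X^i.
pose g a b : {poly int} := \sum_(a <= k < b) 'X^k.
have gE a b : (a <= b)%N -> 'X^a - 'X^b = (1 - 'X) * g a b.
  move=> ab; rewrite /g -opprB -(@telescope_sumr _ a b (fun k => 'X^k)) //.
  rewrite -sumrN mulr_sumr; apply: eq_bigr => k _.
  by rewrite exprS; ring.
have g1 a b : (a <= b)%N -> (g a b).[1] = b%:Z - a%:Z.
  move=> ab; rewrite horner_sum.
  under eq_bigr => k _ do rewrite hornerXn expr1n.
  by rewrite sumr_const_nat subzn // natz.
pose c : {poly int} := \prod_(j < n) \prod_(i < j) (1 - 'X).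
have c0 : c != 0.
  apply/prodf_neq0 => j _; apply/prodf_neq0 => i _.
  apply/eqP => /(congr1 (fun p : {poly int} => p.[0])).
  by rewrite !hornerE.
have key : c * \prod_(j < n) \prod_(i < j) g (l j) (l i) =
   c * (\prod_(j < n) \prod_(i < j) g i j * schur n l t).
  rewrite mulrA.
  have -> : c * \prod_(j < n) \prod_(i < j) g i j = vdm n t.
    rewrite -big_split; apply: eq_bigr => j _ /=; rewrite -big_split.
    by apply: eq_bigr => i _ /=; rewrite -gE // ltnW.
  rewrite -det_powmx //.
  have -> : powmx n l t = Vandermonde n (\row_j 'X^(l j)).
    by apply/matrixP => i j; rewrite !mxE -!exprM mulnC.
  rewrite det_Vandermonde.
  under [in RHS]eq_bigr => i _ do under eq_bigr => j _ do rewrite !mxE.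
  rewrite (prod_triangle _ (fun i j => 'X^(l j) - 'X^(l i))).
  rewrite -big_split; apply: eq_bigr => j _ /=; rewrite -big_split.
  apply: eq_bigr => i _ /=; rewrite -gE // ltnW //.
  by apply: lP; rewrite !ltn_ord.
have e1 (h : nat -> nat -> nat * nat) :
    (forall j i, (i < j < n)%N -> (h i j).1 <= (h i j).2)%N ->
    horner_eval 1 (\prod_(j < n) \prod_(i < j) g (h i j).1 (h i j).2) =
    \prod_(j < n) \prod_(i < j) ((h i j).2%:Z - (h i j).1%:Z).
  move=> hP; rewrite rmorph_prod; apply: eq_bigr => j _; rewrite rmorph_prod.
  apply: eq_bigr => i _; apply: g1; apply: hP.
  by rewrite !ltn_ord.
have := congr1 (horner_eval 1) (mulfI c0 key).
rewrite rmorphM rmorph_schur (e1 (fun i j => (l j, l i))) /=; last first.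
  by move=> j i ij; apply/ltnW/lP.
rewrite (e1 (fun i j => (i, j))) /= => [->|j i /andP[/ltnW]//].
rewrite mulrC; congr (_ * _).
by apply: eq_schur => i _; rewrite /= /horner_eval hornerXn expr1n.
Qed.

(** * Laplace expansion along a block of rows *)

(** Sort the permutations s of the Leibniz formula by the image J of A: they
    are those whose product survives when the entries (i, j) with i in A and
    j not in J, or conversely, are replaced by 0. *)
Lemma laplace_block (R : comNzRingType) n (M : 'M[R]_n) (A : {set 'I_n}) :
  \det M = \sum_(J : {set 'I_n} | #|J| == #|A|)
             \det (\matrix_(i, j) (M i j *+ ((i \in A) == (j \in J)))).
Proof.
rewrite [RHS]exchange_big; apply: eq_bigr => s _ /=.
rewrite -mulr_sumr; congr (_ * _).
rewrite (bigD1 (s @: A)) /=; last by rewrite card_imset //; apply: perm_inj.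
rewrite [X in _ + X]big1 ?addr0 => [|J /andP[_ JN]].
  apply: eq_bigr => i _; rewrite mxE mem_imset ?eqxx ?mulr1n //.
  exact: perm_inj.
have [i /negPf iP] : exists i, (i \in A) != (s i \in J).
  apply/existsP; rewrite -negb_forall; apply: contra JN => /forallP h.
  apply/eqP/setP => j; rewrite -[j](permKV s) mem_imset; last exact: perm_inj.
  by have /eqP := h (s^-1 j)%g; rewrite permKV => ->.
by rewrite (bigD1 i) //= mxE iP mulr0n mul0r.
Qed.

(** Like all sequences of indices here a function on nat; the default 0 is only
    reached beyond the cardinal of J. *)
Definition eidx n (J : {set 'I_n}) (j : nat) : nat := nth 0%N (map val (enum J)) j.

Lemma eidx_mono n (J : {set 'I_n}) i j : (i < j < #|J|)%N -> (eidx J i < eidx J j)%N.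
Proof.
move=> /andP[ij jJ].
have srt : sorted ltn (map val (enum J)).
  have -> : map val (enum J) = [seq i <- iota 0 n | i \in map val (enum J)].
    rewrite -val_enum_ord filter_map; congr map.
    rewrite /enum_mem -filter_predI; apply: eq_filter => x /=.
    rewrite mem_map; last exact: val_inj.
    by rewrite mem_filter -enumT mem_enum !inE !andbT.
  by apply: sorted_filter (iota_ltn_sorted 0 n); apply: ltn_trans.
have := sorted_ltn_nth ltn_trans 0%N srt.
by apply; rewrite ?inE ?size_map -?cardE // (ltn_trans ij).
Qed.

Lemma eidx_ltn n (J : {set 'I_n}) j : (j < #|J|)%N -> (eidx J j < n)%N.
Proof.
move=> jJ; rewrite /eidx.
have : nth 0%N (map val (enum J)) j \in map val (enum J).
  by rewrite mem_nth // size_map -cardE.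
by move=> /mapP[x _ ->]; apply: ltn_ord.
Qed.

Lemma sdec_eidx n l (J : {set 'I_n}) : sdec n l -> sdec #|J| (l \o eidx J).
Proof.
move=> lP i j /andP[ij jJ] /=; apply: lP.
by rewrite eidx_mono ?ij //= eidx_ltn.
Qed.

(** After a permutation of the columns, independent of t, the matrix is block
    diagonal. Only the existence of the sign matters below. *)
Lemma det_block_powmx (R : comNzRingType) k m l (J : {set 'I_(k + m)}) :
  #|J| = k -> exists e : bool, forall t : nat -> R,
  \det (\matrix_(i, j) (powmx (k + m) l t i j *+ ((i < k)%N == (j \in J)))) =
  (-1) ^+ e * (\det (powmx k (l \o eidx J) t)
     * \det (powmx m (l \o eidx (~: J)) (fun i => t (k + i)%N))).
Proof.
move=> cJ.
have cJC : #|~: J| = m by have := cardsC J; rewrite cardT size_enum_ord cJ; lia.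
pose sJ := enum J ++ enum (~: J).
have size_sJ : size sJ = (k + m)%N by rewrite size_cat -!cardE cJ cJC.
have uniq_sJ : uniq sJ.
  rewrite cat_uniq !enum_uniq andbT /=; apply/hasPn => x.
  by rewrite !mem_enum inE.
pose c (i : 'I_(k + m)) := tnth (in_tuple sJ) (cast_ord (esym size_sJ) i).
have c_inj : injective c.
  move=> i j /eqP; rewrite /c !(tnth_nth i) /= nth_uniq ?size_sJ ?ltn_ord //.
  by move=> /eqP/val_inj.
pose p := perm c_inj.
have pl (j : 'I_k) : p (lshift m j) \in J /\ val (p (lshift m j)) = eidx J j.
  rewrite permE /c (tnth_nth (lshift m j)) /= nth_cat -cardE cJ ltn_ord; split.
    by rewrite -mem_enum mem_nth // -cardE cJ.
  by rewrite /eidx (nth_map (lshift m j)) // -cardE cJ.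
have pr (j : 'I_m) :
    p (rshift k j) \in ~: J /\ val (p (rshift k j)) = eidx (~: J) j.
  rewrite permE /c (tnth_nth (rshift k j)) /= nth_cat -cardE cJ.
  have -> : (k + j < k)%N = false by lia.
  have -> : (k + j - k = j)%N by lia.
  split; first by rewrite -mem_enum mem_nth // -cardE cJC.
  by rewrite /eidx (nth_map (rshift k j)) // -cardE cJC.
exists p => t; set M := (X in \det X = _).
have -> : \det M = (-1) ^+ p * \det (col_perm p M).
  rewrite col_permE det_mulmx det_perm mulrCA odd_permV -signr_addb addbb.
  by rewrite mulr1.
congr (_ * _).
have -> : col_perm p M = block_mx (powmx k (l \o eidx J) t) 0 0
   (powmx m (l \o eidx (~: J)) (fun i => t (k + i)%N)).
  apply/matrixP => i j.
  case: (split_ordP i) => i' ->; case: (split_ordP j) => j' ->;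
    rewrite ?block_mxEul ?block_mxEur ?block_mxEdl ?block_mxEdr !mxE /=.
  - by have [-> ->] := pl j'; rewrite ltn_ord eqxx mulr1n.
  - by have [] := pr j'; rewrite inE => /negPf -> _; rewrite ltn_ord mulr0n.
  - by have [-> _] := pl j'; rewrite ltnNge leq_addr mulr0n.
  - have [] := pr j'; rewrite inE => /negPf -> ->.
    by rewrite ltnNge leq_addr eqxx mulr1n.
exact: det_ublock.
Qed.

(** Moving the points to t_i + X^{i+1} makes them pairwise distinct, so that a
    Vandermonde factor can be cancelled even when the t_i are not distinct. *)
Definition spreadX (F : fieldType) (t : nat -> F) (i : nat) : {poly F} :=
  (t i)%:P + 'X^(i.+1).

Lemma vdm_spreadX (F : fieldType) (t : nat -> F) n k :
  vdm n (fun i => spreadX t (k + i)%N) != 0.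
Proof.
apply/prodf_neq0 => j _; apply/prodf_neq0 => i _; apply/eqP.
move/(congr1 (fun p : {poly F} => p`_(k + i).+1)).
rewrite /spreadX coefB !coefD !coefC !coefXn ?coef0 /= eqxx.
have -> : ((k + i).+1 == (k + j).+1) = false.
  by have := ltn_ord i; lia.
rewrite add0r addr0 subr0 => /eqP.
by rewrite oner_eq0.
Qed.

Lemma horner0_spreadX (F : fieldType) (t : nat -> F) i :
  horner_eval 0 (spreadX t i) = t i.
Proof.
by rewrite /horner_eval /spreadX hornerD hornerC hornerXn expr0n addr0.
Qed.

Lemma vdm_split (R : comNzRingType) k m (t : nat -> R) :
  vdm (k + m) t = vdm k t * vdm m (fun i => t (k + i)%N)
                   * \prod_(j < m) \prod_(i < k) (t i - t (k + j)%N).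
Proof.
rewrite /vdm big_split_ord /= -mulrA -big_split /=; congr (_ * _).
apply: eq_bigr => j _; by rewrite big_split_ord /= mulrC.
Qed.

(** All three Schur polynomials are quotients of determinants by Vandermonde
    products; what remains of those is the product of the differences between
    the two blocks of points. *)
Lemma schur_laplace (F : fieldType) k m l (t : nat -> F) : sdec (k + m) l ->
  exists e : {set 'I_(k + m)} -> bool,
  schur (k + m) l t * \prod_(j < m) \prod_(i < k) (t i - t (k + j)%N) =
  \sum_(J : {set 'I_(k + m)} | #|J| == k)
     (-1) ^+ e J * (schur k (l \o eidx J) t
       * schur m (l \o eidx (~: J)) (fun i => t (k + i)%N)).
Proof.
move=> lP.
have /choice [e eP] : forall J : {set 'I_(k + m)}, exists e : bool, #|J| = k ->
  forall u : nat -> {poly F},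
  \det (\matrix_(i, j) (powmx (k + m) l u i j *+ ((i < k)%N == (j \in J)))) =
  (-1) ^+ e * (\det (powmx k (l \o eidx J) u)
     * \det (powmx m (l \o eidx (~: J)) (fun i => u (k + i)%N))).
  move=> J; have [cJ|cJ] := eqVneq #|J| k.
    by have [e eP] := @det_block_powmx {poly F} k m l J cJ; exists e.
  by exists false => cJ'; rewrite cJ' eqxx in cJ.
exists e; pose u := spreadX t.
have v1 : vdm k u != 0 := vdm_spreadX t k 0.
have v2 : vdm m (fun i => u (k + i)%N) != 0 by apply: vdm_spreadX.
have key : schur (k + m) l u * \prod_(j < m) \prod_(i < k) (u i - u (k + j)%N) =
  \sum_(J : {set 'I_(k + m)} | #|J| == k)
     (-1) ^+ e J * (schur k (l \o eidx J) u
       * schur m (l \o eidx (~: J)) (fun i => u (k + i)%N)).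
  apply: (mulfI (mulf_neq0 v1 v2)).
  rewrite [schur _ _ _ * _]mulrC mulrA -vdm_split -det_powmx //.
  pose A := [set i : 'I_(k + m) | (i < k)%N].
  have cA : #|A| = k.
    have -> : A = [set lshift m i | i : 'I_k].
      apply/setP => x; rewrite inE; apply/idP/imsetP => [xk|[i _ ->]] /=.
        by exists (Ordinal xk) => //; apply: val_inj.
      exact: ltn_ord.
    by rewrite card_imset ?card_ord //; apply: lshift_inj.
  rewrite (laplace_block _ A) cA mulr_sumr; apply: eq_bigr => J /eqP cJ.
  have -> : \det (\matrix_(i, j) (powmx (k + m) l u i j *+
                                  ((i \in A) == (j \in J)))) =
     \det (\matrix_(i, j) (powmx (k + m) l u i j *+
                                  ((i < k)%N == (j \in J)))).
    by congr (\det _); apply/matrixP => i j; rewrite mxE [in RHS]mxE inE.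
  have s1 : sdec k (l \o eidx J) by have := @sdec_eidx _ l J lP; rewrite cJ.
  have s2 : sdec m (l \o eidx (~: J)).
    have := @sdec_eidx _ l (~: J) lP; have := cardsC J.
    by rewrite cardT size_enum_ord cJ => /addnI ->.
  by rewrite (eP _ cJ) !det_powmx //; ring.
have := congr1 (horner_eval 0) key.
rewrite rmorphM rmorph_schur rmorph_prod rmorph_sum /=.
rewrite (@eq_schur _ _ _ _ t); last by move=> i _; rewrite /= horner0_spreadX.
have -> : \prod_(j < m) horner_eval 0 (\prod_(i < k) (u i - u (k + j)%N)) =
          \prod_(j < m) \prod_(i < k) (t i - t (k + j)%N).
  apply: eq_bigr => j _; rewrite rmorph_prod; apply: eq_bigr => i _.
  by rewrite rmorphB; congr (_ - _); apply: horner0_spreadX.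
move->; apply: eq_bigr => J _.
rewrite !rmorphM rmorphXn rmorphN rmorph1 !rmorph_schur; congr (_ * (_ * _)).
  by apply: eq_schur => i _; rewrite /= horner0_spreadX.
by apply: eq_schur => i _; rewrite /= horner0_spreadX.
Qed.

(** * Linear algebra *)

(** A maximal subspace among those contained in P contains every vector of P,
    by closure under linear combinations. *)
Lemma subspace_of_pred (F : fieldType) d (P : 'rV[F]_d -> Prop) :
  P 0 -> (forall a u v, P u -> P v -> P (a *: u + v)) ->
  exists U : 'M[F]_d, forall w : 'rV_d, (w <= U)%MS <-> P w.
Proof.
move=> P0 PD.
pose Q (U : 'M[F]_d) := forall w : 'rV_d, (w <= U)%MS -> P w.
pose S k := `[< exists2 U, Q U & \rank U = k >].
have ex : exists k, S k.
  exists 0%N; apply/asboolP; exists 0; last exact: mxrank0.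
  by move=> w; rewrite submx0 => /eqP ->.
have ub k : S k -> (k <= d)%N.
  by move=> /asboolP[U _ <-]; apply: rank_leq_row.
have [k /asboolP[U QU rU] kmax] := ex_maxnP ex ub.
exists U => w; split=> [|Pw]; first exact: QU.
have QUw : Q (U + <<w>>)%MS.
  move=> v /sub_addsmxP[[a b] /= ->].
  have /sub_rVP[c ->] : (b *m <<w>> <= w)%MS.
    by rewrite (submx_trans (submxMl _ _)) // genmxE.
  by rewrite addrC; apply: PD => //; apply: QU; apply: submxMl.
have : S (\rank (U + <<w>>)%MS) by apply/asboolP; exists (U + <<w>>)%MS.
move=> /kmax; rewrite -rU => rle.
have := addsmxSr U <<w>>%MS; rewrite genmxE => /submx_trans; apply.
have := mxrank_leqif_sup (addsmxSl U <<w>>%MS) => -[h1 h2].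
by rewrite -h2 eqn_leq h1 rle.
Qed.

Lemma stablemxP_vec (F : fieldType) d (U f : 'M[F]_d) :
  stablemx U f <-> (forall w : 'rV_d, (w <= U)%MS -> (w *m f <= U)%MS).
Proof.
split=> [fU w wU|h]; first exact: submx_trans (submxMr f wU) fU.
by apply/row_subP => i; rewrite row_mul; apply/h/row_sub.
Qed.

(** * Linear independence of the characters of the torus *)

Lemma prim_root_closed (C : numClosedFieldType) n :
  (0 < n)%N -> exists z : C, n.-primitive_root z.
Proof.
move=> n_gt0; pose p : {poly C} := 'X^n - 1.
have [r pE] := closed_field_poly_normal p.
have {}pE : p = \prod_(z <- r) ('X - z%:P).
  by rewrite pE (monicP (monicXnsubC 1 n_gt0)) scale1r.
have szr : size r = n.
  by have := size_prod_XsubC r (fun z => z); rewrite -pE size_Xn_sub_1 // => -[].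
have ur : uniq r.
  by rewrite -separable_prod_XsubC -pE separable_Xn_sub_1 // pnatr_eq0 -lt0n.
have : has n.-primitive_root r.
  apply: has_prim_root; rewrite ?szr //.
  apply/allP => z zr; rewrite /root_of_unity.
  by rewrite -/p pE root_prod_XsubC.
by case/hasP => z _ zP; exists z.
Qed.

(** Averaging over a coset of the N-torsion of the torus, with N large,
    isolates one exponent; the coset is chosen so that all its points have
    distinct coordinates. *)
Lemma torus_char_indep (C : numClosedFieldType) n (I : finType)
    (nu : I -> {ffun 'I_n -> int}) (c : I -> C) :
  (forall t : nat -> C, (forall i, `|t i| = 1) ->
     (forall i j : 'I_n, i != j -> t i != t j) ->
     \sum_x c x * \prod_(i < n) t i ^ nu x i = 0) ->
  forall nu0, \sum_(x | nu x == nu0) c x = 0.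
Proof.
move=> H nu0.
pose e x i : int := nu x i - nu0 i.
pose N := (\max_x \max_i `|e x i|%N).+1.
have eN x i : (`|e x i| < N)%N.
  rewrite ltnS; apply: leq_trans (leq_bigmax x).
  exact: (leq_bigmax (F := fun i => `|e x i|%N) i).
(* The points xi ^ (j + (n+1) k_j) have distinct coordinates, the exponents
   being distinct modulo n+1, and they form a coset of the N-torsion. *)
have M_gt0 : (0 < N * n.+1)%N by rewrite muln_gt0.
have [xi xiP] := prim_root_closed C M_gt0.
have xi1 : `|xi| = 1.
  apply/eqP; rewrite -(pexpr_eq1 M_gt0) // -normrX (prim_expr_order xiP).
  by rewrite normr1.
have xi0 : xi != 0 by rewrite -normr_eq0 xi1 oner_eq0.
pose z := xi ^+ n.+1.
have zP : N.-primitive_root z.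
  have := exp_prim_root xiP n.+1.
  have -> : gcdn n.+1 (N * n.+1) = n.+1 by apply/gcdn_idPl/dvdn_mull.
  by rewrite mulnK.
have z0 : z != 0 by rewrite expf_neq0.
pose t (k : {ffun 'I_n -> 'I_N}) (j : nat) := xi ^+ (j + n.+1 * natfun k j).
have tS k j : `|t k j| = 1 by rewrite normrX xi1 expr1n.
have t0 k j : t k j != 0 by rewrite -normr_eq0 tS oner_eq0.
have t_reg k (i j : 'I_n) : i != j -> t k i != t k j.
  apply: contra; rewrite /t (eq_prim_root_expr xiP) => /eqP h.
  have := congr1 (fun m => m %% n.+1)%N h.
  have md (a b : nat) : (a + n.+1 * b = a %[mod n.+1])%N.
    by rewrite addnC mulnC modnMDl.
  rewrite !modn_dvdm ?dvdn_mull // !md.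
  have [hi hj] := (ltn_ord i, ltn_ord j).
  rewrite !modn_small ?(ltn_trans _ (ltnSn n)) //.
  by move=> /val_inj ->.
have key : \sum_k (\prod_(i < n) t k i ^ (- nu0 i)) *
    (\sum_x c x * \prod_(i < n) t k i ^ nu x i) = 0.
  by apply: big1 => k _; rewrite H ?mulr0 //; apply: t_reg.
have : \sum_x c x * \prod_(i < n) \sum_(m < N) (xi ^+ (i + n.+1 * m)) ^ e x i = 0.
  rewrite -[RHS]key.
  under [in RHS]eq_bigr => k _ do rewrite mulr_sumr.
  rewrite exchange_big; apply: eq_bigr => x _ /=.
  rewrite bigA_distr_bigA mulr_sumr; apply: eq_bigr => k _ /=.
  rewrite mulrCA -big_split; congr (_ * _); apply: eq_bigr => i _ /=.
  by rewrite -expfzDr // /t natfunE addrC.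
have sumE (i : 'I_n) x :
    \sum_(m < N) (xi ^+ (i + n.+1 * m)) ^ e x i = (e x i == 0)%:R * N%:R.
  have [->|e0] := eqVneq (e x i) 0.
    rewrite mul1r; under eq_bigr => m _ do rewrite expr0z.
    by rewrite sumr_const card_ord.
  rewrite mul0r.
  have zN : (z ^ e x i) ^+ N = 1.
    by rewrite exprnP exprz_exp mulrC -exprz_exp -exprnP (prim_expr_order zP) exp1rz.
  have z1 : z ^ e x i != 1.
    apply/eqP => z1.
    have : z ^+ `|e x i|%N = 1.
      case: (e x i) z1 => k /= hk //.
      have hk' : (z ^+ k.+1)^-1 = 1 := hk.
      by rewrite -[LHS]invrK hk' invr1.
    move/eqP; rewrite -(prim_order_dvd zP) => /dvdn_leq.
    by rewrite absz_gt0 e0 leqNgt eN => /(_ isT).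
  have : (z ^ e x i - 1) * \sum_(m < N) (z ^ e x i) ^+ m = 0.
    by rewrite -subrX1 zN subrr.
  move=> /eqP; rewrite mulf_eq0 subr_eq0 (negPf z1) /= => /eqP s0.
  transitivity ((xi ^+ i) ^ e x i * \sum_(m < N) (z ^ e x i) ^+ m).
    rewrite mulr_sumr; apply: eq_bigr => m _.
    rewrite exprD exprzMl ?unitfE ?expf_neq0 // exprM -/z.
    by congr (_ * _); rewrite [z ^+ m]exprnP [RHS]exprnP exprzAC.
  by rewrite s0 mulr0.
have -> : \sum_x c x * \prod_(i < n) \sum_(m < N) (xi ^+ (i + n.+1 * m)) ^ e x i =
          (\sum_(x | nu x == nu0) c x) * N%:R ^+ n.
  rewrite mulr_suml [RHS]big_mkcond; apply: eq_bigr => x _.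
  under eq_bigr => i _ do rewrite sumE.
  case: eqP => [nx|/eqP nx].
    rewrite (eq_bigr (fun=> N%:R)) => [|i _].
      by rewrite prodr_const card_ord.
    by rewrite /e nx subrr eqxx mul1r.
  have [i ei] : exists i, e x i != 0.
    apply/existsP; rewrite -negb_forall; apply: contra nx => /forallP h.
    by apply/eqP/ffunP => i; apply/eqP; rewrite -subr_eq0 h.
  by rewrite (bigD1 i) //= (negPf ei) !mul0r mulr0.
move=> /eqP; rewrite mulf_eq0 expf_eq0 pnatr_eq0 andbF orbF.
by move/eqP.
Qed.

(** Group both sums by the values of f and g. This turns an equality of
    integral coefficients into an identity over every ring. *)
Lemma eq_fibers (I J : finType) (T : eqType) (R : pzRingType)
    (f : I -> T) (g : J -> T) (c : I -> int) (e : J -> int) (G : T -> R) :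
  (forall v, \sum_(x | f x == v) c x = \sum_(y | g y == v) e y) ->
  \sum_x (c x)%:~R * G (f x) = \sum_y (e y)%:~R * G (g y).
Proof.
move=> H.
have zero (K : finType) (h : K -> T) (b : K -> int) :
    (forall v, \sum_(x | h x == v) b x = 0) -> \sum_x (b x)%:~R * G (h x) = 0.
  move=> b0; pose p x := odflt x [pick y | h y == h x].
  have hp x : h (p x) = h x.
    by rewrite /p; case: pickP => [y /eqP|].
  have pE x y : h x = h y -> p x = p y.
    move=> xy; rewrite /p xy; case: pickP => // /(_ y).
    by rewrite eqxx.
  rewrite (partition_big p predT) //=; apply: big1 => y _.
  have [py|py] := eqVneq (p y) y; last first.
    by apply: big1 => x /eqP px; rewrite -px (pE (p x) x) ?hp ?eqxx in py.
  rewrite (eq_bigl (fun x => h x == h y)) => [|x]; last first.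
    by apply/eqP/eqP => [<-|/pE ->]; rewrite ?hp.
  rewrite (eq_bigr (fun x => (b x)%:~R * G (h y))) => [|x /eqP -> //].
  by rewrite -mulr_suml -rmorph_sum /= b0 mul0r.
have := zero (I + J)%type (fun s => match s with inl x => f x | inr y => g y end)
  (fun s => match s with inl x => c x | inr y => - e y end).
rewrite big_sumType /= => h.
have /eqP : \sum_x (c x)%:~R * G (f x) + \sum_y (- e y)%:~R * G (g y) = 0.
  by apply: h => v; rewrite big_sumType /= sumrN H subrr.
under [X in _ + X]eq_bigr => y _ do rewrite rmorphN mulNr.
by rewrite sumrN subr_eq0 => /eqP.
Qed.

(** * The dominance order *)

(** The usual dominance order, without the assumption that the sequences are
    decreasing. *)
Definition dom n (nu la : {ffun 'I_n -> int}) :=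
  (forall k : nat, \sum_(i < n | (i < k)%N) nu i <=
                   \sum_(i < n | (i < k)%N) la i) /\
  \sum_i nu i = \sum_i la i.

Definition nrm2 n (nu : {ffun 'I_n -> int}) : int := \sum_i nu i ^+ 2.

Lemma abel_sum n (x y : nat -> int) :
  \sum_(i < n.+1) x i * y i = (\sum_(i < n.+1) x i) * y n +
    \sum_(k < n) (\sum_(i < k.+1) x i) * (y k - y k.+1).
Proof.
elim: n => [|n IH]; first by rewrite !big_ord_recr !big_ord0 /= !add0r addr0.
rewrite [LHS]big_ord_recr /= IH [X in _ = _ + X]big_ord_recr /=.
by rewrite [X in _ = X * _ + _]big_ord_recr /=; ring.
Qed.

(** By Abel summation |la|^2 - |nu|^2 = <la - nu, la + nu> is a combination,
    with positive coefficients, of the partial sums of la - nu, which are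
    nonnegative: they must all vanish. *)
Lemma dom_sdec_eq n (nu la : {ffun 'I_n -> int}) :
  (forall i j : 'I_n, (i < j)%N -> nu j < nu i) ->
  (forall i j : 'I_n, (i < j)%N -> la j < la i) ->
  dom nu la -> nrm2 nu = nrm2 la -> nu = la.
Proof.
case: n nu la => [|n] nu la nuP laP [domP sumP] nrmP.
  by apply/ffunP => -[].
pose x k := la (inord k) - nu (inord k); pose y k := la (inord k) + nu (inord k).
have xS k : (k <= n.+1)%N -> \sum_(i < k) x i =
   \sum_(i < n.+1 | (i < k)%N) la i - \sum_(i < n.+1 | (i < k)%N) nu i.
  move=> kn; rewrite (big_ord_widen n.+1 x) // -sumrB.
  by apply: eq_bigr => i _; rewrite /x inord_val.
have x_ge0 k : (k <= n.+1)%N -> 0 <= \sum_(i < k) x i.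
  by move=> kn; rewrite xS // subr_ge0.
have xT : \sum_(i < n.+1) x i = 0.
  rewrite xS // !(eq_bigl predT) => [|i|i]; rewrite ?ltn_ord //.
  by rewrite sumP subrr.
have y_gt k : (k < n)%N -> 0 < y k - y k.+1.
  move=> kn; rewrite /y subr_gt0; apply: ltrD; [apply: laP|apply: nuP];
  by rewrite !inordK // ltnS // ltnW.
have : \sum_(i < n.+1) x i * y i = 0.
  transitivity (nrm2 la - nrm2 nu); last by rewrite nrmP subrr.
  rewrite /nrm2 -sumrB; apply: eq_bigr => i _.
  by rewrite /x /y inord_val; ring.
rewrite abel_sum xT mul0r add0r => /eqP.
rewrite psumr_eq0 => [/allP h|k _]; last first.
  by rewrite mulr_ge0 ?x_ge0 ?ltW ?y_gt // ltnW // ltnS.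
have X0 k : (k <= n.+1)%N -> \sum_(i < k) x i = 0.
  case: k => [|k]; first by rewrite big_ord0.
  rewrite ltnS leq_eqVlt => /orP[/eqP -> //|kn].
  have := h (Ordinal kn); rewrite mem_index_enum => /(_ isT) /=.
  by rewrite mulf_eq0 (gt_eqF (y_gt _ kn)) orbF => /eqP.
apply/ffunP => i; apply/esym/eqP; rewrite -subr_eq0.
have := X0 i.+1 (ltn_ord i); rewrite big_ord_recr /= X0 ?add0r; last exact: ltnW.
by rewrite /x inord_val => ->.
Qed.

(** The first k entries of a decreasing sequence are its k largest ones:
    compare both sums after subtracting the (k+1)-st entry. *)
Lemma dom_perm n (la : {ffun 'I_n -> int}) (s : 'S_n) :
  (forall i j : 'I_n, (i < j)%N -> la j < la i) ->
  dom [ffun i => la (s i)] la.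
Proof.
move=> laP; split; last first.
  rewrite [RHS](reindex_inj (@perm_inj _ s)).
  by apply: eq_bigr => i _; rewrite ffunE.
move=> k; have [kn|nk] := ltnP k n; last first.
  rewrite !(eq_bigl predT) => [|i|i]; try by rewrite (leq_trans (ltn_ord i)).
  rewrite [leRHS](reindex_inj (@perm_inj _ s)) /=.
  by rewrite le_eqVlt; apply/orP; left; apply/eqP/eq_bigr => i _; rewrite ffunE.
under eq_bigr => i _ do rewrite ffunE.
pose c := la (Ordinal kn); rewrite -subr_ge0.
rewrite [X in _ - X](reindex_inj (@perm_inj _ s^-1)) /=.
under [X in _ - X]eq_bigr => i _ do rewrite permKV.
have cE : \sum_(i < n | (s^-1 i < k)%g%N) c = \sum_(i < n | (i < k)%N) c.
  by rewrite [RHS](reindex_inj (@perm_inj _ s^-1)).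
have -> : \sum_(i < n | (i < k)%N) la i - \sum_(i < n | (s^-1 i < k)%g%N) la i =
  \sum_(i < n | (i < k)%N) (la i - c) -
  \sum_(i < n | (s^-1 i < k)%g%N) (la i - c) by rewrite !sumrB cE; ring.
rewrite [X in X - _]big_mkcond [X in _ - X]big_mkcond -sumrB.
apply: sumr_ge0 => i _.
have hlt : (i < k)%N -> c <= la i by move=> ik; apply/ltW/laP.
have hge : (k <= i)%N -> la i <= c.
  rewrite leq_eqVlt => /orP[/eqP ki|ki]; last exact/ltW/laP.
  by rewrite /c; have -> : Ordinal kn = i by apply: val_inj.
case: ltnP => [/hlt|/hge]; case: ifP => _; lia.
Qed.

Lemma domD n (a b c e : {ffun 'I_n -> int}) : dom a b -> dom c e ->
  dom [ffun i => a i + c i] [ffun i => b i + e i].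
Proof.
move=> [d1 s1] [d2 s2]; split=> [k|].
  under eq_bigr => i _ do rewrite ffunE.
  under [leRHS]eq_bigr => i _ do rewrite ffunE.
  by rewrite !big_split lerD.
under eq_bigr => i _ do rewrite ffunE.
under [RHS]eq_bigr => i _ do rewrite ffunE.
by rewrite !big_split /= s1 s2.
Qed.

Lemma sort_perm n (nu : {ffun 'I_n -> int}) : injective nu ->
  exists s : 'S_n, forall i j : 'I_n, (i < j)%N -> nu (s j) < nu (s i).
Proof.
move=> nu_inj; pose r (i j : 'I_n) := nu j < nu i.
pose le (i j : 'I_n) := nu j <= nu i.
pose sq := sort le (enum 'I_n).
have sz : size sq = n by rewrite size_sort size_enum_ord.
have uq : uniq sq by rewrite sort_uniq enum_uniq.
pose f (i : 'I_n) := tnth (in_tuple sq) (cast_ord (esym sz) i).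
have f_inj : injective f.
  move=> i j /eqP; rewrite /f !(tnth_nth i) /= nth_uniq ?sz ?ltn_ord //.
  by move=> /eqP/val_inj.
exists (perm f_inj) => i j ij; rewrite !permE.
have le_tr : transitive le by move=> a b e; rewrite /le => ba eb; apply: le_trans ba.
have srt : sorted le sq by apply: sort_sorted => a b; apply: le_total.
have := sorted_ltn_nth le_tr i srt.
move=> /(_ i j); rewrite !inE sz !ltn_ord => /(_ isT isT ij).
rewrite /le /f !(tnth_nth i) /= lt_neqAle => ->; rewrite andbT.
apply/eqP => /nu_inj/eqP; rewrite nth_uniq ?sz ?ltn_ord //.
by rewrite gtn_eqF.
Qed.

(** * Highest weights *)

(** The pairing with delta = (n-1, ..., 1, 0), a height function on weights. *)
Definition dlt n (nu : {ffun 'I_n -> int}) : int := \sum_(i < n) (n.-1 - i)%:Z * nu i.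

(** The rest of the argument is algebraic: X represents the Lie algebra of all
    matrices, and mu a is the weight of the a-th vector of the standard basis.
    The symmetry of the multiset of weights is taken as a hypothesis; for a
    representation of the group it comes from the permutation matrices. *)
Section Weights.
Variables (C : numClosedFieldType) (d n : nat).
Variable mu : 'I_d -> {ffun 'I_n -> int}.
Variable X : 'M[C]_n -> 'M[C]_d.
Hypothesis X_lin : forall a A B, X (a *: A + B) = a *: X A + X B.
Hypothesis X_br : forall A B,
  X (A *m B - B *m A) = X A *m X B - X B *m X A.
Hypothesis X_diag : forall i,
  X (delta_mx i i) = diag_mx (\row_a (mu a i)%:~R).
Hypothesis X_irr : forall U : 'M[C]_d,
  (forall A, stablemx U (X A)) -> U != 0 -> row_full U.
Hypothesis d_gt0 : (0 < d)%N.
Hypothesis mu_sym : forall (s : 'S_n) (nu : {ffun 'I_n -> int}),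
  #|[set a | mu a == [ffun i => nu (s i)]]| = #|[set a | mu a == nu]|.

Let E i j := X (delta_mx i j).

Let X0 : X 0 = 0.
Proof. by have := X_lin (-1) 0 0; rewrite scaler0 add0r scaleN1r addNr. Qed.

Let XD A B : X (A + B) = X A + X B.
Proof. by have := X_lin 1 A B; rewrite !scale1r. Qed.

Let XZ a A : X (a *: A) = a *: X A.
Proof. by have := X_lin a A 0; rewrite !addr0 X0 addr0. Qed.

Let XN A : X (- A) = - X A.
Proof. by rewrite -scaleN1r XZ scaleN1r. Qed.

Let XMn A k : X (A *+ k) = X A *+ k.
Proof. by rewrite -scaler_nat XZ scaler_nat. Qed.

Let Ebr i j k l : E i j *m E k l - E k l *m E i j =
  E i l *+ (j == k) - E k j *+ (l == i).
Proof. by rewrite -X_br !mul_delta_mx_cond XD XN !XMn. Qed.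

(** The elementary matrices are eigenvectors of the diagonal ones under the
    bracket, so X (delta_mx i j) maps a weight vector to a vector of the weight
    shifted by e_j - e_i (matrices act on row vectors). *)
Lemma root_shift i j a b : E i j a b != 0 ->
  forall k, mu b k = mu a k - (k == i)%:R + (k == j)%:R.
Proof.
move=> Eab k.
have /matrixP/(_ a b) := Ebr k k i j.
rewrite [E k k]X_diag mul_diag_mx mul_mx_diag !mxE !mulmxnE.
have -> : E k j a b *+ (k == i) = (k == i)%:R * E i j a b.
  by case: eqP => [->|_]; rewrite ?mul1r ?mulr1n ?mul0r.
have -> : E i k a b *+ (j == k) = (k == j)%:R * E i j a b.
  by rewrite eq_sym; case: eqP => [->|_]; rewrite ?mul1r ?mulr1n ?mul0r.
rewrite [E i j a b * _]mulrC -!mulrBl => /(mulIf Eab) /eqP.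
rewrite subr_eq => /eqP h; apply: (@intr_inj C).
rewrite rmorphD rmorphB /= h !rmorph_nat; ring.
Qed.

Lemma dlt_shift i j a b : E i j a b != 0 ->
  dlt (mu b) = dlt (mu a) - (n.-1 - i)%:Z + (n.-1 - j)%:Z.
Proof.
move=> /root_shift h; rewrite /dlt.
under eq_bigr => k _ do rewrite h mulrDr mulrBr.
rewrite big_split sumrB /=; congr (_ - _ + _).
  rewrite (bigD1 i) //= eqxx mulr1 big1 ?addr0 // => k /negPf ->.
  by rewrite mulr0.
rewrite (bigD1 j) //= eqxx mulr1 big1 ?addr0 // => k /negPf ->.
by rewrite mulr0.
Qed.

Lemma X_stable (U : 'M[C]_d) : (forall i j, stablemx U (E i j)) ->
  forall A, stablemx U (X A).
Proof.
move=> EU A.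
rewrite [A]matrix_sum_delta (big_morph X XD X0).
apply: (big_ind (fun f => stablemx U f)); first exact: stablemx0.
  exact: stablemxD.
move=> i _; rewrite (big_morph X XD X0).
apply: (big_ind (fun f => stablemx U f)); first exact: stablemx0.
  exact: stablemxD.
by move=> j _; rewrite XZ -scalemxAr; apply/scalemx_sub/EU.
Qed.

(** A vector killed by the raising operators generates the whole space under
    the lowering operators alone: the subspace W that they generate is stable
    under the other ones, since commuting an operator past a lowering one only
    creates brackets, which are again elementary or diagonal operators. *)
Lemma lowering_full (a0 : 'I_d) (U : 'M[C]_d) :
  (forall a, dlt (mu a) <= dlt (mu a0)) ->
  ((delta_mx 0 a0 : 'rV_d) <= U)%MS ->
  (forall i j : 'I_n, (i < j)%N -> stablemx U (E i j)) ->
  row_full U.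
Proof.
move=> amax vU EU.
pose v : 'rV[C]_d := delta_mx 0 a0.
pose PW (w : 'rV_d) := forall V : 'M[C]_d, (v <= V)%MS ->
  (forall i j : 'I_n, (i < j)%N -> stablemx V (E i j)) -> (w <= V)%MS.
have [W WP] : exists W : 'M[C]_d, forall w : 'rV_d, (w <= W)%MS <-> PW w.
  apply: subspace_of_pred => [V _ _|a u w Pu Pw V vV EV]; first exact: sub0mx.
  by rewrite addmx_sub ?scalemx_sub ?Pu ?Pw.
have vW : (v <= W)%MS by apply/WP => V.
have EW (i j : 'I_n) : (i < j)%N -> stablemx W (E i j).
  move=> ij; apply/stablemxP_vec => w /WP wW; apply/WP => V vV EV.
  by have /stablemxP_vec := EV _ _ ij; apply; apply: wW.
(* W' collects the vectors that the diagonal and raising operators keep in W;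
   it contains v and is stable under lowering, hence contains W. *)
pose PW' (w : 'rV_d) := (w <= W)%MS /\
  forall k l : 'I_n, (l <= k)%N -> (w *m E k l <= W)%MS.
have [W' WP'] : exists W : 'M[C]_d, forall w : 'rV_d, (w <= W)%MS <-> PW' w.
  apply: subspace_of_pred => [|a u w [u1 u2] [w1 w2]].
    by split=> [|k l _]; rewrite ?mul0mx sub0mx.
  split=> [|k l lk]; first by rewrite addmx_sub ?scalemx_sub.
  by rewrite mulmxDl -scalemxAl addmx_sub ?scalemx_sub ?u2 ?w2.
have vW' : (v <= W')%MS.
  apply/WP'; split=> // k l; rewrite leq_eqVlt => /orP[/eqP/val_inj ->|lk].
    rewrite [E k k]X_diag.
    suff -> : v *m diag_mx (\row_a (mu a k)%:~R) = (mu a0 k)%:~R *: v.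
      exact: scalemx_sub.
    rewrite mul_mx_diag; apply/rowP => b; rewrite !mxE /= mulrC.
    by case: eqP => [->|_]; rewrite ?mulr0.
  suff -> : v *m E k l = 0 by apply: sub0mx.
  rewrite -rowE; apply/rowP => b; rewrite !mxE; apply/eqP.
  apply: contraT => Eb; have := amax b; rewrite (dlt_shift Eb).
  by have := ltn_ord k; have := ltn_ord l; lia.
have EW' (i j : 'I_n) : (i < j)%N -> stablemx W' (E i j).
  move=> ij; apply/stablemxP_vec => w /WP' [w1 w2]; apply/WP'.
  have wE (k l : 'I_n) : (w *m E k l <= W)%MS.
    case: (ltnP k l) => [kl|]; last exact: w2.
    by have /stablemxP_vec := EW _ _ kl; apply.
  split=> // k l lk; rewrite -mulmxA.
  have -> : E i j *m E k l =
     E k l *m E i j + (E i l *+ (j == k) - E k j *+ (l == i)).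
    by rewrite -Ebr addrC subrK.
  rewrite mulmxDr addmx_sub //.
    by rewrite mulmxA; have /stablemxP_vec := EW _ _ ij; apply.
  rewrite mulmxBr addmx_sub // ?eqmx_opp //.
    by case: (j == k); rewrite ?mulr1n ?mulr0n ?mulmx0 ?sub0mx.
  by case: (l == i); rewrite ?mulr1n ?mulr0n ?mulmx0 ?sub0mx.
have WW' : (W <= W')%MS.
  by apply/row_subP => i; have /WP := row_sub i W; apply.
have fW : row_full W.
  apply: X_irr.
    apply: X_stable => k l; apply/stablemxP_vec => w wW.
    have [kl|lk] := ltnP k l.
      by have /stablemxP_vec := EW _ _ kl; apply.
    by have /WP' [_] := submx_trans wW WW'; apply.
  apply: contraL vW => /eqP ->; rewrite submx0.
  apply/eqP => /rowP/(_ a0); rewrite !mxE !eqxx => /eqP.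
  by rewrite oner_eq0.
rewrite -sub1mx; apply: (@submx_trans _ _ _ _ _ _ W); first exact: submx_full.
by apply/row_subP => i; have /WP := row_sub i W; apply.
Qed.

(** The vectors supported on a0 and on the weights dominated by that of a0 and
    of smaller height form a subspace that is stable under the lowering
    operators and contains e_a0, hence everything. *)
Lemma highest_weight : exists a0 : 'I_d, forall a,
  dom (mu a) (mu a0) /\ (a = a0 \/ dlt (mu a) < dlt (mu a0)).
Proof.
pose o : 'I_d := Ordinal d_gt0.
pose a0 := [arg max_(a > o) dlt (mu a)]%O.
have amax a : dlt (mu a) <= dlt (mu a0).
  by rewrite /a0; case: arg_maxP => //= i _; apply.
exists a0.
pose good b := dom (mu b) (mu a0) /\ (b = a0 \/ dlt (mu b) < dlt (mu a0)).
have [U UP] : exists U : 'M[C]_d, forall w : 'rV_d,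
    (w <= U)%MS <-> (forall b, w 0 b != 0 -> good b).
  apply: subspace_of_pred => [b|a u w Pu Pw b]; first by rewrite mxE eqxx.
  rewrite !mxE; have [->|ub _] := eqVneq (u 0 b) 0; last exact: Pu.
  by rewrite mulr0 add0r; apply: Pw.
have fU : row_full U.
  apply: (@lowering_full a0) => //.
    apply/UP => b; rewrite mxE /=.
    case: (b =P a0) => [-> _|]; last by rewrite eqxx.
    by split; [split|left].
  move=> i j ij; apply/stablemxP_vec => w /UP wU; apply/UP => b.
  rewrite mxE => wb.
  have [a /andP[wa Eab]] : exists a, (w 0 a != 0) && (E i j a b != 0).
    apply/existsP; apply: contraR wb => /existsPn h; apply/eqP/big1 => a _.
    by have := h a; rewrite negb_and !negbK => /orP[]/eqP ->;
      rewrite ?mul0r ?mulr0.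
  have [[ha hs] hd] := wU _ wa; split; first split.
  - move=> k; apply: le_trans (ha k).
    under eq_bigr => x _ do rewrite (root_shift Eab).
    rewrite big_split sumrB /= -addrA gerDl.
    have sm (z : 'I_n) : \sum_(x < n | (x < k)%N) (x == z)%:R = (z < k)%N%:R :> int.
      have [zk|kz] := ltnP z k.
        rewrite (bigD1 z) //= eqxx big1 ?addr0 // => x /andP[_ /negPf ->] //.
      rewrite big1 // => x xk; case: eqP => // xz.
      by move: xk; rewrite xz ltnNge kz.
    by rewrite !sm; case: (ltnP i k); case: (ltnP j k) => //; lia.
  - rewrite -hs; under eq_bigr => x _ do rewrite (root_shift Eab).
    rewrite big_split sumrB /=.
    have sm (z : 'I_n) : \sum_(x < n) (x == z)%:R = 1 :> int.
      by rewrite (bigD1 z) //= eqxx big1 ?addr0 // => x /negPf ->.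
    by rewrite !sm subrK.
  - right; rewrite (dlt_shift Eab); apply: lt_le_trans (amax a).
    by have := ltn_ord j; lia.
move=> a; have /UP h : ((delta_mx 0 a : 'rV_d) <= U)%MS by apply: submx_full.
by apply: h; rewrite mxE !eqxx oner_eq0.
Qed.

(** * The Casimir operator and Weyl's character formula *)

(** The sum of the E_ij E_ji commutes with every E_kl, the brackets cancelling
    in pairs; an eigenspace is then stable, hence everything. *)
Lemma casimir_scalar : exists c, \sum_i \sum_j E i j *m E j i = c%:M.
Proof.
set Cas := \sum_i _.
have comm k l : comm_mx Cas (E k l).
  apply/eqP; rewrite eq_sym -subr_eq0 /Cas mulmx_sumr mulmx_suml -sumrB.
  under eq_bigr => i _.
    rewrite mulmx_sumr mulmx_suml -sumrB.
    under eq_bigr => j _.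
      have -> : E k l *m (E i j *m E j i) - E i j *m E j i *m E k l =
        (E k l *m E i j - E i j *m E k l) *m E j i +
        E i j *m (E k l *m E j i - E j i *m E k l).
        by rewrite mulmxBl mulmxBr !mulmxA addrA subrK.
      rewrite !Ebr mulmxBl mulmxBr.
      over.
    rewrite big_split /= !sumrB.
    over.
  rewrite big_split /= !sumrB.
  have s1 : \sum_i \sum_j (E k j *+ (l == i)) *m E j i = \sum_j E k j *m E j l.
    rewrite (bigD1 l) //= eqxx [X in _ + X]big1 ?addr0 // => i.
    rewrite eq_sym => /negPf ->; apply: big1 => j _.
    by rewrite mulr0n mul0mx.
  have s2 : \sum_i \sum_j (E i l *+ (j == k)) *m E j i = \sum_i E i l *m E k i.
    apply: eq_bigr => i _.
    rewrite (bigD1 k) //= eqxx [X in _ + X]big1 ?addr0 // => j /negPf ->.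
    by rewrite mulr0n mul0mx.
  have s3 : \sum_i \sum_j E i j *m (E k i *+ (l == j)) = \sum_i E i l *m E k i.
    apply: eq_bigr => i _.
    rewrite (bigD1 l) //= eqxx [X in _ + X]big1 ?addr0 // => j.
    by rewrite eq_sym => /negPf ->; rewrite mulr0n mulmx0.
  have s4 : \sum_i \sum_j E i j *m (E j l *+ (i == k)) = \sum_j E k j *m E j l.
    rewrite (bigD1 k) //= eqxx [X in _ + X]big1 ?addr0 // => i /negPf ->.
    by apply: big1 => j _; rewrite mulr0n mulmx0.
  by rewrite s1 s2 s3 s4 addrA subrK subrr.
have [c cP] := eigenvalue_closed Cas d_gt0; exists c.
have : row_full (eigenspace Cas c).
  apply: X_irr cP; apply: X_stable => k l.
  exact: comm_mx_stable_eigenspace.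
rewrite -sub1mx => /eigenspaceP.
by rewrite mul1mx scalemx1.
Qed.

Lemma mu_sum a b : \sum_i mu a i = \sum_i mu b i.
Proof.
by have [a0 h] := highest_weight; have [[_ ->] _] := h a; have [[_ ->] _] := h b.
Qed.

Lemma mu_perm (s : 'S_n) a : exists b, mu b = [ffun i => mu a (s i)].
Proof.
have : (0 < #|[set b | mu b == mu a]|)%N.
  by apply/card_gt0P; exists a; rewrite inE.
by rewrite -(mu_sym s) => /card_gt0P[b]; rewrite inE => /eqP hb; exists b.
Qed.

Section Trace.
Variable t : nat -> C.
Hypothesis t_neq0 : forall i : 'I_n, t i != 0.
Hypothesis t_reg : forall i j : 'I_n, i != j -> t i != t j.

Let tau a := \prod_(i < n) t i ^ mu a i.
Let T : 'M[C]_d := diag_mx (\row_a tau a).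

(** Conjugation by the torus element T multiplies E_ij by t_i / t_j. *)
Let tau_shift i j a b : E i j a b != 0 -> tau a * t j = t i * tau b.
Proof.
move=> Eab; have sh := root_shift Eab.
have -> : tau b = tau a * (\prod_(k < n) t k ^ (- ((k == i)%:R : int)) *
                           \prod_(k < n) t k ^ ((k == j)%:R : int)).
  rewrite -!big_split; apply: eq_bigr => k _ /=.
  by rewrite sh expfzDr // expfzDr // mulrA.
rewrite (bigD1 i) //= [X in _ * X * _]big1 ?mulr1 => [|k /negPf ->]; last first.
  by rewrite oppr0 expr0z.
rewrite (bigD1 j) //= big1 ?mulr1 => [|k /negPf ->]; last by rewrite expr0z.
have -> : t i ^ (- ((i == i)%:R : int)) = (t i)^-1 by rewrite eqxx exprN1.
have -> : t j ^ ((j == j)%:R : int) = t j by rewrite eqxx expr1z.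
by field.
Qed.

(** Move T past E_ij, use cyclicity of the trace, and replace E_ij E_ji by
    E_ji E_ij + E_ii - E_jj: this gives an equation for the trace. *)
Let trE i j : \tr (T *m E i j *m E j i) * (t i - t j) =
  t i * \sum_a (mu a i - mu a j)%:~R * tau a.
Proof.
set x := \tr _.
have shift : t j *: (T *m E i j) = t i *: (E i j *m T).
  apply/matrixP => a b; rewrite mul_diag_mx mul_mx_diag !mxE.
  have [->|Eab] := eqVneq (E i j a b) 0; first by rewrite mul0r !mulr0.
  by rewrite mulrA [t j * _]mulrC (tau_shift Eab) mulrAC mulrA.
have xj : t j * x = t i * \tr (T *m E j i *m E i j).
  rewrite /x -mxtraceZ scalemxAl shift -scalemxAl mxtraceZ; congr (_ * _).
  by rewrite -mulmxA mxtrace_mulC.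
have E2 : E i j *m E j i = E j i *m E i j + (E i i - E j j).
  by have := Ebr i j j i; rewrite !eqxx !mulr1n => <-; rewrite addrC subrK.
have xs : x = \tr (T *m E j i *m E i j) +
    \sum_a (mu a i - mu a j)%:~R * tau a.
  rewrite /x -mulmxA E2 mulmxDr mxtraceD mulmxA; congr (_ + _).
  rewrite ![E _ _]X_diag -linearB /= mulmx_diag mxtrace_diag.
  by apply: eq_bigr => a _; rewrite !mxE -rmorphB /= mulrC.
by move: xj; rewrite xs => xj; rewrite mulrBr [_ * t j]mulrC xj; ring.
Qed.

Let S i := \sum_(j < n | j != i) t i / (t i - t j).

(** Exchange i and j and use t_i / (t_i - t_j) + t_j / (t_j - t_i) = 1. *)
Let sum_roots (m : 'I_n -> C) :
  \sum_i \sum_(j < n | j != i) (m i - m j) * (t i / (t i - t j)) =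
  2 * (\sum_i m i * S i) - n.-1%:R * \sum_i m i.
Proof.
have -> : \sum_i \sum_(j < n | j != i) (m i - m j) * (t i / (t i - t j)) =
   \sum_i m i * S i -
   \sum_i \sum_(j < n | j != i) m j * (t i / (t i - t j)).
  rewrite -sumrB; apply: eq_bigr => i _; rewrite mulr_sumr -sumrB.
  by apply: eq_bigr => j _; rewrite mulrBl.
rewrite [X in _ - X](exchange_big_dep predT) //=.
have -> : \sum_j \sum_(i < n | j != i) m j * (t i / (t i - t j)) =
   n.-1%:R * (\sum_i m i) - \sum_i m i * S i.
  rewrite mulr_sumr -sumrB; apply: eq_bigr => j _.
  rewrite -mulr_sumr [_ * m j]mulrC -mulrBr; congr (_ * _).
  have -> : n.-1%:R = \sum_(i < n | j != i) 1 :> C.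
    rewrite sumr_const; congr (_ *+ _).
    rewrite -[in LHS](card_ord n) -(cardC1 j); apply: eq_card => i.
    by rewrite -!topredE /= eq_sym.
  rewrite /S [X in _ - X](eq_bigl (fun i => j != i)) => [|i];
    last by rewrite eq_sym.
  rewrite -sumrB; apply: eq_bigr => i ji.
  have h1 : t i - t j != 0 by rewrite subr_eq0 t_reg // eq_sym.
  have h2 : t j - t i != 0 by rewrite subr_eq0 t_reg.
  by field; rewrite h1 h2.
by ring.
Qed.

(** The trace of T times the Casimir operator, computed in two ways. *)
Let casimir_trace c : \sum_i \sum_j E i j *m E j i = c%:M ->
  c * \sum_a tau a =
  \sum_a tau a * ((\sum_i mu a i ^+ 2)%:~R +
     2 * (\sum_i (mu a i)%:~R * S i) - n.-1%:R * (\sum_i mu a i)%:~R).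
Proof.
move=> cP.
have -> : c * \sum_a tau a = \tr (T *m c%:M).
  rewrite mul_mx_scalar mxtraceZ mxtrace_diag; congr (_ * _).
  by apply: eq_bigr => a _; rewrite mxE.
rewrite -cP mulmx_sumr raddf_sum /=.
have tij i j : j != i -> \tr (T *m (E i j *m E j i)) =
   \sum_a tau a * (((mu a i)%:~R - (mu a j)%:~R) * (t i / (t i - t j))).
  move=> ji; have h : t i - t j != 0 by rewrite subr_eq0 t_reg // eq_sym.
  apply: (mulIf h); rewrite mulmxA trE mulr_sumr mulr_suml.
  by apply: eq_bigr => a _; rewrite rmorphB /=; field.
have tii i : \tr (T *m (E i i *m E i i)) = \sum_a tau a * (mu a i ^+ 2)%:~R.
  rewrite [E i i]X_diag !mulmx_diag mxtrace_diag; apply: eq_bigr => a _.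
  by rewrite !mxE rmorphXn /= expr2.
have -> : \sum_i \tr (T *m (\sum_j E i j *m E j i)) =
   \sum_i \sum_a tau a * ((mu a i ^+ 2)%:~R + \sum_(j < n | j != i)
      ((mu a i)%:~R - (mu a j)%:~R) * (t i / (t i - t j))).
  apply: eq_bigr => i _; rewrite mulmx_sumr raddf_sum /= (bigD1 i) //= tii.
  rewrite (eq_bigr _ (fun j ji => tij i j ji)) exchange_big -big_split /=.
  by apply: eq_bigr => a _; rewrite -mulr_sumr mulrDr.
rewrite exchange_big; apply: eq_bigr => a _ /=.
rewrite -mulr_sumr; congr (_ * _); rewrite big_split /= sum_roots.
by rewrite -addrA !rmorph_sum.
Qed.

(** The product rule with logarithmic derivatives q i at x. *)
Let deriv_prod (I : Type) (s : seq I) (P : pred I) (p : I -> {poly C}) q x :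
  (forall i, P i -> (p i)^`().[x] = (p i).[x] * q i) ->
  (\prod_(i <- s | P i) p i)^`().[x] =
  (\prod_(i <- s | P i) p i).[x] * \sum_(i <- s | P i) q i.
Proof.
move=> h; elim/big_rec2: _ => [|i y z Pi IH]; first by rewrite derivC hornerC mulr0.
by rewrite derivM !hornerE h // IH; ring.
Qed.

(** S i is the logarithmic derivative t_i d/dt_i of the Vandermonde product,
    which is also an alternating sum of monomials. *)
Let vdm_deriv (i : 'I_n) : S i * vdm n t =
  \sum_(w : 'S_n) (-1) ^+ w * (n.-1 - w i)%:R * \prod_(k < n) t k ^+ (n.-1 - w k).
Proof.
pose u (k : nat) : {poly C} := if k == i then 'X else (t k)%:P.
have u_t k : (u k).[t i] = t k.
  by rewrite /u; case: eqP => [->|_]; rewrite !hornerE.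
have vdm_u : (vdm n u).[t i] = vdm n t.
  rewrite -/(horner_eval _ _) rmorph_vdm; apply: eq_vdm => k _.
  exact: u_t.
have d1 : (vdm n u)^`().[t i] = vdm n t * \sum_(j < n | j != i) (t i - t j)^-1.
  pose q (a b : nat) : C := (a == i)%:R / (t i - t b) + (b == i)%:R / (t i - t a).
  rewrite (@deriv_prod _ _ _ _ (fun b : 'I_n => \sum_(a < b) q a b)); last first.
    move=> b _; apply: deriv_prod => a _.
    have ab : (a : nat) != b by rewrite ltn_eqF.
    have an : (a < n)%N by apply: ltn_trans (ltn_ord b).
    have tab : t a - t b != 0.
      by rewrite subr_eq0 (t_reg (i := Ordinal an)).
    rewrite derivB !hornerE !u_t /u /q.
    have T1 : true%:R = 1 :> C by [].
    have F1 : false%:R = 0 :> C by [].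
    have [ai|ai] := eqVneq (a : nat) i.
      have -> : (b == i :> nat) = false by rewrite -ai eq_sym; apply: negPf.
      rewrite derivX derivC !hornerE -ai ?T1 ?F1 ?mul0r ?addr0 ?mul1r ?subr0 ?divff //.
    have [bi|bi] := eqVneq (b : nat) i; last first.
      rewrite !derivC !hornerE ?F1.
      by rewrite /= oppr0 mulr0 mul0r.
    rewrite derivX derivC !hornerE -bi ?T1 ?F1 ?mul0r ?mul1r ?add0r ?sub0r.
    have tba : t b - t a != 0 by rewrite -opprB oppr_eq0.
    by rewrite /=; field.
  rewrite vdm_u; congr (_ * _).
  have -> : \sum_(b < n) \sum_(a < b) q a b =
      \sum_(b < n) \sum_(a < n | (a < b)%N) q a b.
    apply: eq_bigr => b _.
    by rewrite (big_ord_widen_cond n predT (fun a => q a b)) 1?ltnW.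
  rewrite /q; under eq_bigr => b _ do rewrite big_split /=.
  rewrite big_split /= addrC (bigD1 i) //= [X in _ + X + _]big1; last first.
    by move=> b; rewrite -val_eqE /= => /negPf bi; apply: big1 => a _;
       rewrite bi mul0r.
  rewrite (exchange_big_dep predT) //= [X in _ + X](bigD1 i) //=.
  rewrite [X in _ + (_ + X)]big1; last first.
    by move=> b; rewrite -val_eqE /= => /negPf bi; apply: big1 => a _;
       rewrite bi mul0r.
  rewrite !addr0 eqxx.
  rewrite [RHS](bigID (fun j : 'I_n => (j < i)%N)) /=; congr (_ + _).
    apply: eq_big => [j|j _]; last by rewrite mul1r.
    by rewrite -val_eqE /= ltn_neqAle; case: eqP.
  apply: eq_big => [j|j _]; last by rewrite mul1r.
  by rewrite -val_eqE /= -leqNgt ltn_neqAle eq_sym.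
have -> : S i = t i * \sum_(j < n | j != i) (t i - t j)^-1 by rewrite mulr_sumr.
rewrite -mulrA [X in t i * X]mulrC -d1 vdm_det /determinant.
rewrite raddf_sum horner_sum mulr_sumr; apply: eq_bigr => w _ /=.
have -> : (-1) ^+ w = ((-1) ^+ w)%:P :> {poly C} by rewrite rmorphXn rmorphN1.
rewrite mul_polyC derivZ hornerZ mulrCA -mulrA; congr (_ * _).
rewrite (bigD1 i) //= [in RHS](bigD1 i) //= !mxE {1}/u eqxx.
have -> : \prod_(k < n | k != i) powmx n (subn n.-1) u k (w k) =
   (\prod_(k < n | k != i) t k ^+ (n.-1 - w k))%:P.
  rewrite rmorph_prod; apply: eq_bigr => k /negPf ki.
  by rewrite mxE /u val_eqE ki rmorphXn.
rewrite derivM derivC mulr0 addr0 derivXn hornerM hornerC !hornerMn hornerXn.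
rewrite -mulr_natl !mulrA; congr (_ * _).
case: (n.-1 - w i)%N => [|k] /=; first by rewrite !mul0r mulr0 mul0r.
by rewrite exprS; ring.
Qed.

(** The exponents that occur in the product of the alternating sum over
    w delta with the character. *)
Definition shifted (w : 'S_n) a : {ffun 'I_n -> int} :=
  [ffun i => (n.-1 - w i)%:Z + mu a i].

(** The equation of [casimir_trace] times the Vandermonde product: completing
    the square, the coefficient of each exponent becomes the difference of its
    squared norm and of a constant. *)
Lemma casimir_shifted c : \sum_i \sum_j E i j *m E j i = c%:M ->
  forall a0,
  \sum_(w : 'S_n) \sum_a (-1) ^+ w * ((nrm2 (shifted w a))%:~R -
    (c + n.-1%:R * (\sum_i mu a0 i)%:~R + (\sum_(i < n) (n.-1 - i)%:Z ^+ 2)%:~R))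
    * \prod_(i < n) t i ^ shifted w a i = 0.
Proof.
move=> cP a0; set N := _%:~R; set D2 := _%:~R.
pose tw (w : 'S_n) := \prod_(i < n) t i ^+ (n.-1 - w i).
have e0 : \sum_(w : 'S_n) (-1) ^+ w * tw w * (\sum_a tau a *
   ((\sum_i mu a i ^+ 2)%:~R + 2 * (\sum_i (mu a i)%:~R * S i) -
    n.-1%:R * (\sum_i mu a i)%:~R - c)) = 0.
  rewrite -mulr_suml.
  under [X in _ * X]eq_bigr => a _ do rewrite mulrBr.
  by rewrite sumrB -(casimir_trace cP) -mulr_suml [c * _]mulrC subrr mulr0.
have vE : \sum_(w : 'S_n) (-1) ^+ w * tw w = vdm n t.
  rewrite vdm_det; apply: eq_bigr => w _; congr (_ * _).
  by apply: eq_bigr => k _; rewrite mxE.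
rewrite exchange_big /=.
rewrite -mulr_suml vE mulr_sumr in e0; rewrite -[RHS]e0.
apply: eq_bigr => a _.
transitivity (tau a * \sum_(w : 'S_n) (-1) ^+ w *
   ((nrm2 (shifted w a))%:~R - (c + n.-1%:R * N + D2)) * tw w).
  rewrite mulr_sumr; apply: eq_bigr => w _; rewrite mulrCA; congr (_ * _).
  rewrite -big_split; apply: eq_bigr => i _ /=.
  by rewrite ffunE expfzDr // mulrC.
rewrite mulrCA; congr (_ * _).
have nE w : (nrm2 (shifted w a))%:~R = (\sum_i mu a i ^+ 2)%:~R + D2 +
    2 * \sum_i (mu a i)%:~R * (n.-1 - w i)%:R :> C.
  have -> : D2 = (\sum_i (n.-1 - w i)%:Z ^+ 2)%:~R.
    by rewrite /D2 (reindex_inj (@perm_inj _ w)).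
  rewrite !rmorph_sum -big_split mulr_sumr -big_split; apply: eq_bigr => i _ /=.
  by rewrite ffunE !rmorphXn rmorphD /= -pmulrn; ring.
rewrite (mu_sum a a0) -/N.
transitivity (\sum_(w : 'S_n) ((-1) ^+ w * tw w *
     ((\sum_i mu a i ^+ 2)%:~R - n.-1%:R * N - c) +
   2 * \sum_i (mu a i)%:~R * ((-1) ^+ w * (n.-1 - w i)%:R * tw w))).
  apply: eq_bigr => w _; rewrite nE.
  have -> : \sum_i (mu a i)%:~R * ((-1) ^+ w * (n.-1 - w i)%:R * tw w) =
     (-1) ^+ w * tw w * \sum_i (mu a i)%:~R * (n.-1 - w i)%:R.
    rewrite mulr_sumr; apply: eq_bigr => i _.
    by move: ((-1) ^+ w) => sg; ring.
  by move: ((-1) ^+ w) => sg; ring.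
rewrite big_split /= -mulr_suml vE -mulr_sumr exchange_big /=.
under [X in _ + 2 * X]eq_bigr => i _ do rewrite -mulr_sumr -vdm_deriv mulrA.
by rewrite -mulr_suml; ring.
Qed.

End Trace.

(** The coefficient of the exponent nu in the product of the Vandermonde
    determinant with the character. *)
Let fsum (nu : {ffun 'I_n -> int}) : int :=
  \sum_(p : 'S_n * 'I_d | shifted p.1 p.2 == nu) (-1) ^+ p.1.

(** The characters of the torus are linearly independent, so each term of
    [casimir_shifted] vanishes on its own. *)
Let fsum_casimir : exists kappa : C, forall nu, fsum nu != 0 ->
  (nrm2 nu)%:~R = kappa.
Proof.
have [c cP] := casimir_scalar; have [a0 _] := highest_weight.
exists (c + n.-1%:R * (\sum_i mu a0 i)%:~R + (\sum_(i < n) (n.-1 - i)%:Z ^+ 2)%:~R).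
move=> nu; set kappa := (X in _ = X) => f0.
have := @torus_char_indep C n ('S_n * 'I_d)%type (fun p => shifted p.1 p.2)
  (fun p => (-1) ^+ p.1 * ((nrm2 (shifted p.1 p.2))%:~R - kappa)).
move=> /(_ _ nu) h; apply/eqP; rewrite -subr_eq0.
have : ((nrm2 nu)%:~R - kappa) * (fsum nu)%:~R = 0.
  rewrite -[RHS]h.
    rewrite /fsum [X in _ * X]rmorph_sum /= mulr_sumr; apply: eq_bigr => p /eqP <-.
    by rewrite mulrC rmorphXn rmorphN1.
  move=> t t1 treg.
  have t0 (i : 'I_n) : t i != 0 by rewrite -normr_eq0 t1 oner_eq0.
  by apply: etrans (casimir_shifted t0 treg cP a0); rewrite pair_bigA.
by move=> /eqP; rewrite mulf_eq0 intr_eq0 (negPf f0) orbF.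
Qed.

(** The Vandermonde determinant is alternating and the character symmetric. *)
Let fsum_perm (s : 'S_n) (nu : {ffun 'I_n -> int}) :
  fsum [ffun i => nu (s i)] = (-1) ^+ s * fsum nu.
Proof.
have fE (nu' : {ffun 'I_n -> int}) : fsum nu' = \sum_(w : 'S_n) (-1) ^+ w *+
    #|[set a | mu a == [ffun i => nu' i - (n.-1 - w i)%:Z]]|.
  rewrite /fsum -(pair_big_dep predT (fun w a => shifted w a == nu')
                    (fun w _ => (-1) ^+ w)).
  apply: eq_bigr => w _; rewrite sumr_const; congr (_ *+ _).
  apply: eq_card => a; rewrite inE -[LHS]/(shifted w a == nu').
  apply/eqP/eqP => [<-|muE].
    by apply/ffunP => i; rewrite !ffunE addrAC subrr add0r.
  by apply/ffunP => i; rewrite ffunE muE ffunE addrC subrK.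
rewrite !fE (reindex_inj (mulgI s)) mulr_sumr; apply: eq_bigr => w _ /=.
rewrite odd_permM signr_addb -mulrnAr; congr (_ * (_ *+ _)).
rewrite -[RHS](mu_sym s); apply: eq_card => a; rewrite !inE; congr (_ == _).
by apply/ffunP => i; rewrite !ffunE permM.
Qed.

(** Weyl's formula, as an identity between formal sums of exponents. Both
    sides are alternating, so it suffices to compare the coefficients of
    strictly decreasing exponents; by [fsum_casimir] and [dom_sdec_eq] the only
    one that occurs is l = delta + (highest weight), with coefficient 1. *)
Theorem weyl_character : exists l : {ffun 'I_n -> int},
  (forall i j : 'I_n, (i < j)%N -> l j < l i) /\
  forall (R : pzRingType) (G : {ffun 'I_n -> int} -> R),
    \sum_(w : 'S_n) \sum_a (-1) ^+ w * G (shifted w a) =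
    \sum_(w : 'S_n) (-1) ^+ w * G [ffun i => l (w i)].
Proof.
have [a0 hw] := highest_weight.
pose dl : {ffun 'I_n -> int} := [ffun i : 'I_n => (n.-1 - i)%:Z].
have dlP (i j : 'I_n) : (i < j)%N -> dl j < dl i.
  by rewrite !ffunE; have := ltn_ord j; lia.
pose l := shifted 1 a0.
have lE : l = [ffun i => dl i + mu a0 i].
  by apply/ffunP => i; rewrite !ffunE perm1.
have dltE nu : dlt nu = \sum_i dl i * nu i.
  by apply: eq_bigr => i _; rewrite ffunE.
have la_dec (i j : 'I_n) : (i < j)%N -> mu a0 j <= mu a0 i.
  move=> ij; have [b bE] := mu_perm (tperm i j) a0.
  have : dlt (mu b) <= dlt (mu a0) by have [_ [->|/ltW]] := hw b.
  have ji : j != i by rewrite eq_sym neq_ltn ij.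
  rewrite !dltE bE (bigD1 i) //= (bigD1 j) //= [leRHS](bigD1 i) //=.
  rewrite [X in _ <= _ + X](bigD1 j) //= !addrA.
  rewrite [X in _ + X <= _](eq_bigr (fun k => dl k * mu a0 k)); last first.
    move=> k /andP[ki kj]; by rewrite !ffunE tpermD // eq_sym.
  rewrite lerD2r !ffunE tpermL tpermR => h.
  have := ltn_ord j; nia.
have lP (i j : 'I_n) : (i < j)%N -> l j < l i.
  by move=> ij; rewrite lE [ltLHS]ffunE [ltRHS]ffunE ltr_leD ?dlP ?la_dec.
have l_inj : injective l.
  move=> i j lij; apply/val_inj; case: (ltngtP i j) => // /lP;
  by rewrite lij ltxx.
have dl_inj : injective dl.
  move=> i j lij; apply/val_inj; case: (ltngtP i j) => // /dlP;
  by rewrite lij ltxx.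
have fl : fsum l = 1.
  rewrite /fsum (big_pred1 (1%g, a0)) /= ?odd_perm1 // => -[w a] /=.
  rewrite xpair_eqE; apply/eqP/andP => [slE|[/eqP -> /eqP ->] //].
  have sE i : dl (w i) + mu a i = dl i + mu a0 i.
    by have /ffunP/(_ i) := slE; rewrite lE !ffunE.
  have h1 : \sum_i dl i * dl (w i) <= \sum_i dl i * dl i.
    have h2 : 0 <= \sum_i (dl i - dl (w i)) ^+ 2.
      by apply: sumr_ge0 => i _; apply: sqr_ge0.
    have h3 : \sum_i dl i * dl i = \sum_i dl (w i) * dl (w i).
      by rewrite (reindex_inj (@perm_inj _ w)).
    have h4 : \sum_i (dl i - dl (w i)) ^+ 2 = \sum_i dl i * dl i +
       \sum_i dl (w i) * dl (w i) - (\sum_i dl i * dl (w i)) *+ 2.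
      rewrite -sumrMnl -big_split -sumrB; apply: eq_bigr => i _ /=; ring.
    by rewrite h4 -h3 in h2; lia.
  have h2 : \sum_i dl i * dl (w i) + dlt (mu a) =
            \sum_i dl i * dl i + dlt (mu a0).
    rewrite !dltE -!big_split; apply: eq_bigr => i _ /=.
    by rewrite -!mulrDr sE.
  have aa0 : a = a0.
    by have [_ [//|hlt]] := hw a; lia.
  split; last by rewrite aa0.
  apply/eqP/permP => i; rewrite perm1; apply: dl_inj.
  by have := sE i; rewrite aa0 => /addIr.
have [kappa kP] := fsum_casimir.
have nrmE nu : fsum nu != 0 -> nrm2 nu = nrm2 l.
  by move=> /kP h; apply: (@intr_inj C); rewrite h -(kP l) // fl oner_eq0.
pose gsum (nu : {ffun 'I_n -> int}) : int := \sum_(w : 'S_n | [ffun i => l (w i)] == nu) (-1) ^+ w.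
have gsum_perm (s : 'S_n) (nu : {ffun 'I_n -> int}) :
    gsum [ffun i => nu (s i)] = (-1) ^+ s * gsum nu.
  rewrite /gsum (reindex_inj (mulgI s)) mulr_sumr; apply: eq_big => w.
    apply/eqP/eqP => [/ffunP h|/ffunP h]; apply/ffunP => i.
      by have := h (s^-1 i)%g; rewrite !ffunE permM permKV.
    by have := h (s i); rewrite !ffunE permM.
  by rewrite odd_permM signr_addb.
have gl : gsum l = 1.
  rewrite /gsum (big_pred1 1%g) ?odd_perm1 // => w.
  apply/eqP/eqP => [/ffunP h|->]; last by apply/ffunP => i; rewrite ffunE perm1.
  by apply/permP => i; rewrite perm1; apply: l_inj; have := h i; rewrite ffunE.
have f_dec (nu : {ffun 'I_n -> int}) : (forall i j : 'I_n, (i < j)%N -> nu j < nu i) ->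
    fsum nu != 0 -> nu = l.
  move=> nuP f0; apply: dom_sdec_eq => //; last exact: nrmE.
  have [p /eqP <-] : exists p : 'S_n * 'I_d, shifted p.1 p.2 == nu.
    apply/existsP; apply: contraR f0 => /existsPn h.
    by rewrite /fsum big_pred0 // => p; apply: negPf (h p).
  have -> : shifted p.1 p.2 =
     [ffun i => [ffun j => dl (p.1 j)] i + mu p.2 i].
    by apply/ffunP => i; rewrite !ffunE.
  rewrite lE; apply: domD; first exact: dom_perm.
  by have [] := hw p.2.
have g_dec (nu : {ffun 'I_n -> int}) : (forall i j : 'I_n, (i < j)%N -> nu j < nu i) ->
    gsum nu != 0 -> nu = l.
  move=> nuP g0.
  have [w /eqP wE] : exists w : 'S_n, [ffun i => l (w i)] == nu.
    apply/existsP; apply: contraR g0 => /existsPn h.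
    by rewrite /gsum big_pred0 // => p; apply: negPf (h p).
  apply: dom_sdec_eq => //; rewrite -wE; first exact: dom_perm.
  rewrite /nrm2 [RHS](reindex_inj (@perm_inj _ w)).
  by apply: eq_bigr => i _; rewrite ffunE.
have fgE (nu : {ffun 'I_n -> int}) : fsum nu = gsum nu.
  have [/injectiveP nu_inj|/injectivePn [i [j ij nuij]]] :=
      boolP (injectiveb nu); last first.
    have tn : [ffun k => nu (tperm i j k)] = nu.
      by apply/ffunP => k; rewrite ffunE; case: tpermP => [->|->|].
    have f0 : fsum nu = - fsum nu.
      by rewrite -{1}tn fsum_perm odd_tperm ij mulN1r.
    have g0 : gsum nu = - gsum nu.
      by rewrite -{1}tn gsum_perm odd_tperm ij mulN1r.
    by lia.
  have [s sP] := sort_perm nu_inj.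
  pose nu' := [ffun i => nu (s i)].
  have nu'P (i j : 'I_n) : (i < j)%N -> nu' j < nu' i.
    by move=> ij; rewrite !ffunE sP.
  suff : fsum nu' = gsum nu'.
    rewrite fsum_perm gsum_perm => /(congr1 (fun x => (-1) ^+ s * x)).
    by rewrite !mulrA -!signr_addb !addbb !mul1r.
  have [f0|f0] := eqVneq (fsum nu') 0; last first.
    by rewrite (f_dec nu' nu'P f0) fl gl.
  have [g0|g0] := eqVneq (gsum nu') 0; first by rewrite f0 g0.
  by rewrite (g_dec nu' nu'P g0) fl gl.
exists l; split=> // R G.
have := @eq_fibers ('S_n * 'I_d)%type 'S_n _ R (fun p => shifted p.1 p.2)
  (fun w => [ffun i => l (w i)]) (fun p => (-1) ^+ p.1) (fun w => (-1) ^+ w) G fgE.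
rewrite pair_bigA /= => h.
transitivity (\sum_(p : 'S_n * 'I_d) ((-1) ^+ p.1)%:~R * G (shifted p.1 p.2)).
  by apply: eq_bigr => p _; rewrite rmorphXn rmorphN1.
by rewrite h; apply: eq_bigr => w _; rewrite rmorphXn rmorphN1.
Qed.

End Weights.

Local Open Scope complex_scope.

(** * Real-valued norms of complex numbers and matrices *)

Section Norms.
Variable R : realType.
Notation C := R[i].

(** The modulus as an element of R, where the order is total and linear
    arithmetic is available. *)
Definition cn (z : C) : R := complex.Re `|z|.

Lemma cnE z : (cn z)%:C = `|z|.
Proof. by rewrite RRe_real ?normr_real. Qed.

Lemma cn_ge0 z : 0 <= cn z.
Proof. by rewrite -lecR cnE normr_ge0. Qed.

Lemma cn_eq0 z : cn z = 0 -> z = 0.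
Proof. by move=> h; apply/eqP; rewrite -normr_eq0 -cnE h. Qed.

Lemma cnD x y : cn (x + y) <= cn x + cn y.
Proof. by rewrite -lecR rmorphD /= !cnE ler_normD. Qed.

Lemma cnM x y : cn (x * y) = cn x * cn y.
Proof. by apply: complexI; rewrite rmorphM /= !cnE normrM. Qed.

Lemma cnN x : cn (- x) = cn x.
Proof. by rewrite /cn normrN. Qed.

Lemma cn0 : cn 0 = 0.
Proof. by rewrite /cn normr0. Qed.

Lemma cn1 : cn 1 = 1.
Proof. by rewrite /cn normr1. Qed.

Lemma cnR (x : R) : cn x%:C = `|x|.
Proof. by rewrite /cn normc_def /= expr0n addr0 sqrtr_sqr. Qed.

Lemma cn_sum (I : Type) (s : seq I) (P : pred I) (F : I -> C) :
  cn (\sum_(i <- s | P i) F i) <= \sum_(i <- s | P i) cn (F i).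
Proof.
elim/big_rec2: _ => [|i x y _ h]; first by rewrite cn0.
by apply: le_trans (cnD _ _) _; rewrite lerD2l.
Qed.

Lemma cn_le_ReIm z : cn z <= `|complex.Re z| + `|complex.Im z|.
Proof.
rewrite {1}[z]complexE; apply: le_trans (cnD _ _) _.
rewrite cnM !cnR; have -> : cn 'i%C = 1; last by rewrite mul1r.
by rewrite /cn normc_def /= expr0n expr1n add0r sqrtr1.
Qed.

Lemma Re_le_cn z : `|complex.Re z| <= cn z.
Proof. by rewrite -lecR cnE normc_ge_Re. Qed.

Lemma Im_le_cn z : `|complex.Im z| <= cn z.
Proof.
have := Re_le_cn (z * 'i%C); rewrite cnM ReiNIm normrN.
have -> : cn 'i%C = 1; last by rewrite mulr1.
by rewrite /cn normc_def /= expr0n expr1n add0r sqrtr1.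
Qed.

(** The entrywise l1 norm, which is submultiplicative. *)
Definition mn m n (A : 'M[C]_(m, n)) : R := \sum_i \sum_j cn (A i j).

Lemma mn_ge0 m n (A : 'M[C]_(m, n)) : 0 <= mn A.
Proof. by apply: sumr_ge0 => i _; apply: sumr_ge0 => j _; apply: cn_ge0. Qed.

Lemma cn_le_mn m n (A : 'M[C]_(m, n)) i j : cn (A i j) <= mn A.
Proof.
rewrite /mn (bigD1 i) //= (bigD1 j) //= -addrA lerDl addr_ge0 //.
  by apply: sumr_ge0 => *; apply: cn_ge0.
by apply: sumr_ge0 => *; apply: sumr_ge0 => *; apply: cn_ge0.
Qed.

Lemma mn_eq0 m n (A : 'M[C]_(m, n)) : mn A = 0 -> A = 0.
Proof.
move=> h; apply/matrixP => i j; rewrite mxE; apply: cn_eq0; apply/eqP.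
by rewrite eq_le cn_ge0 andbT -h cn_le_mn.
Qed.

Lemma mnD m n (A B : 'M[C]_(m, n)) : mn (A + B) <= mn A + mn B.
Proof.
rewrite /mn -big_split; apply: ler_sum => i _; rewrite -big_split.
by apply: ler_sum => j _; rewrite mxE cnD.
Qed.

Lemma mnN m n (A : 'M[C]_(m, n)) : mn (- A) = mn A.
Proof.
by apply: eq_bigr => i _; apply: eq_bigr => j _; rewrite mxE cnN.
Qed.

Lemma mnB m n (A B : 'M[C]_(m, n)) : mn (A - B) <= mn A + mn B.
Proof. by apply: le_trans (mnD _ _) _; rewrite mnN. Qed.

Lemma mnZ m n a (A : 'M[C]_(m, n)) : mn (a *: A) = cn a * mn A.
Proof.
rewrite /mn mulr_sumr; apply: eq_bigr => i _; rewrite mulr_sumr.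
by apply: eq_bigr => j _; rewrite mxE cnM.
Qed.

Lemma mnM m n p (A : 'M[C]_(m, n)) (B : 'M[C]_(n, p)) :
  mn (A *m B) <= mn A * mn B.
Proof.
rewrite /mn mulr_suml; apply: ler_sum => i _.
apply: (@le_trans _ _ (\sum_j \sum_k cn (A i k) * cn (B k j))).
  apply: ler_sum => j _; rewrite mxE; apply: le_trans (cn_sum _ _ _) _.
  by apply: ler_sum => k _; rewrite cnM.
rewrite exchange_big mulr_suml; apply: ler_sum => k _ /=.
rewrite -mulr_sumr ler_wpM2l ?cn_ge0 //.
rewrite [leRHS](bigD1 k) //= lerDl.
by apply: sumr_ge0 => l _; apply: sumr_ge0 => j _; apply: cn_ge0.
Qed.

Lemma mn_diag n (t : 'rV[C]_n) : mn (diag_mx t) = \sum_i cn (t 0 i).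
Proof.
apply: eq_bigr => i _; rewrite (bigD1 i) //= big1 ?addr0 => [|j /negPf ji].
  by rewrite mxE eqxx mulr1n.
by rewrite mxE eq_sym ji mulr0n cn0.
Qed.

Lemma mn_scalar1 n : mn (1%:M : 'M[C]_n) = n%:R.
Proof.
rewrite -diag_const_mx mn_diag; under eq_bigr => i _ do rewrite mxE cn1.
by rewrite sumr_const card_ord.
Qed.

Lemma unitary_entry n (u : 'M[C]_n) i j : u \is unitarymx -> cn (u i j) <= 1.
Proof.
move=> /unitarymxP/matrixP/(_ i i); rewrite !mxE eqxx => h.
rewrite -lecR cnE -(@expr_le1 _ 2) // -[leRHS]h (bigD1 j) //= !mxE.
rewrite -normCK lerDl; apply: sumr_ge0 => k _.
by rewrite !mxE -normCK exprn_ge0.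
Qed.

Lemma mn_unitary n (u : 'M[C]_n) : u \is unitarymx -> mn u <= n%:R ^+ 2.
Proof.
move=> uU; apply: (@le_trans _ _ (\sum_(i < n) \sum_(j < n) 1)).
  by apply: ler_sum => i _; apply: ler_sum => j _; apply: unitary_entry.
by rewrite !sumr_const !card_ord expr2 -mulrnA natrM.
Qed.

Lemma unitary1 n : (1%:M : 'M[C]_n) \is unitarymx.
Proof. by apply/unitarymxP; rewrite trmx1 map_mx1 mulmx1. Qed.

Lemma unitaryM n (u v : 'M[C]_n) :
  u \is unitarymx -> v \is unitarymx -> u *m v \is unitarymx.
Proof. exact: mul_unitarymx. Qed.

Lemma unitaryV n (u : 'M[C]_n) : u \is unitarymx -> invmx u \is unitarymx.
Proof. by move=> uU; rewrite (invmx_unitary uU) trmxC_unitary. Qed.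

End Norms.

(** * The circle *)

Section Circle.
Variable R : realType.
Notation C := R[i].

Definition cis (t : R) : C := cos t +i* sin t.

Lemma cisD s t : cis (s + t) = cis s * cis t.
Proof. by rewrite /cis cosD sinD; simpc; congr (_ +i* _); rewrite addrC. Qed.

Lemma cis0 : cis 0 = 1.
Proof. by rewrite /cis cos0 sin0. Qed.

Lemma cisN t : cis (- t) = (cis t)^-1.
Proof.
apply: (@mulrI _ (cis t)); last first.
  rewrite -cisD subrr cis0 divrr // unitfE; apply/eqP => h.
  by have /eqP := cis0; rewrite -(subrr t) cisD h mul0r eq_sym oner_eq0.
rewrite unitfE; apply/eqP => h.
by have /eqP := cis0; rewrite -(subrr t) cisD h mul0r eq_sym oner_eq0.
Qed.

Lemma cn_cis t : cn (cis t) = 1.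
Proof. by rewrite /cn normc_def /= cos2Dsin2 sqrtr1. Qed.

Lemma norm_cis t : `|cis t| = 1.
Proof. by rewrite -cnE cn_cis. Qed.

Lemma cis_neq0 t : cis t != 0.
Proof. by rewrite -normr_eq0 norm_cis oner_eq0. Qed.

Lemma cis2pi : cis (pi *+ 2) = 1.
Proof. by rewrite /cis cos2pi sin2pi. Qed.

Lemma cis_sum (I : Type) (s : seq I) (P : pred I) (F : I -> R) :
  cis (\sum_(i <- s | P i) F i) = \prod_(i <- s | P i) cis (F i).
Proof. exact: (big_morph cis cisD cis0). Qed.

Lemma cisMn t n : cis (t *+ n) = cis t ^+ n.
Proof. by elim: n => [|n IH]; rewrite ?mulr0n ?cis0 // mulrS cisD IH exprS. Qed.

Lemma cisMz t (k : int) : cis (k%:~R * t) = cis t ^ k.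
Proof.
case: k => n; first by rewrite -pmulrn mulr_natl cisMn.
by rewrite NegzE mulrNz mulNr cisN -pmulrn mulr_natl cisMn.
Qed.

Lemma sin_le (x : R) : `|sin x| <= `|x|.
Proof.
wlog x0 : x / 0 <= x => [h|].
  have [/h //|x0] := leP 0 x; rewrite -normrN -sinN -[`|x|]normrN.
  by apply: h; rewrite oppr_ge0 ltW.
have [c _] := @MVT_segment R sin cos 0 x x0
  (fun y _ => is_derive_sin y) (continuous_subspaceT (@continuous_sin R)).
by rewrite sin0 !subr0 => ->; rewrite normrM ler_piMl // cos_max.
Qed.

Lemma cos1_le (x : R) : `|cos x - 1| <= `|x|.
Proof.
wlog x0 : x / 0 <= x => [h|].
  have [/h //|x0] := leP 0 x; rewrite -cosN -[`|x|]normrN.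
  by apply: h; rewrite oppr_ge0 ltW.
have [c _] := @MVT_segment R cos (fun y => - sin y) 0 x x0
  (fun y _ => is_derive_cos y) (continuous_subspaceT (@continuous_cos R)).
by rewrite cos0 !subr0 => ->; rewrite normrM normrN ler_piMl // sin_max.
Qed.

(** The constants in this and the next bounds are not sharp: only the order of
    vanishing at 0 matters. *)
Lemma cos1_sq (x : R) : `|cos x - 1| <= x ^+ 2.
Proof.
have -> : x = (x / 2) *+ 2 by rewrite -mulr_natr divfK.
set y := x / 2; rewrite cos_mulr2n cos2sin2.
have -> : (1 - sin y ^+ 2) *+ 2 - 1 - 1 = - (sin y ^+ 2 *+ 2) by ring.
rewrite normrN ger0_norm ?mulrn_wge0 ?sqr_ge0 // exprMn_n.
have h : sin y ^+ 2 <= y ^+ 2.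
  rewrite -(real_normK (num_real (sin y))) -(real_normK (num_real y)).
  by rewrite lerXn2r ?nnegrE ?normr_ge0 ?sin_le.
have := sqr_ge0 y; nra.
Qed.

Lemma sin1_sq (x : R) : `|sin x - x| <= x ^+ 2.
Proof.
wlog x0 : x / 0 <= x => [h|].
  have [/h //|x0] := leP 0 x; rewrite -sqrrN -normrN opprB -[x in `|x - _|]opprK.
  rewrite addrC -sinN; apply: h; rewrite oppr_ge0 ltW //.
have dd (y : R) : y \in `]0, x[ -> is_derive y 1 (fun z => sin z - z) (cos y - 1).
  by move=> _; apply: is_deriveB.
have cc : {within `[0, x], continuous (fun z : R => sin z - z)}%classic.
  apply: continuous_subspaceT => z; apply: cvgB; first exact: continuous_sin.
  exact: cvg_id.
have [c /itvP cx] := @MVT_segment R (fun z => sin z - z) (fun y => cos y - 1)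
   0 x x0 dd cc.
rewrite sin0 !subr0 => ->; rewrite normrM expr2 [`|x|]ger0_norm //.
rewrite ler_wpM2r //; apply: le_trans (cos1_le c) _.
by rewrite ger0_norm cx.
Qed.

Lemma cis1_le x : cn (cis x - 1) <= `|x| *+ 2.
Proof.
apply: le_trans (cn_le_ReIm _) _ => /=.
by rewrite subr0 mulr2n lerD ?cos1_le ?sin_le.
Qed.

Lemma cis2_le x : cn (cis x - 1 - 0 +i* x) <= x ^+ 2 *+ 2.
Proof.
apply: le_trans (cn_le_ReIm _) _ => /=.
by rewrite !subr0 mulr2n lerD ?cos1_sq ?sin1_sq.
Qed.

Lemma cis_surj z : cn z = 1 -> exists t, z = cis t.
Proof.
move=> z1.
have z2 : complex.Re z ^+ 2 + complex.Im z ^+ 2 = 1.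
  by apply: complexI; rewrite add_Re2_Im2 -cnE z1 expr1n.
have Re1 : -1 <= complex.Re z <= 1 by rewrite -ler_norml -z1 Re_le_cn.
pose t := acos (complex.Re z).
have ct : cos t = complex.Re z by apply: acosK; rewrite in_itv.
have st : sin t = `|complex.Im z|.
  by rewrite sin_acos // -z2 addrC addKr sqrtr_sqr.
have [i0|i0] := leP 0 (complex.Im z).
  by exists t; rewrite /cis ct st ger0_norm //; case: (z).
exists (- t); rewrite /cis cosN sinN ct st ltr0_norm // opprK.
by case: (z).
Qed.

Lemma cis_surj_half z : cn z = 1 -> 0 < complex.Re z ->
  exists t, - (pi / 2) < t < pi / 2 /\ z = cis t.
Proof.
move=> z1 Re0.
have z2 : complex.Re z ^+ 2 + complex.Im z ^+ 2 = 1.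
  by apply: complexI; rewrite add_Re2_Im2 -cnE z1 expr1n.
have Im1 : -1 < complex.Im z < 1 by rewrite -ltr_norml -sqrtr1 -sqrtr_sqr ltr_sqrt //; nra.
have /andP[Im1a Im1b] := Im1.
have Im2 : -1 <= complex.Im z <= 1 by rewrite !ltW.
exists (asin (complex.Im z)); split.
  by rewrite asin_gtNpi2 ?asin_ltpi2 // ?Im1a ?Im1b ltW.
rewrite /cis cos_asin // asinK ?in_itv //= -z2 addrK sqrtr_sqr gtr0_norm //.
by case: (z).
Qed.

Lemma cis_eq1 x : cis x = 1 -> exists k : int, x = k%:~R * (pi *+ 2).
Proof.
move=> x1; pose k := Num.floor (x / (pi *+ 2)).
have p0 : 0 < pi *+ 2 :> R by rewrite pmulrn_lgt0 // pi_gt0.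
exists k; pose y := x - k%:~R * (pi *+ 2).
have y1 : cis y = 1.
  by rewrite /y cisD x1 mul1r -mulNr -mulrNz cisMz cis2pi exp1rz.
have /andP[fl1 fl2] := floor_itv (x / (pi *+ 2)).
have y_ge0 : 0 <= y.
  by rewrite subr_ge0 -ler_pdivlMr.
have y_lt : y < pi *+ 2.
  rewrite ltrBlDl -[X in _ + X]mul1r -mulrDl -ltr_pdivrMr // addrC.
  by move: fl2; rewrite rmorphD /= addrC.
have [y0|] := eqVneq y 0; first by apply/eqP; rewrite -subr_eq0 -/y y0.
rewrite neq_lt ltNge y_ge0 /= => y_gt0.
have sy : 0 < sin (y / 2).
  rewrite sin_gt0_pi // divr_gt0 //= ltr_pdivrMr // mulr_natr //.
have cy : cos ((y / 2) *+ 2) = 1 by rewrite -mulr_natr divfK //; case: y1.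
by exfalso; move: cy; rewrite cos_mulr2n cos2sin2; nra.
Qed.

Lemma dyadic_small (dl : R) : 0 < dl -> exists m, pi *+ 2 / 2 ^+ m < dl.
Proof.
move=> dl0; exists (Num.truncn (pi *+ 2 / dl)).+1.
rewrite ltr_pdivrMr ?exprn_gt0 // mulrC -ltr_pdivrMr //.
apply: lt_le_trans (truncnS_gt _) _.
by rewrite -natrX ler_nat ltnW // ltn_expl.
Qed.

(** Close to 0 the values have positive real part, which singles out one of the
    two square roots when the argument is halved. So chi agrees with some
    x |-> cis (ka * x) at the dyadic multiples of 2 pi, hence everywhere by
    continuity, and ka is an integer because 2 pi is a period. *)
Lemma circle_char (chi : R -> C) :
  (forall s t, chi (s + t) = chi s * chi t) -> chi (pi *+ 2) = 1 ->
  (forall e : R, 0 < e -> exists2 dl : R, 0 < dl &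
     forall s, `|s| < dl -> cn (chi s - 1) < e) ->
  exists k : int, forall s, chi s = cis (k%:~R * s).
Proof.
move=> chiD chi2pi chi_cont.
have p0 : 0 < pi *+ 2 :> R by rewrite pmulrn_lgt0 // pi_gt0.
have chi0 : chi 0 = 1 by rewrite -[LHS]mulr1 -chi2pi -chiD add0r.
have chiMn s m : chi (s *+ m) = chi s ^+ m.
  by elim: m => [|m IH]; rewrite ?mulr0n ?chi0 // mulrS chiD IH exprS.
have small := dyadic_small.
have [dl dl0 dlP] := chi_cont 1 ltr01.
have Re_gt0 s : `|s| < dl -> 0 < complex.Re (chi s).
  move=> /dlP h; have := le_lt_trans (Re_le_cn _) h.
  by rewrite raddfB /= ltr_norml => /andP[]; lra.
have [m0 m0P] := small dl dl0.
pose s j : R := pi *+ 2 / 2 ^+ m0 / 2 ^+ j.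
have s_gt0 j : 0 < s j by rewrite !divr_gt0 ?exprn_gt0.
have s_le j : s j <= s 0.
  by rewrite /s expr0 divr1 ler_pdivrMr ?exprn_gt0 // ler_peMr ?exprn_ege1 //
       ?ler1n // ltW // divr_gt0 ?exprn_gt0.
have s_dl j : `|s j| < dl.
  rewrite gtr0_norm //; apply: le_lt_trans (s_le j) _.
  by rewrite /s expr0 divr1.
have s0E : s 0 *+ (2 ^ m0)%N = pi *+ 2.
  by rewrite -[LHS]mulr_natr /s expr0 divr1 natrX divfK // expf_neq0.
have sS j : s j.+1 *+ 2 = s j.
  by rewrite -[LHS]mulr_natr /s exprS invfM -mulrA [_ * 2]mulrAC mulVf ?mul1r.
have cn_s0 : cn (chi (s 0)) = 1.
  apply/eqP; rewrite -(@pexpr_eq1 _ _ (2 ^ m0)%N) ?expn_gt0 ?cn_ge0 //.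
  have cnX z m : cn (z ^+ m) = cn z ^+ m.
    by elim: m => [|m IH]; rewrite ?expr0 ?cn1 // !exprS cnM IH.
  by rewrite -cnX -chiMn s0E chi2pi cn1.
have [al [/andP[al1 al2] alE]] := cis_surj_half cn_s0 (Re_gt0 _ (s_dl 0)).
have halve (x : R) j : - (pi / 2) < x < pi / 2 -> 
    - (pi / 2) < x / 2 ^+ j < pi / 2.
  rewrite -!ltr_norml => h; rewrite normrM; apply: le_lt_trans h.
  by rewrite ler_piMr // ger0_norm ?invr_ge0 ?exprn_ge0 // invf_le1
       ?exprn_gt0 // exprn_ege1 // ler1n.
have chi_s j : chi (s j) = cis (al / 2 ^+ j).
  elim: j => [|j IH]; first by rewrite expr0 divr1.
  have hS : al / 2 ^+ j.+1 *+ 2 = al / 2 ^+ j.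
    by rewrite exprS -mulr_natr invfM mulrA mulrAC divfK.
  have : chi (s j.+1) ^+ 2 = cis (al / 2 ^+ j.+1) ^+ 2.
    by rewrite -chiMn sS IH -cisMn hS.
  move=> /eqP; rewrite eqf_sqr => /orP[/eqP //|/eqP eN].
  have := Re_gt0 _ (s_dl j.+1); rewrite eN /=.
  have : 0 < cos (al / 2 ^+ j.+1).
    by apply/cos_gt0_pihalf/halve; rewrite al1.
  by move=> h1; rewrite oppr_gt0 => /(lt_trans h1); rewrite ltxx.
pose ka := al / s 0.
have kaE j : al / 2 ^+ j = ka * s j.
  have sE : s j = s 0 / 2 ^+ j by rewrite /s expr0 divr1.
  by rewrite sE /ka mulrA divfK ?gt_eqF.
pose psi x := chi x * cis (- (ka * x)).
have psiD x y : psi (x + y) = psi x * psi y.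
  by rewrite /psi chiD mulrDr opprD cisD; ring.
have psi_s j m : psi (s j *+ m) = 1.
  have h1 : psi (s j) = 1 by rewrite /psi chi_s kaE -cisD subrr cis0.
  elim: m => [|m IH]; last by rewrite mulrS psiD h1 IH mulr1.
  by rewrite mulr0n /psi chi0 mulr0 oppr0 cis0 mulr1.
have psi_cont (e : R) : 0 < e -> exists2 dl : R, 0 < dl &
     forall x, `|x| < dl -> cn (psi x - 1) < e.
  move=> e0; have e2 : 0 < e / 2 by rewrite divr_gt0.
  have [d1 d10 d1P] := chi_cont _ e2.
  pose d2 := e / 2 / (`|ka| *+ 2 + 1).
  have q0 : 0 < `|ka| *+ 2 + 1 by rewrite ltr_wpDl // mulrn_wge0.
  have d20 : 0 < d2 by rewrite divr_gt0.
  exists (Num.min d1 d2); first by rewrite lt_min d10.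
  move=> x; rewrite lt_min => /andP[x1 x2].
  have -> : psi x - 1 = (chi x - 1) * cis (- (ka * x)) + (cis (- (ka * x)) - 1).
    by rewrite /psi; ring.
  apply: le_lt_trans (cnD _ _) _; rewrite cnM cn_cis mulr1.
  have := d1P _ x1; have := cis1_le (- (ka * x)); rewrite normrN normrM => h1 h2.
  rewrite /d2 ltr_pdivlMr // in x2.
  have h3 : (`|ka| * `|x|) *+ 2 <= e / 2.
    apply: le_trans (ltW x2).
    by rewrite mulrDr mulr1 mulrnAr [`|x| * _]mulrC lerDl normr_ge0.
  by lra.
have psi_ge0 x : 0 <= x -> psi x = 1.
  move=> x_ge0; suff H (e : R) : 0 < e -> cn (psi x - 1) < e.
    apply/eqP; rewrite -subr_eq0; apply/eqP/cn_eq0/eqP.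
    rewrite eq_le cn_ge0 andbT leNgt; apply/negP => /H.
    by rewrite ltxx.
  move=> e0; have [d1 d10 d1P] := psi_cont e e0.
  have [j jP] := small d1 d10.
  have sj : s j < d1.
    apply: le_lt_trans jP; rewrite /s ler_pM2r ?invr_gt0 ?exprn_gt0 //.
    by rewrite ler_pdivrMr ?exprn_gt0 // ler_peMr ?exprn_ege1 ?ler1n // ltW.
  have xs0 : 0 <= x / s j by rewrite divr_ge0 // ltW.
  pose p := Num.truncn (x / s j); have := truncn_itv xs0; rewrite -/p.
  rewrite ler_pdivlMr // ltr_pdivrMr // -natr1 mulrDl mul1r => /andP[h1 h2].
  have -> : x = (x - s j *+ p) + s j *+ p by rewrite subrK.
  rewrite psiD psi_s mulr1; apply: d1P; rewrite -mulr_natl ger0_norm; lra.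
have psi1 x : psi x = 1.
  have [/psi_ge0 //|x0] := leP 0 x.
  have := psiD x (- x); rewrite subrr psi_ge0 // [psi (- x)]psi_ge0 ?mulr1 //.
  by rewrite oppr_ge0 ltW.
have chiE x : chi x = cis (ka * x).
  have := psi1 x; rewrite /psi cisN => /eqP.
  by rewrite -[_ / _ == _](inj_eq (mulIf (cis_neq0 (ka * x)))) divfK ?cis_neq0 // mul1r => /eqP.
have [k kE] : exists k : int, ka * (pi *+ 2) = k%:~R * (pi *+ 2).
  by apply: cis_eq1; rewrite -chiE.
by exists k => x; rewrite chiE; congr (cis (_ * x)); apply: (mulIf (lt0r_neq0 p0)).
Qed.

End Circle.

(** * Curves of matrices and their velocities at the identity *)

(** Velocity with a quadratic error bound that is uniform in s. The curves
    that are needed have it, and it makes the calculus elementary; the bound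
    on the curve itself makes it stable under products. *)
Definition tang (R : realType) m (c : R -> 'M[R[i]]_m) (A : 'M[R[i]]_m) :=
  exists K : R, (forall s, mn (c s) <= K) /\
    forall s, mn (c s - 1%:M - s%:C *: A) <= K * s ^+ 2.

Section Tangent.
Variables (R : realType) (m : nat).
Notation C := R[i].
Implicit Types (c : R -> 'M[C]_m) (A B : 'M[C]_m).

Lemma tang_lip c A : tang c A -> exists2 K, 0 <= K &
  forall s, mn (c s - 1%:M) <= K * `|s|.
Proof.
move=> [K [K1 K2]]; have K0 : 0 <= K := le_trans (mn_ge0 _) (K1 0).
exists (mn A + K + m%:R); first by rewrite !addr_ge0 ?mn_ge0.
move=> s; have [s1|s1] := leP `|s| 1.
  have -> : c s - 1%:M = (c s - 1%:M - s%:C *: A) + s%:C *: A by rewrite subrK.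
  apply: le_trans (mnD _ _) _; rewrite mnZ cnR.
  have h := K2 s; rewrite -(real_normK (num_real s)) in h.
  have h2 : K * `|s| ^+ 2 <= K * `|s|.
    by rewrite ler_wpM2l // expr2 ler_piMl.
  have h3 : 0 <= m%:R * `|s| by rewrite mulr_ge0.
  by rewrite !mulrDl; lra.
apply: (@le_trans _ _ ((K + m%:R) * 1)).
  by rewrite mulr1; apply: le_trans (mnB _ _) _; rewrite mn_scalar1 lerD2r.
apply: ler_pM => //; [by rewrite addr_ge0|by rewrite -addrA lerDr mn_ge0|exact: ltW].
Qed.

Lemma tang_mul c c' A B : tang c A -> tang c' B ->
  tang (fun s => c s *m c' s) (A + B).
Proof.
move=> tA tB; have [K2' K20 K2P] := tang_lip tB.
move: tA tB => [K [K1 K2]] [L [L1 L2]].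
have K0 : 0 <= K := le_trans (mn_ge0 _) (K1 0).
have L0 : 0 <= L := le_trans (mn_ge0 _) (L1 0).
exists (K * L + L + mn A * K2'); split=> s.
  apply: le_trans (mnM _ _) _; apply: (@le_trans _ _ (K * L)).
    by apply: ler_pM; rewrite ?mn_ge0.
  by rewrite -addrA lerDl addr_ge0 // mulr_ge0 ?mn_ge0.
have -> : c s *m c' s - 1%:M - s%:C *: (A + B) =
   (c s - 1%:M - s%:C *: A) *m c' s + (c' s - 1%:M - s%:C *: B) +
   s%:C *: (A *m (c' s - 1%:M)).
  rewrite !mulmxBl mul1mx mulmxBr mulmx1 scalerBr scalerDr -!scalemxAl.
  move: (c s *m c' s) (c' s) (s%:C *: A) (s%:C *: B) (s%:C *: (A *m c' s)).
  by move=> x1 x2 x3 x4 x5; apply/matrixP => i j; rewrite !mxE; ring.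
apply: le_trans (mnD _ _) _; rewrite [leRHS]mulrDl; apply: lerD.
  apply: le_trans (mnD _ _) _; rewrite mulrDl; apply: lerD => //.
  apply: le_trans (mnM _ _) _; rewrite mulrAC.
  by apply: ler_pM; rewrite ?mn_ge0.
rewrite mnZ cnR; apply: (@le_trans _ _ (`|s| * (mn A * (K2' * `|s|)))).
  rewrite ler_wpM2l //; apply: le_trans (mnM _ _) _.
  by rewrite ler_wpM2l ?mn_ge0.
rewrite -(real_normK (num_real s)) le_eqVlt; apply/orP; left; apply/eqP.
by move: (mn A) `|s| => x y; ring.
Qed.

Lemma tang_scale c A (a : R) : tang c A -> tang (fun s => c (a * s)) (a%:C *: A).
Proof.
move=> [K [K1 K2]]; have K0 : 0 <= K := le_trans (mn_ge0 _) (K1 0).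
exists (K + K * a ^+ 2); split=> s.
  by apply: le_trans (K1 _) _; rewrite lerDl mulr_ge0 ?sqr_ge0.
have := K2 (a * s); rewrite scalerA -rmorphM /= [s * a]mulrC => h.
apply: le_trans h _; rewrite exprMn mulrA ler_wpM2r ?sqr_ge0 //.
by rewrite lerDr.
Qed.

Lemma mn_sandwich k l (g : 'M[C]_(k, m)) (M : 'M[C]_m) (h : 'M[C]_(m, l)) b :
  mn M <= b -> mn (g *m M *m h) <= mn g * mn h * b.
Proof.
move=> Mb; apply: le_trans (mnM _ _) _; rewrite mulrAC.
by apply: ler_pM; rewrite ?mn_ge0 //; apply: le_trans (mnM _ _) _;
  rewrite ler_wpM2l ?mn_ge0.
Qed.

Lemma tang_conj c A (g h : 'M[C]_m) : g *m h = 1%:M -> tang c A ->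
  tang (fun s => g *m c s *m h) (g *m A *m h).
Proof.
move=> gh [K [K1 K2]]; exists (mn g * mn h * K); split=> s.
  exact: mn_sandwich.
have -> : g *m c s *m h - 1%:M - s%:C *: (g *m A *m h) =
   g *m (c s - 1%:M - s%:C *: A) *m h.
  by rewrite !mulmxBr !mulmxBl mulmx1 gh -!scalemxAr -!scalemxAl.
by rewrite -[leRHS]mulrA; apply: mn_sandwich.
Qed.

(** Divide by s and let s tend to 0. *)
Lemma small_eq0 (x K : R) : 0 <= x ->
  (forall s, 0 < s -> s <= 1 -> s * x <= K * s ^+ 2) -> x = 0.
Proof.
move=> x0 H; apply/eqP; rewrite eq_le x0 andbT leNgt; apply/negP => x_gt0.
have K0 : 0 < K.
  by apply: lt_le_trans x_gt0 _; have := H 1 ltr01 (lexx _); rewrite mul1r expr1n mulr1.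
pose s := x / (K + x) / 2.
have Kx : 0 < K + x by rewrite addr_gt0.
have s0 : 0 < s by rewrite !divr_gt0.
have s1 : s <= 1.
  by rewrite /s ler_pdivrMr // mul1r ler_pdivrMr //; lra.
have := H s s0 s1; rewrite expr2 mulrCA ler_pM2l //; apply/negP; rewrite -ltNge.
rewrite /s !mulrA ltr_pdivrMr // ltr_pdivrMr //; nra.
Qed.

Lemma tang_uniq c c' A B : tang c A -> tang c' B ->
  (exists K, forall s, mn (c s - c' s) <= K * s ^+ 2) -> A = B.
Proof.
move=> [K [_ K2]] [L [_ L2]] [M MP].
apply/eqP; rewrite -subr_eq0; apply/eqP/mn_eq0.
apply: (@small_eq0 _ (K + L + M)); first exact: mn_ge0.
move=> s s0 _; rewrite -{1}(gtr0_norm s0) -cnR -mnZ.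
have -> : s%:C *: (A - B) = (c' s - 1%:M - s%:C *: B) -
   (c s - 1%:M - s%:C *: A) + (c s - c' s).
  rewrite scalerBr; move: (c s) (c' s) (s%:C *: A) (s%:C *: B).
  by move=> x1 x2 x3 x4; apply/matrixP => i j; rewrite !mxE; ring.
apply: le_trans (mnD _ _) _; apply: le_trans (lerD (mnB _ _) (lexx _)) _.
by have := K2 s; have := L2 s; have := MP s; rewrite !mulrDl; lra.
Qed.

(** The bracket is the first-order term of a conjugation. *)
Lemma tang_commutator c c' A B : tang c B -> tang c' (- B) -> exists K,
  forall s, `|s| <= 1 ->
  mn (c s *m A *m c' s - A - s%:C *: (B *m A - A *m B)) <= K * s ^+ 2.
Proof.
move=> [K [K1 K2]] [L [L1 L2]].
have K0 : 0 <= K := le_trans (mn_ge0 _) (K1 0).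
have L0 : 0 <= L := le_trans (mn_ge0 _) (L1 0).
exists (K * mn A * L + (m%:R + mn B) * mn A * L + mn (B *m A *m B)) => s s1.
have -> : c s *m A *m c' s - A - s%:C *: (B *m A - A *m B) =
  (c s - 1%:M - s%:C *: B) *m A *m c' s +
  (1%:M + s%:C *: B) *m A *m (c' s - 1%:M - s%:C *: - B) -
  (s ^+ 2)%:C *: (B *m A *m B).
  rewrite scalerN opprK !(mulmxDl, mulNmx, mul1mx, mulmxDr, mulmxN, mulmx1).
  rewrite scalerBr !(=^~ scalemxAl, =^~ scalemxAr).
  rewrite expr2 rmorphM /= -scalerA.
  move: (c s *m A *m c' s) (A *m c' s) (s%:C *: (B *m A *m c' s))
     (s%:C *: (B *m A)) (s%:C *: (A *m B)) (s%:C *: (s%:C *: (B *m A *m B))).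
  by move=> x1 x2 x3 x4 x5 x6; apply/matrixP => i j; rewrite !mxE; ring.
apply: le_trans (mnB _ _) _; rewrite mulrDl; apply: lerD; last first.
  by rewrite mnZ cnR ger0_norm ?sqr_ge0 // mulrC.
apply: le_trans (mnD _ _) _; rewrite mulrDl; apply: lerD.
  apply: le_trans (mnM _ _) _; rewrite mulrAC.
  apply: ler_pM; rewrite ?mn_ge0 //.
  apply: le_trans (mnM _ _) _; rewrite mulrAC.
  by rewrite ler_wpM2r ?mn_ge0.
apply: le_trans (mnM _ _) _; rewrite -[leRHS]mulrA.
apply: ler_pM; rewrite ?mn_ge0 //.
apply: le_trans (mnM _ _) _; rewrite ler_wpM2r ?mn_ge0 //.
apply: le_trans (mnD _ _) _; rewrite mn_scalar1 lerD2l mnZ cnR.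
by rewrite ler_piMl ?mn_ge0.
Qed.

End Tangent.

(** * Continuous representations of the unitary group *)

Lemma interpolation (F : fieldType) (s : seq F) (f : F -> F) :
  exists p : {poly F}, {in s, forall x, p.[x] = f x}.
Proof.
elim: s => [|x s [p pP]]; first by exists 0.
have [xs|xs] := boolP (x \in s).
  by exists p => y; rewrite inE => /orP[/eqP ->|]; apply: pP.
pose q := \prod_(y <- s) ('X - y%:P).
have qx : q.[x] != 0 by rewrite -/(root q x) root_prod_XsubC.
exists (p + ((f x - p.[x]) / q.[x]) *: q) => y.
rewrite inE hornerD hornerZ => /orP[/eqP ->|ys].
  by rewrite divfK // addrC subrK.
have /eqP -> : q.[y] == 0 by rewrite -/(root q y) root_prod_XsubC.
by rewrite mulr0 addr0 pP.
Qed.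

Lemma diag_finite_order (C : numClosedFieldType) d (A : 'M[C]_d) N :
  (0 < N)%N -> iter N (mulmx A) 1%:M = 1%:M -> diagonalizable A.
Proof.
case: d A => [|d] A N_gt0 AN.
  by exists 1%:M; rewrite ?unitmx1 //; apply/is_diag_mxP => -[].
have AX : A ^+ N = 1.
  by rewrite -[RHS]AN; elim: (N) => [|k IH] //=; rewrite exprS IH.
have [z zP] := prim_root_closed C N_gt0.
apply/diagonalizableP; exists [seq z ^+ i | i <- index_iota 0 N].
  rewrite map_inj_in_uniq ?iota_uniq // => i j.
  rewrite !mem_index_iota /= => iN jN /eqP.
  by rewrite (eq_prim_root_expr zP) !modn_small // => /eqP.
rewrite big_map (factor_Xn_sub_1 zP); apply: mxminpoly_min.
by rewrite rmorphB rmorphXn rmorph1 /= horner_mx_X AX subrr.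
Qed.

(** The span of the family is finite dimensional, so finitely many members
    span it; diagonalise those simultaneously. *)
Lemma codiag_family (C : numClosedFieldType) d (I : eqType) (A : I -> 'M[C]_d) :
  (forall i, diagonalizable (A i)) -> (forall i j, comm_mx (A i) (A j)) ->
  exists2 P : 'M[C]_d, P \in unitmx &
    forall i, is_diag_mx (P *m A i *m invmx P).
Proof.
move=> Adiag Acomm.
pose sp (s : seq I) := (\sum_(i <- s) <<mxvec (A i)>>)%MS.
pose S k := `[< exists s, \rank (sp s) = k >].
have exS : exists k, S k by exists (\rank (sp [::])); apply/asboolP; exists [::].
have ubS k : S k -> (k <= d * d)%N.
  by move=> /asboolP[s <-]; apply: rank_leq_row.
have [k /asboolP[s rs] kmax] := ex_maxnP exS ubS.
have sp_all i : (mxvec (A i) <= sp s)%MS.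
  have rle : (\rank (sp (i :: s)) <= \rank (sp s))%N.
    by rewrite rs; apply: kmax; apply/asboolP; exists (i :: s).
  have sub : (sp s <= sp (i :: s))%MS by rewrite /sp big_cons addsmxSr.
  have eqr : (sp (i :: s) <= sp s)%MS.
    have [h1 h2] := mxrank_leqif_sup sub.
    by rewrite -h2 eqn_leq h1 rle.
  apply: submx_trans eqr; rewrite /sp big_cons.
  by apply: submx_trans (addsmxSl _ _); rewrite genmxE.
have [P Punit Pdiag] : codiagonalizable [seq A i | i <- s].
  apply/codiagonalizableP; split.
    by move=> _ _ /mapP[i _ ->] /mapP[j _ ->].
  by move=> _ /mapP[i _ ->].
pose Q (w : 'rV[C]_(d * d)) := is_diag_mx (P *m vec_mx w *m invmx P).
have [U UP] : exists U : 'M[C]_(d * d), forall w : 'rV_(d * d), (w <= U)%MS <-> Q w.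
  apply: subspace_of_pred => [|a u v Qu Qv].
    by rewrite /Q linear0 mulmx0 mul0mx; apply/is_diag_mxP => i j _; rewrite mxE.
  apply/is_diag_mxP => i j ij.
  rewrite linearP /= mulmxDr mulmxDl -scalemxAr -scalemxAl 2!mxE.
  have /is_diag_mxP/(_ _ _ ij) -> := Qu.
  by have /is_diag_mxP/(_ _ _ ij) -> := Qv; rewrite mulr0 addr0.
have spU : (sp s <= U)%MS.
  rewrite /sp big_seq; apply: (big_ind (fun V : 'M[C]_(d * d) => (V <= U)%MS)).
  - exact: sub0mx.
  - by move=> V W VU WU; rewrite addsmx_sub VU.
  move=> i si; rewrite genmxE; apply/UP; rewrite /Q mxvecK.
  have /allP/(_ (A i) (map_f _ si)) := Pdiag.
  by rewrite /= /similar_to /conjmx pinvmxE.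
exists P => // i; have /UP := submx_trans (sp_all i) spU.
by rewrite /Q mxvecK.
Qed.

Section Analysis.
Variables (R : realType) (n d : nat).
Notation C := R[i].
Variable r : 'M[C]_n -> 'M[C]_d.
Hypothesis r_repr : Un_repr r.
Hypothesis r_cont : Un_continuous r.

Lemma repr1 : r 1%:M = 1%:M. Proof. by case: r_repr. Qed.

Lemma reprM u v : u \is unitarymx -> v \is unitarymx -> r (u *m v) = r u *m r v.
Proof. by case: r_repr => _; apply. Qed.

Lemma reprK u : u \is unitarymx -> r u *m r (invmx u) = 1%:M.
Proof.
by move=> uU; rewrite -reprM ?unitaryV // mulmxV ?repr1 // unitarymx_unit.
Qed.

Lemma reprVK u : u \is unitarymx -> r (invmx u) *m r u = 1%:M.
Proof. by move=> uU; apply: mulmx1C; apply: reprK. Qed.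

Lemma repr_unit u : u \is unitarymx -> r u \in unitmx.
Proof. by move=> uU; have /mulmx1_unit [] := reprK uU. Qed.

Lemma reprV u : u \is unitarymx -> r (invmx u) = invmx (r u).
Proof.
move=> uU; rewrite -[RHS]mul1mx -(reprVK uU) mulmxK //; exact: repr_unit.
Qed.

(** Continuity is used at the identity only, and in terms of matrix norms. *)
Lemma repr_cont1 (e : R) : 0 < e -> exists2 dlt : R, 0 < dlt &
  forall h, h \is unitarymx -> mn (h - 1%:M) < dlt -> mn (r h - 1%:M) < e.
Proof.
move=> e0.
have /subspace_continuousP/(_ 1%:M (unitary1 R n)) := r_cont.
pose e' : R := e / (d * d).+1%:R.
have e'0 : 0 < e' by rewrite divr_gt0 // ltr0n.
have e'C : 0 < (e'%:C : C) by rewrite ltcR.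
move=> /cvg_ballP/(_ _ e'C); rewrite near_withinE => /nbhs_ballP[eta /= eta0 H].
have etaE : eta = (complex.Re eta)%:C by rewrite RRe_real // gtr0_real.
exists (complex.Re eta); first by rewrite -ltcR -etaE.
move=> h hU hlt.
have : ball (1%:M : 'M[C^o]_n) eta (h : 'M[C^o]_n).
  split=> // i j; rewrite -ball_normE /= etaE -cnE ltcR.
  apply: le_lt_trans hlt; rewrite -mnN opprB.
  by apply: le_trans (cn_le_mn _ i j); rewrite !mxE.
move=> /H /(_ hU) [_ hb].
apply: (@le_lt_trans _ _ (\sum_(i < d) \sum_(j < d) e')).
  apply: ler_sum => i _; apply: ler_sum => j _.
  have : ball (r 1%:M i j : C^o) e'%:C (r h i j) := hb i j.
  rewrite -ball_normE /= -cnE ltcR repr1 => /ltW.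
  by rewrite -cnN opprB !mxE.
rewrite !sumr_const !card_ord -mulrnA -mulr_natr /e' -mulrA.
rewrite gtr_pMr // mulrC ltr_pdivrMr ?ltr0n // mul1r ltr_nat //.
Qed.

(** Finitely many translates of a neighbourhood of 1 cover the group: sort its
    elements according to the integer parts of their rescaled entries. *)
Lemma repr_bounded : exists2 B : R, 0 < B &
  forall u, u \is unitarymx -> mn (r u) <= B.
Proof.
have [dl dl0 dlP] := repr_cont1 (@ltr01 R).
(* Matrices in the same cell of side eta differ by at most 2 n^2 eta in norm,
   and multiplication by a unitary matrix costs another factor n^2. *)
pose q : R := 1 + n%:R ^+ 4 * 4.
have q0 : 0 < q by rewrite /q; have := exprn_ge0 4 (ler0n R n); lra.
pose eta := dl / q.
have eta0 : 0 < eta by rewrite divr_gt0.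
pose M := (Num.truncn (2 / eta)).+1.
pose cell1 (x : R) : 'I_M := inord (Num.truncn ((x + 1) / eta)).
have cell1P x y : `|x| <= 1 -> `|y| <= 1 -> cell1 x = cell1 y -> `|x - y| <= eta.
  rewrite !ler_norml => /andP[x1 x2] /andP[y1 y2] xy.
  have hM z : -1 <= z -> z <= 1 -> (Num.truncn ((z + 1) / eta) < M)%N.
    move=> z1 z2; rewrite ltnS; apply: le_truncn.
    by rewrite ler_pM2r ?invr_gt0 //; lra.
  have := congr1 val xy; rewrite /cell1 /= !inordK ?hM // => e1.
  have hz z : -1 <= z -> 0 <= (z + 1) / eta by move=> z1; apply: divr_ge0; [lra|exact: ltW].
  have /andP[a1 a2] := truncn_itv (hz x x1).
  have /andP[b1 b2] := truncn_itv (hz y y1).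
  move: a1 a2 b1 b2; rewrite e1; set k := Num.truncn _ => a1 a2 b1 b2.
  rewrite -natr1 in a2 b2.
  rewrite ler_pdivlMr // in a1; rewrite ltr_pdivrMr // in a2.
  rewrite ler_pdivlMr // in b1; rewrite ltr_pdivrMr // in b2.
  by apply/andP; split; lra.
pose cell (u : 'M[C]_n) : {ffun 'I_n * 'I_n -> 'I_M * 'I_M} :=
  [ffun p => (cell1 (complex.Re (u p.1 p.2)), cell1 (complex.Im (u p.1 p.2)))].
have cellP u v : u \is unitarymx -> v \is unitarymx -> cell u = cell v ->
    mn (r u) <= mn (r v) * (d%:R + 1).
  move=> uU vU uv.
  have -> : u = v *m (invmx v *m u).
    by rewrite mulKVmx // unitarymx_unit.
  have wU : invmx v *m u \is unitarymx by exact: unitaryM (unitaryV vU) uU.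
  rewrite reprM //; apply: le_trans (mnM _ _) _.
  rewrite ler_wpM2l ?mn_ge0 //.
  have -> : r (invmx v *m u) = 1%:M + (r (invmx v *m u) - 1%:M).
    by rewrite addrC subrK.
  apply: le_trans (mnD _ _) _; rewrite mn_scalar1 lerD2l ltW //.
  apply: dlP => //.
  have -> : invmx v *m u - 1%:M = invmx v *m (u - v).
    by rewrite mulmxBr mulVmx // unitarymx_unit.
  apply: le_lt_trans (mnM _ _) _.
  have uvb : mn (u - v) <= n%:R ^+ 2 * (eta + eta).
    have -> : n%:R ^+ 2 * (eta + eta) = \sum_(i < n) \sum_(j < n) (eta + eta).
      by rewrite !sumr_const !card_ord -mulrnA -natrX mulr_natl.
    apply: ler_sum => i _; apply: ler_sum => j _.
    apply: le_trans (cn_le_ReIm _) _; rewrite !mxE.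
    have /ffunP/(_ (i, j)) := uv; rewrite !ffunE /= => -[hR hI].
    have [uu vv] := (unitary_entry i j uU, unitary_entry i j vU).
    rewrite !raddfB /=; apply: lerD; apply: cell1P => //.
    - exact: le_trans (Re_le_cn _) uu.
    - exact: le_trans (Re_le_cn _) vv.
    - exact: le_trans (Im_le_cn _) uu.
    - exact: le_trans (Im_le_cn _) vv.
  apply: (@le_lt_trans _ _ (n%:R ^+ 2 * (n%:R ^+ 2 * (eta + eta)))).
    apply: ler_pM => //; rewrite ?mn_ge0 //.
    exact: mn_unitary (unitaryV vU).
  have dlE : dl = eta * q by rewrite /eta divfK // gt_eqF.
  rewrite dlE /q; have := exprn_ge0 4 (ler0n R n).
  have -> : n%:R ^+ 2 * (n%:R ^+ 2 * (eta + eta)) = eta * (n%:R ^+ 4 * 2) by ring.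
  by move=> h; rewrite ltr_pM2l //; lra.
pose good c v := v \is unitarymx /\ cell v = c.
have [rep repP] : exists rep : {ffun 'I_n * 'I_n -> 'I_M * 'I_M} -> 'M[C]_n,
    forall u, u \is unitarymx -> good (cell u) (rep (cell u)).
  have /choice [rep repP] : forall c, exists v, (exists u, good c u) -> good c v.
    move=> c; have [[u cu]|nc] := pselect (exists u, good c u).
      by exists u.
    by exists 1%:M.
  by exists rep => u uU; apply: repP; exists u.
exists (1 + \sum_c mn (r (rep c)) * (d%:R + 1)).
  rewrite ltr_pwDl // sumr_ge0 // => c _.
  by rewrite mulr_ge0 ?mn_ge0 // addr_ge0.
move=> u uU; have [vU cv] := repP u uU.
apply: le_trans (cellP u _ uU vU (esym cv)) _.
rewrite (bigD1 (cell u)) //= addrCA lerDl addr_ge0 // sumr_ge0 // => c _.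
by rewrite mulr_ge0 ?mn_ge0 // addr_ge0.
Qed.

Definition torus (t : 'rV[R]_n) : 'M[C]_n := diag_mx (\row_j cis (t 0 j)).

Lemma torusD s t : torus (s + t) = torus s *m torus t.
Proof.
rewrite /torus mulmx_diag; congr diag_mx; apply/rowP => j.
by rewrite !mxE cisD.
Qed.

Lemma torus0 : torus 0 = 1%:M.
Proof.
rewrite /torus -[RHS]diag_const_mx; congr diag_mx; apply/rowP => j.
by rewrite !mxE cis0.
Qed.

Lemma torus_unitary t : torus t \is unitarymx.
Proof.
apply/unitarymxP; rewrite /torus tr_diag_mx map_diag_mx mulmx_diag.
rewrite -[RHS]diag_const_mx; congr diag_mx; apply/rowP => j.
by rewrite !mxE -normCK norm_cis expr1n.
Qed.

Let rT t := r (torus t).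

Let rTD s t : rT (s + t) = rT s *m rT t.
Proof. by rewrite /rT torusD reprM ?torus_unitary. Qed.

Let rT0 : rT 0 = 1%:M. Proof. by rewrite /rT torus0 repr1. Qed.

Let rT_cont (e : R) : 0 < e -> exists2 dl : R, 0 < dl &
  forall t : 'rV[R]_n, (forall j, `|t 0 j| < dl) -> mn (rT t - 1%:M) < e.
Proof.
move=> /repr_cont1[dl dl0 dlP].
pose d1 := dl / (n * 2).+1%:R.
have d10 : 0 < d1 by rewrite divr_gt0 ?ltr0n.
exists d1 => // t tP; apply: dlP; first exact: torus_unitary.
have -> : torus t - 1%:M = diag_mx (\row_j (cis (t 0 j) - 1)).
  by rewrite -[1%:M]diag_const_mx -linearB /=; congr diag_mx;
     apply/rowP => j; rewrite !mxE.
rewrite mn_diag; apply: (@le_lt_trans _ _ (\sum_(i < n) (d1 *+ 2))).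
  apply: ler_sum => j _; rewrite mxE; apply: le_trans (cis1_le _) _.
  by rewrite lerMn2r /= ltW.
rewrite sumr_const card_ord -mulrnA mulnC -mulr_natr /d1 mulrAC.
by rewrite ltr_pdivrMr ?ltr0n // ltr_pM2l // ltr_nat.
Qed.

(** The torsion points of 2-power order commute and have diagonalizable images,
    being of finite order, so they are diagonalised simultaneously; they are
    dense in the torus, and the off-diagonal entries depend continuously on
    the point. *)
Let rT_diag : exists2 P : 'M[C]_d, P \in unitmx &
  forall t, is_diag_mx (P *m rT t *m invmx P).
Proof.
(* The torsion points with coordinates in (2 pi / 2^m) Z. *)
pose dy (p : nat * {ffun 'I_n -> int}) : 'rV[R]_n :=
  \row_j ((p.2 j)%:~R * (pi *+ 2 / 2 ^+ p.1)).
have p0 : 0 < pi *+ 2 :> R by rewrite pmulrn_lgt0 // pi_gt0.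
have [P Pu Pd] : exists2 P : 'M[C]_d, P \in unitmx &
    forall p, is_diag_mx (P *m rT (dy p) *m invmx P).
  apply: codiag_family => [[m k]|p p']; last first.
    by rewrite /comm_mx -!rTD addrC.
  apply: (@diag_finite_order _ _ _ (2 ^ m)%N); first by rewrite expn_gt0.
  have it N : iter N (mulmx (rT (dy (m, k)))) 1%:M = rT (dy (m, k) *+ N).
    elim: N => [|N IH]; first by rewrite mulr0n rT0.
    by rewrite /= IH -rTD mulrS.
  suff E : torus (dy (m, k) *+ (2 ^ m)%N) = 1%:M by rewrite it /rT E repr1.
  rewrite /torus -[RHS]diag_const_mx; congr diag_mx; apply/rowP => j.
  rewrite mxE mulmxnE mxE /= -[X in cis X]mulr_natr natrX -mulrA divfK ?expf_neq0 //.
  by rewrite cisMz cis2pi exp1rz mxE.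
exists P => // t; apply/is_diag_mxP => a b ab.
suff H (e : R) : 0 < e -> cn ((P *m rT t *m invmx P) a b) < e.
  apply/cn_eq0/eqP; rewrite eq_le cn_ge0 andbT leNgt; apply/negP => /H.
  by rewrite ltxx.
move=> e0; pose q := mn P * mn (rT t) * mn (invmx P) + 1.
have q0 : 0 < q by rewrite ltr_wpDl // !mulr_ge0 ?mn_ge0.
have [dl dl0 dlP] := rT_cont (divr_gt0 e0 q0).
have [m mP] := dyadic_small dl0; set w := pi *+ 2 / 2 ^+ m in mP.
have w0 : 0 < w by rewrite divr_gt0 ?exprn_gt0.
pose k : {ffun 'I_n -> int} := [ffun j => Num.floor (t 0 j / w)].
have tE : rT t - rT (dy (m, k)) = rT t *m (1%:M - rT (dy (m, k) - t)).
  by rewrite mulmxBr mulmx1 -rTD addrCA subrr addr0.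
have sub : mn (1%:M - rT (dy (m, k) - t)) < e / q.
  rewrite -mnN opprB; apply: dlP => j; apply: le_lt_trans mP.
  rewrite !mxE /= ffunE -/w.
  have /andP[] := floor_itv (t 0 j / w); rewrite rmorphD /=.
  rewrite ler_pdivlMr // ltr_pdivrMr // mulrDl mul1r => h1 h2.
  by rewrite ler_norml; lra.
have -> : P *m rT t *m invmx P = P *m rT (dy (m, k)) *m invmx P +
     P *m (rT t - rT (dy (m, k))) *m invmx P.
  by rewrite -mulmxDl -mulmxDr addrC subrK.
rewrite mxE; have /is_diag_mxP/(_ _ _ ab) -> := Pd (m, k); rewrite add0r tE.
apply: le_lt_trans (cn_le_mn _ a b) _.
apply: le_lt_trans (mnM _ _) _.
apply: (@le_lt_trans _ _ (mn P * (mn (rT t) * (e / q)) * mn (invmx P))).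
  rewrite ler_wpM2r ?mn_ge0 //; apply: le_trans (mnM _ _) _.
  rewrite ler_wpM2l ?mn_ge0 //; apply: le_trans (mnM _ _) _.
  by rewrite ler_wpM2l ?mn_ge0 // ltW.
have -> : mn P * (mn (rT t) * (e / q)) * mn (invmx P) = (q - 1) * (e / q).
  by rewrite /q; ring.
by rewrite mulrBl mul1r mulrC divfK ?gt_eqF // ltrBlDr ltrDl divr_gt0.
Qed.

(** Each diagonal entry restricts to a continuous character of each circle
    factor of the torus, so it is a power there. *)
Lemma torus_weights : exists (P : 'M[C]_d) (mu : 'I_d -> {ffun 'I_n -> int}),
  P \in unitmx /\ forall t : 'rV[R]_n, P *m r (torus t) *m invmx P =
     diag_mx (\row_a \prod_i cis (t 0 i) ^ mu a i).
Proof.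
have [P Pu Pd] := rT_diag.
pose Z t := P *m rT t *m invmx P.
pose chi a t := Z t a a.
have ZE t : Z t = diag_mx (\row_a chi a t).
  apply/matrixP => a b; rewrite [RHS]mxE [in RHS]mxE.
  have [->|ab] := eqVneq a b; first by rewrite mulr1n.
  by rewrite mulr0n; have /is_diag_mxP/(_ _ _ ab) -> := Pd t.
have ZD s t : Z (s + t) = Z s *m Z t.
  by rewrite /Z rTD -!mulmxA mulKmx.
have chiD a s t : chi a (s + t) = chi a s * chi a t.
  rewrite {1}/chi ZD !ZE mulmx_diag !mxE eqxx mulr1n.
  by rewrite /chi.
have chi0 a : chi a 0 = 1.
  by rewrite /chi /Z rT0 mulmx1 mulmxV // mxE eqxx.
have chi_cont a (e : R) : 0 < e -> exists2 dl : R, 0 < dl &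
    forall t : 'rV[R]_n, (forall j, `|t 0 j| < dl) -> cn (chi a t - 1) < e.
  move=> e0; pose q := mn P * mn (invmx P) + 1.
  have q0 : 0 < q by rewrite ltr_wpDl // !mulr_ge0 ?mn_ge0.
  have [dl dl0 dlP] := rT_cont (divr_gt0 e0 q0).
  exists dl => // t /dlP tP.
  have -> : chi a t - 1 = (P *m (rT t - 1%:M) *m invmx P) a a.
    rewrite mulmxBr mulmxBl mulmx1 mulmxV // [RHS]mxE; congr (_ + _).
    by rewrite !mxE eqxx.
  apply: le_lt_trans (cn_le_mn _ a a) _.
  apply: le_lt_trans (mnM _ _) _.
  apply: (@le_lt_trans _ _ (mn P * (e / q) * mn (invmx P))).
    rewrite ler_wpM2r ?mn_ge0 //; apply: le_trans (mnM _ _) _.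
    by rewrite ler_wpM2l ?mn_ge0 // ltW.
  have -> : mn P * (e / q) * mn (invmx P) = (q - 1) * (e / q).
    by rewrite /q; ring.
  by rewrite mulrBl mul1r mulrC divfK ?gt_eqF // ltrBlDr ltrDl divr_gt0.
have ex (ai : 'I_d * 'I_n) : exists k : int, forall x : R,
    chi ai.1 (x *: delta_mx 0 ai.2) = cis (k%:~R * x).
  case: ai => a i /=; apply: circle_char.
  - by move=> s t; rewrite scalerDl chiD.
  - have -> : chi a (pi *+ 2 *: delta_mx 0 i) = chi a 0; last exact: chi0.
    have E : torus (pi *+ 2 *: delta_mx 0 i) = torus 0.
      rewrite /torus; congr diag_mx; apply/rowP => j; rewrite !mxE cis0 /=.
      by case: eqP => _; rewrite ?mulr1 ?cis2pi // mulr0 cis0.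
    by rewrite /chi /Z /rT E.
  - move=> e e0; have [dl dl0 dlP] := chi_cont a e e0; exists dl => // s sP.
    apply: dlP => j; rewrite !mxE /=.
    by case: eqP => _; rewrite ?mulr1 // mulr0 normr0.
have [k kP] := choice ex.
exists P, (fun a => [ffun i => k (a, i)]); split=> // t.
rewrite -/(rT t) -/(Z t) ZE; congr diag_mx; apply/rowP => a; rewrite !mxE.
rewrite {1}[t]row_sum_delta (big_morph (chi a) (chiD a) (chi0 a)).
by apply: eq_bigr => i _; rewrite (kP (a, i)) ffunE cisMz.
Qed.

End Analysis.

(** * The derived representation *)

Lemma conjtrZ (R : realType) m n (a : R[i]) (A : 'M[R[i]]_(m, n)) :
  ((a *: A) ^t* = a^*%C *: A ^t*)%sesqui.
Proof. by apply/matrixP => i j; rewrite !mxE rmorphM. Qed.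

Lemma conjtrM (R : realType) m n p (A : 'M[R[i]]_(m, n)) (B : 'M[R[i]]_(n, p)) :
  ((A *m B) ^t* = B ^t* *m A ^t*)%sesqui.
Proof. by rewrite trmx_mul map_mxM. Qed.

Lemma conjtrD (R : realType) m n (A B : 'M[R[i]]_(m, n)) :
  ((A + B) ^t* = A ^t* + B ^t*)%sesqui.
Proof. by rewrite linearD map_mxD. Qed.

Lemma conjtrN (R : realType) m n (A : 'M[R[i]]_(m, n)) :
  ((- A) ^t* = - A ^t*)%sesqui.
Proof. by rewrite linearN map_mxN. Qed.

Lemma invmx_mul (F : fieldType) n (A B : 'M[F]_n) : A \in unitmx -> B \in unitmx ->
  invmx (A *m B) = invmx B *m invmx A.
Proof.
move=> uA uB; have AB : A *m B *m (invmx B *m invmx A) = 1%:M.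
  by rewrite mulmxA mulmxK // mulmxV.
by rewrite -[LHS]mulmx1 -AB mulKmx // unitmx_mul uA.
Qed.

Lemma tang_ext (R : realType) m (c c' : R -> 'M[R[i]]_m) A :
  (forall s, c s = c' s) -> tang c A -> tang c' A.
Proof. by move=> /funext ->. Qed.

Lemma unitary_spectral (R : realType) n (h : 'M[R[i]]_n) : h \is unitarymx ->
  exists (u : 'M[R[i]]_n) (t : 'rV[R]_n),
    u \is unitarymx /\ h = invmx u *m torus t *m u.
Proof.
move=> hU; have hN : h \is normalmx.
  apply/normalmxP; have /unitarymxP -> := hU.
  by apply/esym/mulmx1C/unitarymxP.
have /orthomx_spectralP hE := hN.
have uU := spectral_unitarymx h; move: (spectralmx h) (spectral_diag h) uU hE.
move=> u D uU hE.
have uu : u \in unitmx := unitarymx_unit uU.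
have DU : diag_mx D \is unitarymx.
  have -> : diag_mx D = u *m h *m invmx u.
    by rewrite hE !mulmxA mulmxV // mul1mx -mulmxA mulmxV // mulmx1.
  by apply: unitaryM (unitaryV uU); apply: unitaryM uU hU.
have D1 j : exists x : R, D 0 j = cis x.
  apply: cis_surj; have /unitarymxP/matrixP/(_ j j) := DU.
  rewrite tr_diag_mx map_diag_mx mulmx_diag !mxE eqxx !mulr1n -normCK => h1.
  apply/eqP; rewrite -(@pexpr_eq1 _ _ 2) ?cn_ge0 //.
  by apply/eqP/complexI; rewrite rmorphXn /= cnE h1.
have [t tP] := choice D1.
have DE : diag_mx D = torus (\row_j t j).
  by rewrite /torus; congr diag_mx; apply/rowP => j; rewrite !mxE tP.
by exists u, (\row_j t j); split; [exact: uU | rewrite -DE; exact: hE].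
Qed.

Definition skew (R : realType) n (A : 'M[R[i]]_n) := (A ^t*)%sesqui = - A.

(** The Lie algebra element of which [torus] t is the exponential. *)
Definition idiag (R : realType) n (t : 'rV[R]_n) : 'M[R[i]]_n :=
  diag_mx (\row_j (0 +i* t 0 j)).

Lemma skew_spectral (R : realType) n (A : 'M[R[i]]_n) : skew A ->
  exists (u : 'M[R[i]]_n) (t : 'rV[R]_n),
    u \is unitarymx /\ A = invmx u *m idiag t *m u.
Proof.
move=> skA; have AN : A \is normalmx.
  by apply/normalmxP; rewrite skA mulmxN mulNmx.
have /orthomx_spectralP AE := AN.
have uU := spectral_unitarymx A; move: (spectralmx A) (spectral_diag A) uU AE.
move=> u D uU AE.
have uu : u \in unitmx := unitarymx_unit uU.
have skD : ((diag_mx D) ^t*)%sesqui = - diag_mx D.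
  have -> : diag_mx D = u *m A *m invmx u.
    by rewrite AE !mulmxA mulmxV // mul1mx -mulmxA mulmxV // mulmx1.
  by rewrite !conjtrM (invmx_unitary uU) trmxCK skA mulNmx mulmxN mulmxA.
have DE : diag_mx D = idiag (\row_j complex.Im (D 0 j)).
  rewrite /idiag; congr diag_mx; apply/rowP => j.
  have /matrixP/(_ j j) := skD; rewrite !mxE eqxx !mulr1n.
  case: (D 0 j) => a b /eqP; rewrite eq_complex /= => /andP[/eqP h _].
  by congr (_ +i* _); lra.
by exists u, (\row_j complex.Im (D 0 j)); split; [exact: uU | rewrite -DE; exact: AE].
Qed.

Lemma skew_idiag (R : realType) n (t : 'rV[R]_n) : skew (idiag t).
Proof.
rewrite /skew /idiag tr_diag_mx map_diag_mx -linearN /=; congr diag_mx.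
by apply/rowP => j; rewrite !mxE; apply/eqP; rewrite eq_complex /= oppr0 !eqxx.
Qed.

Lemma skew_conj (R : realType) n (g A : 'M[R[i]]_n) : g \is unitarymx -> skew A ->
  skew (g *m A *m invmx g).
Proof.
move=> gU sA; rewrite /skew (invmx_unitary gU) !conjtrM trmxCK sA.
by rewrite mulNmx mulmxN mulmxA.
Qed.

Lemma skewB (R : realType) n (A B : 'M[R[i]]_n) :
  skew A -> skew B -> skew (A *m B - B *m A).
Proof.
by move=> sA sB; rewrite /skew conjtrD conjtrN !conjtrM sA sB !mulmxN !mulNmx;
   rewrite !opprK opprB.
Qed.

Lemma skewD (R : realType) n (A B : 'M[R[i]]_n) :
  skew A -> skew B -> skew (A + B).
Proof. by move=> sA sB; rewrite /skew conjtrD sA sB opprD. Qed.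

Lemma skewZ (R : realType) n (a : R) (A : 'M[R[i]]_n) :
  skew A -> skew (a%:C *: A).
Proof. by move=> sA; rewrite /skew conjtrZ sA conjc_real scalerN. Qed.

Section Lie.
Variables (R : realType) (n d : nat).
Notation C := R[i].
Variable r : 'M[C]_n -> 'M[C]_d.
Hypothesis r_repr : Un_repr r.
Hypothesis r_cont : Un_continuous r.

Variables (P : 'M[C]_d) (mu : 'I_d -> {ffun 'I_n -> int}).
Hypothesis P_unit : P \in unitmx.
Hypothesis P_torus : forall t : 'rV[R]_n, P *m r (torus t) *m invmx P =
     diag_mx (\row_a \prod_i cis (t 0 i) ^ mu a i).

Let wt a (t : 'rV[R]_n) : R := \sum_i (mu a i)%:~R * t 0 i.

Let r_torus t : r (torus t) = invmx P *m diag_mx (\row_a cis (wt a t)) *m P.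
Proof.
have -> : diag_mx (\row_a cis (wt a t)) = P *m r (torus t) *m invmx P.
  rewrite P_torus; congr diag_mx; apply/rowP => a; rewrite !mxE cis_sum.
  by apply: eq_bigr => i _; rewrite cisMz.
by rewrite !mulmxA mulVmx // mul1mx -mulmxA mulVmx // mulmx1.
Qed.

Lemma repr_spectral u t : u \is unitarymx -> r (invmx u *m torus t *m u) =
  invmx (P *m r u) *m diag_mx (\row_a cis (wt a t)) *m (P *m r u).
Proof.
move=> uU; have tU := torus_unitary t; have vU := unitaryV uU.
rewrite (reprM r_repr (unitaryM vU tU) uU) (reprM r_repr vU tU).
rewrite (reprV r_repr uU) r_torus (invmx_mul P_unit (repr_unit r_repr uU)).
by rewrite !mulmxA.
Qed.

(** Geometric sum. *)
Let cis_pow (x : R) (k : int) : cn (cis x ^ k - 1) <= (`|k|%:~R : R) * cn (cis x - 1).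
Proof.
have pos m : cn (cis x ^+ m - 1) <= m%:R * cn (cis x - 1).
  elim: m => [|m IH]; first by rewrite expr0 subrr cn0 mul0r.
  have -> : cis x ^+ m.+1 - 1 = cis x * (cis x ^+ m - 1) + (cis x - 1).
    by rewrite exprS; ring.
  apply: le_trans (cnD _ _) _.
  by rewrite cnM cn_cis mul1r -natr1 mulrDl mul1r lerD2r.
case: k => m; first exact: pos.
rewrite NegzE -exprnN normrN.
have -> : (cis x ^- m.+1 - 1) = - (cis x ^- m.+1 * (cis x ^+ m.+1 - 1)).
  by rewrite mulrBr mulVf ?expf_neq0 ?cis_neq0 // mulr1 opprB.
rewrite cnN cnM; apply: le_trans (pos m.+1).
by rewrite -cisMn -cisN cn_cis mul1r.
Qed.

Let cis_wt a t : cn (cis (wt a t) - 1) <=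
  \sum_i `|mu a i|%:~R * cn (cis (t 0 i) - 1).
Proof.
rewrite cis_sum.
have [_ h] : cn (\prod_i cis ((mu a i)%:~R * t 0 i)) = 1 /\
   cn (\prod_i cis ((mu a i)%:~R * t 0 i) - 1) <=
     \sum_i `|mu a i|%:~R * cn (cis (t 0 i) - 1); last exact: h.
elim/big_rec2: _ => [|i x y _ [IH1 IH2]]; first by rewrite cn1 subrr cn0.
rewrite cnM cn_cis mul1r; split=> //.
have -> : cis ((mu a i)%:~R * t 0 i) * y - 1 =
   (cis ((mu a i)%:~R * t 0 i) - 1) * y + (y - 1) by ring.
apply: le_trans (cnD _ _) _; apply: lerD IH2.
by rewrite cnM IH1 mulr1 cisMz cis_pow.
Qed.

(** A continuous representation is Lipschitz at 1: every unitary matrix is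
    conjugate to an element of the torus, where the representation is given by
    Laurent monomials, and the conjugating matrices have bounded images. *)
Let r_lip : exists2 K, 0 <= K &
  forall h, h \is unitarymx -> mn (r h - 1%:M) <= K * mn (h - 1%:M).
Proof.
have [B B0 BP] := repr_bounded r_repr r_cont.
pose K1 : R := \sum_a \sum_i `|mu a i|%:~R.
have K10 : 0 <= K1.
  by apply: sumr_ge0 => a _; apply: sumr_ge0 => i _; rewrite ler0z.
pose K := (mn (invmx P) * B) * (mn P * B) * (K1 * (n%:R ^+ 2 * n%:R ^+ 2)).
exists K; first by rewrite !mulr_ge0 ?mn_ge0 ?exprn_ge0 // ltW.
move=> h hU; have [u [t [uU hE]]] := unitary_spectral hU.
have uu := unitarymx_unit uU.
have -> : r h - 1%:M = invmx (P *m r u) *m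
   (diag_mx (\row_a cis (wt a t)) - 1%:M) *m (P *m r u).
  rewrite hE repr_spectral // mulmxBr mulmxBl mulmx1 mulVmx //.
  by rewrite unitmx_mul P_unit (repr_unit r_repr).
have tE : torus t - 1%:M = u *m (h - 1%:M) *m invmx u.
  rewrite hE mulmxBr mulmxBl mulmx1 mulmxV // !mulmxA mulmxV // mul1mx.
  by rewrite -mulmxA mulmxV // mulmx1.
have tb : mn (torus t - 1%:M) <= n%:R ^+ 2 * n%:R ^+ 2 * mn (h - 1%:M).
  rewrite tE; apply: le_trans (mn_sandwich _ _ (lexx _)) _.
  rewrite ler_wpM2r ?mn_ge0 //; apply: ler_pM; rewrite ?mn_ge0 //.
    exact: mn_unitary.
  exact: mn_unitary (unitaryV uU).
have db : mn (diag_mx (\row_a cis (wt a t)) - 1%:M) <= K1 * mn (torus t - 1%:M).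
  have -> : diag_mx (\row_a cis (wt a t)) - 1%:M =
     diag_mx (\row_a (cis (wt a t) - 1)).
    by rewrite -diag_const_mx -linearB /=; congr diag_mx;
       apply/rowP => a; rewrite !mxE.
  rewrite mn_diag /K1 mulr_suml; apply: ler_sum => a _; rewrite mxE.
  apply: le_trans (cis_wt a t) _; rewrite mulr_suml; apply: ler_sum => i _.
  rewrite ler_wpM2l ?ler0z //.
  by have := cn_le_mn (torus t - 1%:M) i i; rewrite !mxE eqxx !mulr1n.
apply: le_trans (mn_sandwich _ _ db) _.
rewrite /K -[leRHS]mulrA; apply: ler_pM.
- by rewrite mulr_ge0 ?mn_ge0.
- by rewrite mulr_ge0 ?mn_ge0.
- rewrite (invmx_mul P_unit (repr_unit r_repr uU)) -(reprV r_repr uU).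
  apply: ler_pM; rewrite ?mn_ge0 //.
    apply: le_trans (mnM _ _) _; rewrite mulrC ler_wpM2l ?mn_ge0 //.
    exact/BP/unitaryV.
  by apply: le_trans (mnM _ _) _; rewrite ler_wpM2l ?mn_ge0 // BP.
by rewrite -mulrA; apply: ler_wpM2l K10 _ _ tb.
Qed.

(** Some curve with velocity A is enough, as all of them give the same X
    ([deriv_uniq]). *)
Definition deriv_at A X := exists e : R -> 'M[C]_n,
  [/\ forall s, e s \is unitarymx, tang e A & tang (r \o e) X].

(** By the Lipschitz bound, curves that agree to first order have images that
    agree to first order. *)
Let r_close c c' A : (forall s, c s \is unitarymx) ->
  (forall s, c' s \is unitarymx) -> tang c A -> tang c' A ->
  exists K, forall s, mn (r (c s) - r (c' s)) <= K * s ^+ 2.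
Proof.
move=> cU c'U [K [_ K2]] [L [_ L2]].
have [B B0 BP] := repr_bounded r_repr r_cont; have [M M0 MP] := r_lip.
exists (B * (M * (n%:R ^+ 2 * (K + L)))) => s.
have wU : invmx (c' s) *m c s \is unitarymx by exact: unitaryM (unitaryV _) _.
have -> : r (c s) - r (c' s) = r (c' s) *m (r (invmx (c' s) *m c s) - 1%:M).
  rewrite mulmxBr mulmx1 -(reprM r_repr (c'U s) wU).
  by rewrite (mulKVmx (unitarymx_unit (c'U s))).
apply: le_trans (mnM _ _) _; rewrite -mulrA.
apply: ler_pM; [exact: mn_ge0 | exact: mn_ge0 | exact: BP (c'U s) |].
apply: le_trans (MP _ wU) _; rewrite -mulrA ler_wpM2l //.
have -> : invmx (c' s) *m c s - 1%:M = invmx (c' s) *m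
    ((c s - 1%:M - s%:C *: A) - (c' s - 1%:M - s%:C *: A)).
  have -> : (c s - 1%:M - s%:C *: A) - (c' s - 1%:M - s%:C *: A) = c s - c' s.
    move: (c s) (c' s) => x y; apply/matrixP => i j; rewrite !mxE; ring.
  by rewrite mulmxBr (mulVmx (unitarymx_unit (c'U s))).
apply: le_trans (mnM _ _) _; rewrite -mulrA.
apply: ler_pM; [exact: mn_ge0 | exact: mn_ge0 | |].
  exact: mn_unitary (unitaryV (c'U s)).
by apply: le_trans (mnB _ _) _; rewrite mulrDl lerD.
Qed.

Lemma deriv_uniq A X Y : deriv_at A X -> deriv_at A Y -> X = Y.
Proof.
move=> [e [eU te tr]] [f [fU tf tr']].
exact: tang_uniq tr tr' (r_close eU fU te tf).
Qed.

(** Every skew-hermitian matrix is a diagonal one in some orthonormal basis,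
    whose exponential curve is explicit. *)
Lemma deriv_spectral u t : u \is unitarymx ->
  exists e : R -> 'M[C]_n,
  [/\ forall s, e s \is unitarymx, forall s, e (- s) = invmx (e s),
      tang e (invmx u *m idiag t *m u) &
      tang (r \o e) (invmx (P *m r u) *m idiag (\row_a wt a t) *m (P *m r u))].
Proof.
move=> uU; have uu := unitarymx_unit uU.
have tang_diag m (x : 'rV[R]_m) :
    tang (fun s => diag_mx (\row_j cis (s * x 0 j))) (idiag x).
  exists (m%:R + \sum_j (x 0 j ^+ 2 *+ 2)); split=> s.
    rewrite mn_diag; under eq_bigr => j _ do rewrite mxE cn_cis.
    rewrite sumr_const card_ord lerDl; apply: sumr_ge0 => j _.
    by rewrite mulrn_wge0 ?sqr_ge0.
  have -> : diag_mx (\row_j cis (s * x 0 j)) - 1%:M - s%:C *: idiag x =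
     diag_mx (\row_j (cis (s * x 0 j) - 1 - 0 +i* (s * x 0 j))).
    rewrite /idiag -diag_const_mx -linearZ -!linearB /=; congr diag_mx.
    apply/rowP => j; rewrite !mxE; congr (_ - _).
    by simpc.
  rewrite mn_diag mulrDl; apply: ler_wpDl; first by rewrite mulr_ge0 ?sqr_ge0.
  rewrite mulr_suml; apply: ler_sum => j _; rewrite mxE.
  apply: le_trans (cis2_le _) _.
  by rewrite exprMn mulrC mulrnAl mulrC.
pose e s := invmx u *m torus (s *: t) *m u.
have torusZ s : torus (s *: t) = diag_mx (\row_j cis (s * t 0 j)).
  by rewrite /torus; congr diag_mx; apply/rowP => j; rewrite !mxE.
have eU s : e s \is unitarymx.
  exact: unitaryM (unitaryM (unitaryV uU) (torus_unitary _)) uU.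
exists e; split=> //.
- move=> s; have ese : e s *m e (- s) = 1%:M.
    rewrite /e -!mulmxA [u *m (_ *m _)]mulmxA mulmxV // mul1mx.
    rewrite [torus (s *: t) *m _]mulmxA -torusD -scalerDl subrr scale0r torus0.
    by rewrite mul1mx mulVmx.
  by rewrite -[RHS]mulmx1 -ese (mulKmx (unitarymx_unit (eU s))).
- apply: tang_ext (tang_conj (mulVmx uu) (tang_diag n t)) => s.
  by rewrite /e torusZ.
have Pu : P *m r u \in unitmx by rewrite unitmx_mul P_unit (repr_unit r_repr).
apply: tang_ext (tang_conj (mulVmx Pu) (tang_diag d (\row_a wt a t))) => s.
rewrite /= /e (repr_spectral _ uU).
have -> : \row_a cis (wt a (s *: t)) = \row_a cis (s * (\row_a wt a t) 0 a).
  apply/rowP => a; rewrite !mxE; congr cis.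
  by rewrite /wt mulr_sumr; apply: eq_bigr => i _; rewrite mxE mulrCA.
by [].
Qed.

Lemma deriv_ex A : skew A -> exists X (e : R -> 'M[C]_n),
  [/\ forall s, e s \is unitarymx, forall s, e (- s) = invmx (e s),
      tang e A & tang (r \o e) X].
Proof.
move=> /skew_spectral[u [t [uU ->]]].
by have [e h] := deriv_spectral t uU; eexists; exists e; apply: h.
Qed.

Lemma derivD A B X Y : deriv_at A X -> deriv_at B Y -> deriv_at (A + B) (X + Y).
Proof.
move=> [e [eU te tr]] [f [fU tf tr']]; exists (fun s => e s *m f s); split.
- by move=> s; apply: unitaryM.
- exact: tang_mul.
apply: tang_ext (tang_mul tr tr') => s /=.
by rewrite (reprM r_repr).
Qed.

Lemma derivZ (a : R) A X : deriv_at A X -> deriv_at (a%:C *: A) (a%:C *: X).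
Proof.
move=> [e [eU te tr]]; exists (fun s => e (a * s)); split.
- by move=> s; exact: eU.
- exact: (tang_scale a te).
- exact: (tang_scale a tr).
Qed.

Lemma deriv_conj g A X : g \is unitarymx -> deriv_at A X ->
  deriv_at (g *m A *m invmx g) (r g *m X *m invmx (r g)).
Proof.
move=> gU [e [eU te tr]]; have gu := unitarymx_unit gU.
exists (fun s => g *m e s *m invmx g); split.
- by move=> s; exact: unitaryM (unitaryM gU (eU s)) (unitaryV gU).
- by apply: tang_conj => //; apply: mulmxV.
apply: tang_ext (tang_conj (mulmxV (repr_unit r_repr gU)) tr) => s /=.
by rewrite (reprM r_repr (unitaryM gU (eU s)) (unitaryV gU)) (reprM r_repr gU (eU s))
   (reprV r_repr gU).
Qed.

(** The Lipschitz bound passes to the derivative. It has to be uniform in A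
    because in [deriv_bracket] the matrix A varies with s. *)
Lemma deriv_bound : exists2 K, 0 <= K &
  forall A X, deriv_at A X -> mn X <= K * mn A.
Proof.
have [K K0 KP] := r_lip; exists K => // A X [e [eU [L [_ L2]] [M [_ M2]]]].
rewrite leNgt; apply/negP => lt.
have d0 : 0 < mn X - K * mn A by rewrite subr_gt0.
have : mn X - K * mn A = 0.
  apply: (@small_eq0 _ _ (K * L + M)); first exact: ltW.
  move=> s s0 _; rewrite mulrBr -{1}(gtr0_norm s0) -cnR -mnZ.
  have h1 : mn (s%:C *: X) <= mn (r (e s) - 1%:M) + M * s ^+ 2.
    have -> : s%:C *: X = (r (e s) - 1%:M) - (r (e s) - 1%:M - s%:C *: X).
      by rewrite opprB addrC subrK.
    by apply: le_trans (mnB _ _) _; rewrite lerD2l; apply: M2.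
  have h2 : mn (e s - 1%:M) <= s * mn A + L * s ^+ 2.
    have -> : e s - 1%:M = s%:C *: A + (e s - 1%:M - s%:C *: A).
      by rewrite [RHS]addrC subrK.
    apply: le_trans (mnD _ _) _; rewrite mnZ cnR gtr0_norm // lerD2l.
    exact: L2.
  have h3 := KP _ (eU s).
  have h4 : K * mn (e s - 1%:M) <= K * (s * mn A + L * s ^+ 2).
    by rewrite ler_wpM2l.
  have h5 : K * (s * mn A + L * s ^+ 2) = s * (K * mn A) + K * L * s ^+ 2.
    by ring.
  by rewrite mulrDl; lra.
by move=> h; move: d0; rewrite h ltxx.
Qed.

(** Differentiate r (e s) X r (e (-s)) = derivative at e(s) A e(-s), where e is
    a curve with velocity B: both sides are known to first order in s, and
    [deriv_bound] controls the error on the side of the group. *)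
Lemma deriv_bracket A B X Y : skew A -> skew B ->
  deriv_at A X -> deriv_at B Y -> deriv_at (B *m A - A *m B) (Y *m X - X *m Y).
Proof.
move=> sA sB dA dB.
have [Z [e' [e'U _ te' tre']]] := deriv_ex (skewB sB sA).
have dZ : deriv_at (B *m A - A *m B) Z by exists e'.
suff <- : Z = Y *m X - X *m Y by [].
have [Y' [e [eU eN te tre]]] := deriv_ex sB.
have YY : Y' = Y by apply: deriv_uniq dB; exists e.
rewrite {}YY in tre.
have flip m (c : R -> 'M[C]_m) D : tang c D -> tang (fun s => c (- s)) (- D).
  move=> /(tang_scale (-1)); rewrite rmorphN1 scaleN1r.
  by apply: tang_ext => s; rewrite mulN1r.
have [K KP] := tang_commutator A te (flip _ _ _ te).
have [L LP] := tang_commutator X tre (flip _ _ _ tre).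
have [M M0 MP] := deriv_bound.
apply/eqP; rewrite -subr_eq0; apply/eqP/mn_eq0.
apply: (@small_eq0 _ _ (M * K + L)); first exact: mn_ge0.
move=> s s0 s1; have s1' : `|s| <= 1 by rewrite gtr0_norm.
have dR : deriv_at (e s *m A *m e (- s) - A - s%:C *: (B *m A - A *m B))
   (r (e s) *m X *m r (e (- s)) - X - s%:C *: Z).
  have := derivZ (-1) (derivD dA (derivZ s dZ)).
  rewrite rmorphN1 !scaleN1r !opprD => h.
  rewrite -!addrA; apply: derivD h; rewrite eN (reprV r_repr) //.
  exact: deriv_conj.
have h1 := MP _ _ dR; have h2 := KP s s1'; have h3 := LP s s1'.
rewrite -{1}(gtr0_norm s0) -cnR -mnZ.
have -> : s%:C *: (Z - (Y *m X - X *m Y)) =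
   (r (e s) *m X *m r (e (- s)) - X - s%:C *: (Y *m X - X *m Y)) -
   (r (e s) *m X *m r (e (- s)) - X - s%:C *: Z).
  rewrite scalerBr; move: (_ - X) (s%:C *: Z) (s%:C *: _) => x1 x2 x3.
  by apply/matrixP => i j; rewrite !mxE; ring.
apply: le_trans (mnB _ _) _.
have h4 := ler_wpM2l M0 h2.
by rewrite /= in h3; rewrite mulrDl -mulrA; lra.
Qed.

(** The derivative exists by the spectral theorem and depends on the velocity
    only, so it is a function, and the rules above make it a representation of
    the real Lie algebra of skew-hermitian matrices. *)
Lemma derived_rep : exists dr : 'M[C]_n -> 'M[C]_d,
  [/\ forall A B, skew A -> skew B -> dr (A + B) = dr A + dr B,
      forall (a : R) A, skew A -> dr (a%:C *: A) = a%:C *: dr A,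
      forall A B, skew A -> skew B ->
        dr (B *m A - A *m B) = dr B *m dr A - dr A *m dr B &
      forall u t, u \is unitarymx -> dr (invmx u *m idiag t *m u) =
        invmx (P *m r u) *m idiag (\row_a wt a t) *m (P *m r u)].
Proof.
have /choice[dr drP] : forall A, exists X, skew A -> deriv_at A X.
  move=> A; have [sA|nA] := pselect (skew A); last by exists 0.
  by have [X [e [eU _ te tre]]] := deriv_ex sA; exists X => _; exists e.
exists dr; split.
- move=> A B sA sB; apply: (deriv_uniq (drP _ (skewD sA sB))).
  exact: derivD (drP _ sA) (drP _ sB).
- move=> a A sA; apply: (deriv_uniq (drP _ (skewZ a sA))).
  exact: derivZ (drP _ sA).
- move=> A B sA sB; apply: (deriv_uniq (drP _ (skewB sB sA))).
  exact: deriv_bracket sA sB (drP _ sA) (drP _ sB).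
move=> u t uU; have sA := skew_conj (unitaryV uU) (skew_idiag t).
rewrite invmxK in sA; apply: (deriv_uniq (drP _ sA)).
by have [e [eU _ te tre]] := deriv_spectral t uU; exists e.
Qed.

End Lie.

(** Every matrix is A + i B with A and B skew-hermitian, so dr extends in one
    way to a complex linear map. The bracket identity is bilinear, which makes
    it enough to check it on skew-hermitian matrices. *)
Lemma complexify (R : realType) n d (dr : 'M[R[i]]_n -> 'M[R[i]]_d) :
  (forall A B, skew A -> skew B -> dr (A + B) = dr A + dr B) ->
  (forall (a : R) A, skew A -> dr (a%:C *: A) = a%:C *: dr A) ->
  (forall A B, skew A -> skew B ->
     dr (B *m A - A *m B) = dr B *m dr A - dr A *m dr B) ->
  exists X : 'M[R[i]]_n -> 'M[R[i]]_d,
    [/\ forall a A B, X (a *: A + B) = a *: X A + X B,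
        forall A B, X (A *m B - B *m A) = X A *m X B - X B *m X A &
        forall A, skew A -> X A = dr A].
Proof.
move=> drD drZ drB.
pose im : R[i] := 0 +i* 1.
have imM : im * im = -1 by rewrite /im; simpc.
pose sk (M : 'M[R[i]]_n) : 'M[R[i]]_n := (2^-1 : R)%:C *: (M - (M ^t*)%sesqui).
have skP M : skew (sk M).
  apply: skewZ; rewrite /skew conjtrD conjtrN trmxCK opprB.
  by rewrite addrC.
have skD A B : sk (A + B) = sk A + sk B.
  rewrite /sk conjtrD -scalerDr; congr (_ *: _).
  move: (A^t* )%sesqui (B^t* )%sesqui => x y.
  by apply/matrixP => i j; rewrite !mxE; ring.
have skZ (a : R) A : sk (a%:C *: A) = a%:C *: sk A.
  by rewrite /sk conjtrZ conjc_real -scalerBr !scalerA mulrC.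
have half (V : lmodType R[i]) (v : V) : (2^-1 : R)%:C *: (v + v) = v.
  rewrite scalerDr -scalerDl -rmorphD /=; have -> : 2^-1 + 2^-1 = 1 :> R by lra.
  by rewrite scale1r.
have sk_id A : skew A -> sk A = A.
  by move=> sA; rewrite /sk sA opprK half.
have im_conj : im^*%C = - im by rewrite /im; simpc.
have sk_im A : skew A -> sk (im *: A) = 0.
  move=> sA; rewrite /sk conjtrZ sA im_conj scalerN scaleNr opprK subrr.
  exact: scaler0.
have decomp M : M = sk M - im *: sk (im *: M).
  rewrite /sk conjtrZ im_conj scaleNr opprK scalerA mulrC -scalerA -scalerBr.
  rewrite [im *: (_ + _)]scalerDr !scalerA imM !scaleN1r -{1}[M]half; congr (_ *: _).
  move: (M ^t* )%sesqui => y; apply/matrixP => i j; rewrite !mxE; ring.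
pose X M := dr (sk M) - im *: dr (sk (im *: M)).
have dr0 : dr 0 = 0.
  have := drZ 0 (sk 0) (skP 0); rewrite !scale0r; exact.
have XD A B : X (A + B) = X A + X B.
  rewrite /X scalerDr !skD !drD // scalerDr.
  move: (dr _) (dr _) (im *: dr _) (im *: dr _) => x1 x2 x3 x4.
  by apply/matrixP => i j; rewrite !mxE; ring.
have XZr (a : R) A : X (a%:C *: A) = a%:C *: X A.
  rewrite /X skZ drZ // [im *: (_ *: _)]scalerA mulrC -scalerA skZ drZ //.
  by rewrite scalerA [im * _]mulrC -scalerA -scalerBr.
have XN A : X (- A) = - X A.
  by have := XZr (-1) A; rewrite rmorphN1 !scaleN1r.
have Xim A : X (im *: A) = im *: X A.
  rewrite /X scalerA imM scaleN1r.
  have m1 : (-1 : R)%:C = -1 :> R[i] by rewrite rmorphN1.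
  have -> : sk (- A) = (-1)%:C *: sk A by rewrite -skZ m1 scaleN1r.
  rewrite (drZ (-1) _ (skP A)) m1 scaleN1r scalerBr scalerA imM scalerN opprK.
  by rewrite scaleN1r opprK addrC.
have XZ a A : X (a *: A) = a *: X A.
  have -> : a = (complex.Re a)%:C + im * (complex.Im a)%:C.
    by case: a => x y; rewrite /im; simpc.
  by rewrite !scalerDl -!scalerA XD Xim !XZr.
have Xsk A : skew A -> X A = dr A.
  by move=> sA; rewrite /X sk_im // dr0 scaler0 subr0 sk_id.
clearbody X sk; exists X; split=> //; first by move=> a A B; rewrite XD XZ.
have Xbr0 A B : skew A -> skew B -> X (A *m B - B *m A) = X A *m X B - X B *m X A.
  by move=> sA sB; rewrite !Xsk ?drB //; apply: skewB.
pose bad A B := X (A *m B - B *m A) - (X A *m X B - X B *m X A).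
have badD A B B' : bad A (B + B') = bad A B + bad A B'.
  rewrite /bad !XD !XN mulmxDr [_ *m A]mulmxDl !XD mulmxDr mulmxDl.
  move: (X (A *m B)) (X (A *m B')) (X (B *m A)) (X (B' *m A)).
  move: (X A *m X B) (X A *m X B') (X B *m X A) (X B' *m X A).
  by move=> x1 x2 x3 x4 x5 x6 x7 x8; apply/matrixP => i j; rewrite !mxE; ring.
have badZ A a B : bad A (a *: B) = a *: bad A B.
  by rewrite /bad -scalemxAr -scalemxAl -scalerBr !XZ -scalemxAr -scalemxAl -!scalerBr.
have badC A B : bad B A = - bad A B.
  rewrite /bad -[B *m A - _]opprB XN.
  by rewrite -[X B *m X A - _]opprB -opprD.
have bad_sk A B : skew A -> skew B -> bad A B = 0.
  by move=> sA sB; rewrite /bad Xbr0 // subrr.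
have bad_l A B : skew A -> bad A B = 0.
  move=> sA; rewrite [B]decomp -scaleNr badD badZ !bad_sk //.
  by rewrite scaler0 addr0.
move=> A B; apply/eqP; rewrite -subr_eq0; apply/eqP; rewrite -/(bad A B).
rewrite badC [A]decomp -scaleNr badD badZ [bad B (sk A)]badC [bad B (sk _)]badC.
by rewrite !bad_l // !oppr0 scaler0 addr0 oppr0.
Qed.

(** Interpolation makes the second matrix a polynomial in the first one. *)
Lemma stablemx_fun (F : fieldType) m d (V : 'M[F]_(m, d)) (Q : 'M[F]_d)
    (D E : 'rV[F]_d) (f : F -> F) :
  Q \in unitmx -> (forall a, E 0 a = f (D 0 a)) ->
  stablemx V (invmx Q *m diag_mx D *m Q) -> stablemx V (invmx Q *m diag_mx E *m Q).
Proof.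
case: d m V Q D E => [|d] [|m] V Q D E Qu Ef st.
- by rewrite [V]flatmx0 mul0mx sub0mx.
- by rewrite [V]thinmx0 mul0mx sub0mx.
- by rewrite [V]flatmx0 mul0mx sub0mx.
have [p pP] := interpolation [seq D 0 a | a <- enum 'I_d.+1] f.
have -> : diag_mx E = horner_mx (diag_mx D) p.
  rewrite horner_mx_diag; congr diag_mx; apply/rowP => a.
  by rewrite mxE Ef pP // map_f // mem_enum.
by rewrite -horner_mx_uconjC //; apply: horner_mx_stable.
Qed.

Lemma torus_perm (R : realType) n (s : 'S_n) (t : 'rV[R]_n) :
  perm_mx s *m torus t *m invmx (perm_mx s) = torus (\row_i t 0 (s i)).
Proof.
have -> : invmx (perm_mx s) = perm_mx s^-1 :> 'M[R[i]]_n.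
  have pK : perm_mx s *m perm_mx s^-1 = 1%:M :> 'M[R[i]]_n.
    by rewrite -perm_mxM mulgV perm_mx1.
  by rewrite -[RHS](mulKmx (unitmx_perm _ s)) pK mulmx1.
rewrite -col_permE -row_permE; apply/matrixP => i j.
by rewrite !mxE (inj_eq perm_inj).
Qed.

Lemma perm_mx_unitary (R : realType) n (s : 'S_n) :
  (perm_mx s : 'M[R[i]]_n) \is unitarymx.
Proof.
apply/unitarymxP; rewrite tr_perm_mx.
have -> : (perm_mx s^-1 ^ Num.Def.conjC)%sesqui = perm_mx s^-1 :> 'M[R[i]]_n.
  by apply/matrixP => i j; rewrite !mxE; case: eqP => _; rewrite ?rmorph1 ?rmorph0.
by rewrite -perm_mxM mulgV perm_mx1.
Qed.

(** The basis of weight vectors of [torus_weights] is used as the standard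
    basis. A subspace stable under the Lie algebra is stable under the group,
    because r (g) is a polynomial in the derivative at a logarithm of g; and
    the multiset of weights is symmetric since permutation matrices are
    unitary and normalise the torus. *)
Theorem weights_of_rep (R : realType) n d (r : 'M[R[i]]_n -> 'M[R[i]]_d) :
  Un_repr r -> Un_continuous r -> Un_irreducible r ->
  exists (mu : 'I_d -> {ffun 'I_n -> int}) (X : 'M[R[i]]_n -> 'M[R[i]]_d),
  [/\ [/\ forall a A B, X (a *: A + B) = a *: X A + X B,
         forall A B, X (A *m B - B *m A) = X A *m X B - X B *m X A &
         forall i, X (delta_mx i i) = diag_mx (\row_a (mu a i)%:~R)],
      forall U : 'M[R[i]]_d, (forall A, stablemx U (X A)) -> U != 0 -> row_full U,
      (0 < d)%N,
      forall (s : 'S_n) (nu : {ffun 'I_n -> int}),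
        #|[set a | mu a == [ffun i => nu (s i)]]| = #|[set a | mu a == nu]| &
      forall t : 'rV[R]_n, \tr (r (torus t)) = \sum_a \prod_i cis (t 0 i) ^ mu a i].
Proof.
move=> r_repr r_cont [r_n0 r_irr].
have [P [mu [Pu Pt]]] := torus_weights r_repr r_cont.
have [dr [drD drZ drB drS]] := derived_rep r_repr r_cont Pu Pt.
have [X [XL XB Xsk]] := complexify drD drZ drB.
have trE (t : 'rV[R]_n) : \tr (r (torus t)) = \sum_a \prod_i cis (t 0 i) ^ mu a i.
  transitivity (\tr (P *m r (torus t) *m invmx P)).
    by rewrite mxtrace_mulC mulmxA mulVmx // mul1mx.
  by rewrite Pt mxtrace_diag; apply: eq_bigr => a _; rewrite mxE.
have XZ a A : X (a *: A) = a *: X A.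
  have X0 : X 0 = 0.
    have := XL 1 0 0; rewrite scale1r addr0 scale1r => /eqP.
    by rewrite eq_sym addrC -subr_eq0 addrK => /eqP.
  by have := XL a A 0; rewrite addr0 X0 addr0.
exists mu, (fun A => P *m X A *m invmx P); split=> //.
- split=> [a A B|A B|i].
  + by rewrite XL mulmxDr mulmxDl -scalemxAr -scalemxAl.
  + rewrite XB mulmxBr mulmxBl; congr (_ - _);
    by rewrite !mulmxA mulmxKV.
  pose e : 'rV[R]_n := \row_j (j == i)%:R.
  have E : delta_mx i i = - (0 +i* 1) *: (invmx 1%:M *m idiag e *m 1%:M) :> 'M[R[i]]_n.
    rewrite invmx1 mul1mx mulmx1; apply/matrixP => a b; rewrite !mxE.
    have [->|ab] := eqVneq a b; last first.
      rewrite !mulr0n mulr0.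
      by case: (eqVneq a i) ab => [->|] //=; rewrite eq_sym => /negbTE ->.
    by rewrite andbb !mulr1n; case: (b == i); simpc.
  have [r1 _] := r_repr.
  rewrite E XZ Xsk; last first.
    have := skew_conj (unitary1 R n) (skew_idiag e).
    by rewrite invmx1.
  rewrite drS ?unitary1 // r1 mulmx1 -scalemxAr -scalemxAl !mulmxA mulmxV //.
  rewrite mul1mx -mulmxA mulmxV // mulmx1 /idiag -linearZ /=; congr diag_mx.
  apply/rowP => a; rewrite !mxE (bigD1 i) //= big1 ?addr0.
    rewrite mxE eqxx mulr1; simpc; rewrite -(rmorph_int (real_complex R)) /=.
    by [].
  by move=> j ji; rewrite mxE (negbTE ji) mulr0.
- move=> U Ust U0; pose V := U *m P.
  have V0 : V != 0.
    by apply: contraNneq U0 => V0; rewrite -[U](mulmxK Pu) -/V V0 mul0mx.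
  have Vst A : stablemx V (X A).
    have := submxMr P (Ust A); rewrite /V !mulmxA => h.
    by move: h; rewrite mulmxKV.
  have : row_full V.
    apply: r_irr V0 => g gU; have [u [t [uU ->]]] := unitary_spectral gU.
    have Qu : P *m r u \in unitmx by rewrite unitmx_mul Pu (repr_unit r_repr uU).
    rewrite (repr_spectral r_repr Pu Pt _ uU).
    have := Vst (invmx u *m idiag t *m u).
    rewrite Xsk; last first.
      by have := skew_conj (unitaryV uU) (skew_idiag t); rewrite invmxK.
    rewrite (drS _ _ uU) /idiag => st.
    apply: (stablemx_fun (f := fun z => cis (complex.Im z)) Qu _ st).
    by move=> a; rewrite 3!mxE.
  by rewrite /row_full mxrankMfree // row_free_unit.
- rewrite lt0n; apply: contraNneq r_n0 => d0; apply/eqP; apply/matrixP => -[i id].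
  by move: (id); rewrite d0.
move=> s nu.
pose nu' (x : 'I_d + 'I_d) : {ffun 'I_n -> int} :=
  match x with inl a => mu a | inr a => [ffun i => mu a (s^-1 i)%g] end.
pose c (x : 'I_d + 'I_d) : R[i] := match x with inl a => 1 | inr a => -1 end.
have := @torus_char_indep _ _ _ nu' c _ nu.
rewrite big_sumType /= !sumr_const mulNrn => H.
have /eqP : 1 *+ #|[pred a | mu a == nu]| - 1 *+
   #|[pred a | [ffun i => mu a (s^-1 i)%g] == nu]| = 0 :> R[i].
  apply: H => t t1 _; rewrite big_sumType /=.
  have /choice[x xP] : forall i : 'I_n, exists x, t i = cis x.
    by move=> i; apply: cis_surj; apply: complexI; rewrite cnE t1.
  have := trE (\row_i x (s i)); have := trE (\row_i x i).
  have -> : torus (\row_i x (s i)) =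
     perm_mx s *m torus (\row_i x i) *m invmx (perm_mx s).
    by rewrite torus_perm; congr torus; apply/rowP => i; rewrite !mxE.
  have pU := perm_mx_unitary R s; have tU := torus_unitary (\row_i x i).
  rewrite (reprM r_repr (unitaryM pU tU) (unitaryV pU)) (reprM r_repr pU tU).
  rewrite (reprV r_repr pU) mxtrace_mulC mulmxA (mulVmx (repr_unit r_repr pU)) mul1mx.
  move=> -> E.
  under eq_bigr => a _ do rewrite mul1r.
  under [X in _ + X]eq_bigr => a _ do rewrite mulN1r.
  rewrite sumrN; apply/eqP; rewrite subr_eq0; apply/eqP.
  transitivity (\sum_a \prod_i cis ((\row_i x i) 0 i) ^ mu a i).
    by apply: eq_bigr => a _; apply: eq_bigr => i _; rewrite mxE xP.
  rewrite E; apply: eq_bigr => a _.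
  rewrite (reindex_inj (@perm_inj _ (s^-1)%g)) /=; apply: eq_bigr => i _.
  by rewrite mxE permKV ffunE xP.
rewrite subr_eq0 eqr_nat => /eqP E.
have -> : #|[set a | mu a == nu]| = #|[pred a | mu a == nu]|.
  by apply: eq_card => a; rewrite !inE.
rewrite E; apply: eq_card => a; rewrite !inE; apply/eqP/eqP => /ffunP h.
  by apply/ffunP => i; rewrite ffunE h ffunE permKV.
by apply/ffunP => i; rewrite -[i in mu a i](permK s) ffunE -h ffunE.
Qed.

(** * Characters as Schur polynomials *)

(** Unique factorisation: strip off one common root at a time. *)
Lemma perm_prod_XsubC (F : fieldType) (s t : seq F) :
  \prod_(x <- s) ('X - x%:P) = \prod_(x <- t) ('X - x%:P) -> perm_eq s t.
Proof.
elim: s t => [|x s IH] t.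
  rewrite big_nil => E; suff -> : t = [::] by [].
  apply: size0nil; have := size_prod_XsubC t id.
  by rewrite -E size_poly1 => -[].
move=> E; have xt : x \in t.
  have : root (\prod_(x <- x :: s) ('X - x%:P)) x.
    by rewrite root_prod_XsubC mem_head.
  by rewrite E root_prod_XsubC.
rewrite (permPr (perm_to_rem xt)) perm_cons; apply: IH.
move: E; rewrite (perm_big _ (perm_to_rem xt)) /= !big_cons.
by move=> /mulfI; apply; rewrite polyXsubC_eq0.
Qed.

Lemma char_poly_conj (F : fieldType) n (u A : 'M[F]_n) : u \in unitmx ->
  char_poly (invmx u *m A *m u) = char_poly A.
Proof.
move=> uu; rewrite /char_poly.
have -> : char_poly_mx (invmx u *m A *m u) =
   map_mx polyC (invmx u) *m char_poly_mx A *m map_mx polyC u.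
  rewrite /char_poly_mx mulmxBr mulmxBl !map_mxM; congr (_ - _).
  rewrite scalar_mxC -mulmxA -map_mxM mulVmx //.
  by rewrite map_mx1 mulmx1.
rewrite !det_mulmx mulrAC -det_mulmx -map_mxM mulVmx //.
by rewrite map_mx1 det1 mul1r.
Qed.

(** A high power of the product of the t_i makes all exponents nonnegative.
    The hypothesis then becomes an identity between polynomials, from which
    the Vandermonde determinant is cancelled at the points [spreadX] t. *)
Lemma weyl_schur d n (mu : 'I_d -> {ffun 'I_n -> int}) (l : {ffun 'I_n -> int}) :
  (forall i j : 'I_n, (i < j)%N -> l j < l i) ->
  (forall (R : pzRingType) (G : {ffun 'I_n -> int} -> R),
     \sum_(w : 'S_n) \sum_a (-1) ^+ w * G (shifted mu w a) =
     \sum_(w : 'S_n) (-1) ^+ w * G [ffun i => l (w i)]) ->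
  exists (c : nat) (l' : nat -> nat), sdec n l' /\
    forall (F : fieldType) (t : nat -> F), (forall i, t i != 0) ->
    (\prod_(i < n) t i) ^+ c * \sum_a \prod_(i < n) t i ^ mu a i = schur n l' t.
Proof.
move=> lP H.
pose c := (\max_a \max_i `|mu a i|%N + \max_i `|l i|%N)%N.
have cmu a i : 0 <= mu a i + c.
  have h1 : (`|mu a i| <= \max_i `|mu a i|)%N.
    exact: (leq_bigmax (F := fun i => `|mu a i|%N) i).
  have h2 := leq_bigmax (F := fun a => (\max_i `|mu a i|)%N) a.
  by rewrite /c; move: h1 h2 => /=; lia.
have cl i : 0 <= l i + c.
  by have := leq_bigmax (F := fun i => `|l i|%N) i; rewrite /c /=; lia.
pose l' j : nat := if insub j is Some i then `|(l i + c : int)|%N else 0%N.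
have l'E (i : 'I_n) : l' i = `|(l i + c : int)|%N by rewrite /l' valK.
have l'P : sdec n l'.
  move=> i j /andP[ij jn]; have iN := ltn_trans ij jn.
  have := lP (Ordinal iN) (Ordinal jn) ij.
  have /= -> := l'E (Ordinal iN); have /= -> := l'E (Ordinal jn).
  by have := cl (Ordinal iN); have := cl (Ordinal jn); lia.
pose S (R : comNzRingType) (t : nat -> R) : R :=
  \sum_a \prod_(i < n) t i ^+ `|(mu a i + c : int)|%N.
have key (R : comNzRingType) (t : nat -> R) :
    vdm n t * S R t = vdm n t * schur n l' t.
  rewrite -det_powmx // vdm_det.
  have := H R (fun v => \prod_(i < n) t i ^+ `|(v i + c : int)|%N).
  have -> : \sum_(w : 'S_n) (-1) ^+ w * \prod_(i < n)
       t i ^+ `|([ffun i => l (w i)] i + c : int)|%N = \det (powmx n l' t).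
    apply: eq_bigr => w _; congr (_ * _); apply: eq_bigr => i _.
    by rewrite mxE ffunE l'E.
  move=> <-; rewrite /determinant mulr_suml; apply: eq_bigr => w _.
  rewrite /S mulr_sumr; apply: eq_bigr => a _; rewrite -mulrA; congr (_ * _).
  rewrite -big_split; apply: eq_bigr => i _ /=.
  rewrite mxE ffunE -exprD; congr (_ ^+ _).
  by move: (cmu a i); move: (mu a i) (n.-1 - w i)%N => x y; lia.
exists c, l'; split=> // F t t0.
have ST : S {poly F} (spreadX t) = schur n l' (spreadX t).
  apply: mulfI (key _ (spreadX t)).
  exact: (vdm_spreadX t n 0).
have := congr1 (horner_eval 0) ST.
rewrite rmorph_schur (@eq_schur _ _ _ _ t); last first.
  by move=> i _; apply: horner0_spreadX.
move=> <-; rewrite /S rmorph_sum mulr_sumr; apply: eq_bigr => a _.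
rewrite rmorph_prod -prodrXl -big_split; apply: eq_bigr => i _ /=.
rewrite rmorphXn /= horner0_spreadX -[_ ^+ `|_|%N]/(t i ^ (`|_|%N%:Z)).
rewrite gez0_abs // exprzDr ?unitfE // mulrC.
by [].
Qed.

(** A unitary matrix is conjugate, by a unitary matrix, to the torus element
    with its eigenvalues in any prescribed order; on the torus this is Weyl's
    formula, up to a power of the determinant, which is unimodular. *)
Theorem character_schur (R : realType) n (chi : 'M[R[i]]_n -> R[i]) :
  irr_Un chi -> exists l, [/\ sdec n l,
    char_degree chi = schur n l (fun=> 1 : R) &
    forall g, g \is unitarymx -> forall s, perm_eq s (eigenvalues g) ->
      [/\ size s = n, forall i, (i < n)%N -> `|s`_i| = 1 &
      `|chi g| = `|schur n l (nth 0 s)| ] ].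
Proof.
move=> chi_irr; have [d [r [r_repr r_cont r_irr chiE]]] := chi_irr.
have [mu [X [[XL XB XD] Xirr d0 mus trE]]] := weights_of_rep r_repr r_cont r_irr.
have [l0 [l0P lW]] := weyl_character XL XB XD Xirr d0 mus.
have [c [l [lP lS]]] := weyl_schur l0P lW.
have chi_torus (x : nat -> R) : chi (torus (\row_(i < n) x i)) *
     (\prod_(i < n) cis (x i)) ^+ c = schur n l (fun i => cis (x i)).
  have E : \sum_a \prod_i cis ((\row_(i < n) x i) 0 i) ^ mu a i =
      \sum_a \prod_(i < n) cis (x i) ^ mu a i.
    by apply: eq_bigr => a _; apply: eq_bigr => i _; rewrite mxE.
  rewrite (chiE _ (torus_unitary _)) trE E mulrC; apply: lS => i.
  exact: cis_neq0.
exists l; split=> //.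
  apply: complexI; rewrite -char_degreeE // (rmorph_schur (real_complex R)).
  have := chi_torus (fun=> 0); rewrite big1 ?expr1n ?mulr1; last first.
    by move=> i _; rewrite cis0.
  have -> : torus (\row_(i < n) (0 : R)) = 1%:M.
    by rewrite -(torus0 R n); congr torus; apply/rowP => i; rewrite !mxE.
  by move=> ->; apply: eq_schur => i _; rewrite cis0 /= rmorph1.
move=> g gU s sg; have [u [x [uU gE]]] := unitary_spectral gU.
have uu := unitarymx_unit uU.
pose y := [tuple cis (x 0 i) | i < n].
have eg : perm_eq (eigenvalues g) y.
  apply: perm_prod_XsubC; rewrite -eigenvaluesP gE char_poly_conj //.
  rewrite char_poly_trig ?diag_mx_is_trig // big_map big_enum /=.
  by apply: eq_bigr => i _; rewrite !mxE eqxx mulr1n.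
have /tuple_permP[p sE] := perm_trans sg eg.
pose x' (i : nat) : R := oapp (fun j => x 0 (p j)) 0 (insub i).
have x'E (i : 'I_n) : x' i = x 0 (p i) by rewrite /x' valK.
have sz : size s = n by rewrite (perm_size (perm_trans sg eg)) size_tuple.
have s_nth i : (i < n)%N -> s`_i = cis (x' i).
  move=> hi; have /= -> := x'E (Ordinal hi); rewrite sE (nth_map (Ordinal hi)).
    by rewrite tnth_mktuple (nth_ord_enum (Ordinal hi) (Ordinal hi)).
  by rewrite size_enum_ord.
have chi_g : chi g = chi (torus (\row_(i < n) x' i)).
  have -> : torus (\row_(i < n) x' i) = perm_mx p *m torus x *m invmx (perm_mx p).
    by rewrite torus_perm; congr torus; apply/rowP => i; rewrite !mxE x'E.
  have pU := perm_mx_unitary R p; have tU := torus_unitary x.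
  have vU := unitaryV uU; have qU := unitaryV pU.
  rewrite (chiE _ gU) chiE; last exact: unitaryM (unitaryM pU tU) qU.
  have tr_conj v : v \is unitarymx ->
      \tr (r (v *m torus x *m invmx v)) = \tr (r (torus x)).
    move=> vU'; have wU := unitaryV vU'.
    rewrite (reprM r_repr (unitaryM vU' tU) wU) (reprM r_repr vU' tU).
    rewrite (reprV r_repr vU') mxtrace_mulC mulmxA.
    by rewrite (mulVmx (repr_unit r_repr vU')) mul1mx.
  rewrite (tr_conj _ pU) gE; have := tr_conj _ vU.
  by rewrite invmxK.
split=> // [i hi|]; first by rewrite s_nth // norm_cis.
have := congr1 Num.norm (chi_torus x').
rewrite normrM normrX normr_prod big1 ?expr1n ?mulr1; last first.
  by move=> i _; rewrite norm_cis.
rewrite -chi_g => ->; congr `|_|; apply: eq_schur => i hi.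
by rewrite s_nth.
Qed.

(** * Dimensions of Schur polynomials and mutual distances *)

Section Energy.
Variable R : realType.
Implicit Types (l : nat -> nat) (a b c : nat).

(** The value at a = b is ln 0, which is 0 by convention; the diagonal terms of
    the double sums below therefore vanish. *)
Definition ldist a b : R := ln `|a%:R - b%:R|.

Lemma ldistxx a : ldist a a = 0.
Proof. by rewrite /ldist subrr normr0 ln0. Qed.

Lemma ldistC a b : ldist a b = ldist b a.
Proof. by rewrite /ldist distrC. Qed.

Lemma dist_ge1 a b : a != b -> 1 <= `|a%:R - b%:R| :> R.
Proof.
wlog ab : a b / (a < b)%N => [h ab|_].
  have := ab; rewrite neq_ltn => /orP[lt|lt]; first exact: h.
  by rewrite distrC; apply: h; rewrite // eq_sym.
rewrite distrC -natrB; last exact: ltnW.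
by rewrite normr_nat ler1n subn_gt0.
Qed.

Lemma ldist_ge0 a b : 0 <= ldist a b.
Proof.
have [->|ab] := eqVneq a b; first by rewrite ldistxx.
exact/ln_ge0/dist_ge1.
Qed.

(** Two integers at distance x and y >= 1 from a third one are at distance at
    most x + y <= 2 x y. *)
Lemma ldist_triangle a b c : c != a -> c != b ->
  ldist a b <= ln 2 + ldist a c + ldist b c.
Proof.
move=> ca cb; have [->|ab] := eqVneq a b.
  by rewrite ldistxx !addr_ge0 ?ldist_ge0 ?ln_ge0 ?ler1n.
have x1 := dist_ge1 ab.
have y1 : 1 <= `|a%:R - c%:R| :> R by rewrite dist_ge1 // eq_sym.
have z1 : 1 <= `|b%:R - c%:R| :> R by rewrite dist_ge1 // eq_sym.
have tri : `|a%:R - b%:R| <= `|a%:R - c%:R| + `|b%:R - c%:R| :> R.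
  by rewrite [`|b%:R - c%:R|]distrC; apply: ler_distD.
rewrite /ldist; move: `|a%:R - c%:R| `|b%:R - c%:R| `|a%:R - b%:R| x1 y1 z1 tri.
move=> y z x x1 y1 z1 tri.
rewrite -!lnM ?posrE; [|nra..].
rewrite ler_ln ?posrE; [|nra..].
by nra.
Qed.

(** Twice the logarithm of the product of the mutual distances. *)
Definition energy n l : R := \sum_(i < n) \sum_(j < n) ldist (l i) (l j).

Lemma energy_half n l :
  energy n l = (\sum_(j < n) \sum_(i < j) ldist (l i) (l j)) *+ 2.
Proof.
rewrite /energy; elim: n => [|n IH]; first by rewrite !big_ord0 mul0rn.
rewrite !big_ord_recr /= ldistxx addr0 mulrnDl -IH mulr2n.
under eq_bigr => i _ do rewrite big_ord_recr /=.
rewrite big_split /= -addrA; congr (_ + (_ + _)).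
by apply: eq_bigr => i _; apply: ldistC.
Qed.

(** Logarithm of [schur1]. *)
Lemma ln_schur1 n l : sdec n l -> 0 < schur n l (fun=> 1 : R) /\
  ln (schur n l (fun=> 1 : R)) *+ 2 = energy n l - energy n id.
Proof.
move=> lP; pose A := \sum_(j < n) \sum_(i < j) ldist (l i) (l j).
pose B := \sum_(j < n) \sum_(i < j) ldist i j.
suff -> : schur n l (fun=> 1 : R) = expR (A - B).
  by rewrite expR_gt0 expRK !energy_half mulrnBl.
have /(congr1 (fun x : int => x%:~R : R)) := schur1 lP.
rewrite rmorphM /= (rmorph_schur (intmul 1)) !rmorph_prod /=.
have -> : \prod_(j < n) ((\prod_(i < j) (j%:Z - i%:Z))%:~R : R) = expR B.
  rewrite expR_sum; apply: eq_bigr => j _; rewrite expR_sum rmorph_prod.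
  apply: eq_bigr => i _; rewrite rmorphB /= /ldist lnK.
    by rewrite distrC -natrB ?normr_nat ?natrB // ltnW.
  by rewrite posrE (lt_le_trans ltr01) // dist_ge1 // ltn_eqF.
have -> : \prod_(j < n) ((\prod_(i < j) ((l i)%:Z - (l j)%:Z))%:~R : R) = expR A.
  rewrite expR_sum; apply: eq_bigr => j _; rewrite expR_sum rmorph_prod.
  apply: eq_bigr => i _; rewrite rmorphB /= /ldist lnK.
    have lij : (l j < l i)%N by apply: lP; rewrite ltn_ord /=.
    by rewrite -natrB ?normr_nat ?natrB // ltnW.
  rewrite posrE (lt_le_trans ltr01) // dist_ge1 // gtn_eqF //.
  by apply: lP; rewrite ltn_ord /=.
rewrite (@eq_schur _ _ _ _ (fun=> 1)) // => E.
by rewrite expRD expRN -E mulfK // gt_eqF // expR_gt0.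
Qed.

Lemma sum_eidx N (J : {set 'I_N}) (F : nat -> R) :
  \sum_(i < #|J|) F (eidx J i) = \sum_(i in J) F i.
Proof.
have sz : size (map val (enum J)) = #|J| by rewrite size_map -cardE.
rewrite -[RHS]big_enum /= -(big_map val xpredT F) (big_nth 0%N) sz.
by rewrite big_mkord.
Qed.

Lemma energy_eidx N (J : {set 'I_N}) l :
  energy #|J| (l \o eidx J) = \sum_(i in J) \sum_(j in J) ldist (l i) (l j).
Proof.
rewrite /energy -(sum_eidx J (fun x => \sum_(j in J) ldist (l x) (l j))).
apply: eq_bigr => i _.
by rewrite -(sum_eidx J (fun y => ldist (l (eidx J i)) (l y))).
Qed.

Lemma energy_split N (J : {set 'I_N}) l :
  energy N l = energy #|J| (l \o eidx J) + energy #|~: J| (l \o eidx (~: J)) +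
    (\sum_(i in J) \sum_(j in ~: J) ldist (l i) (l j)) *+ 2.
Proof.
rewrite !energy_eidx /energy (bigID (mem J)) /=.
have sp (i : 'I_N) : \sum_(j < N) ldist (l i) (l j) =
   \sum_(j in J) ldist (l i) (l j) + \sum_(j in ~: J) ldist (l i) (l j).
  rewrite (bigID (mem J)) /=; congr (_ + _).
  by apply: eq_bigl => j; rewrite inE.
under eq_bigr => i _ do rewrite sp.
under [X in _ + X]eq_bigr => i _ do rewrite sp.
rewrite !big_split /=.
have nJ (F : 'I_N -> R) : \sum_(i < N | i \notin J) F i = \sum_(i in ~: J) F i.
  by apply: eq_bigl => i; rewrite inE.
rewrite !nJ.
have -> : \sum_(i in ~: J) \sum_(j in J) ldist (l i) (l j) =
          \sum_(i in J) \sum_(j in ~: J) ldist (l i) (l j).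
  rewrite exchange_big; apply: eq_bigr => j _; apply: eq_bigr => i _.
  exact: ldistC.
by rewrite mulr2n; ring.
Qed.

(** Sum [ldist_triangle] over the ordered pairs in J and the third points in
    K. *)
Lemma energy_cross N (J K : {set 'I_N}) l : sdec N l -> [disjoint J & K] ->
  energy #|J| (l \o eidx J) * #|K|%:R <= #|J|%:R ^+ 2 * #|K|%:R * ln 2 +
    (\sum_(i in J) \sum_(j in K) ldist (l i) (l j)) * #|J|%:R *+ 2.
Proof.
move=> lP dJK; rewrite energy_eidx.
have neq (i j : 'I_N) : i \in J -> j \in K -> l j != l i.
  move=> iJ jK; have ji : j != i.
    by apply: contraTneq jK => ->; rewrite (disjointFr dJK iJ).
  have /orP[lt|lt] : (i < j)%N || (j < i)%N by rewrite -neq_ltn eq_sym.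
    by rewrite ltn_eqF // lP // lt ltn_ord.
  by rewrite gtn_eqF // lP // lt ltn_ord.
have cst (A : {set 'I_N}) (x : R) : \sum_(i in A) x = #|A|%:R * x.
  by rewrite sumr_const mulr_natl.
have -> : (\sum_(i in J) \sum_(j in J) ldist (l i) (l j)) * #|K|%:R =
   \sum_(i in J) \sum_(j in J) \sum_(c in K) ldist (l i) (l j).
  rewrite mulr_suml; apply: eq_bigr => i _; rewrite mulr_suml.
  by apply: eq_bigr => j _; rewrite cst mulrC.
have -> : #|J|%:R ^+ 2 * #|K|%:R * ln 2 +
    (\sum_(i in J) \sum_(j in K) ldist (l i) (l j)) * #|J|%:R *+ 2 =
   \sum_(i in J) \sum_(j in J) \sum_(c in K)
     (ln 2 + ldist (l i) (l c) + ldist (l j) (l c)).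
  move: (ln 2) => w; transitivity (\sum_(i in J) (#|J|%:R * (#|K|%:R * w) +
       (\sum_(c in K) ldist (l i) (l c)) * #|J|%:R +
        \sum_(j in J) \sum_(c in K) ldist (l j) (l c))).
    by rewrite !big_split /= !cst -mulr_suml mulr2n; ring.
  apply: eq_bigr => i _.
  rewrite -[#|K|%:R * w]cst -cst [X in _ + X + _]mulrC -cst -!big_split.
  by apply: eq_bigr => j _; rewrite -!big_split.
apply: ler_sum => i iJ; apply: ler_sum => j jJ; apply: ler_sum => c cK.
by apply: ldist_triangle; apply: neq.
Qed.

(** The distances between {0..k-1} and {k..k+m-1} are at most k + m. *)
Lemma energy_id k m : energy (k + m) id <= energy k id + energy m id +
  k%:R * m%:R * ln (k + m)%:R *+ 2.
Proof.
rewrite /energy big_split_ord /=.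
under eq_bigr => i _ do rewrite big_split_ord /=.
under [X in _ + X]eq_bigr => i _ do rewrite big_split_ord /=.
rewrite !big_split /=.
have -> : \sum_(i < m) \sum_(j < m) ldist (k + i) (k + j) =
          \sum_(i < m) \sum_(j < m) ldist i j.
  apply: eq_bigr => i _; apply: eq_bigr => j _.
  by rewrite /ldist !natrD opprD addrACA subrr add0r.
have -> : \sum_(i < m) \sum_(j < k) ldist (k + i) j =
          \sum_(j < k) \sum_(i < m) ldist j (k + i).
  rewrite exchange_big; apply: eq_bigr => j _; apply: eq_bigr => i _.
  exact: ldistC.
have : \sum_(j < k) \sum_(i < m) ldist j (k + i) <= k%:R * m%:R * ln (k + m)%:R.
  have -> : k%:R * m%:R * ln (k + m)%:R =
     \sum_(j < k) \sum_(i < m) (ln (k + m)%:R : R).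
    move: (ln _ : R) => x; rewrite sumr_const card_ord sumr_const card_ord.
    by rewrite -mulrA mulr_natl mulr_natl.
  apply: ler_sum => j _; apply: ler_sum => i _.
  rewrite /ldist ler_ln ?posrE.
  - rewrite distrC -natrB; last by have := ltn_ord j; lia.
    by rewrite normr_nat ler_nat; have := ltn_ord i; lia.
  - by rewrite (lt_le_trans ltr01) // dist_ge1 //; have := ltn_ord j; lia.
  - by rewrite ltr0n; have := ltn_ord j; lia.
by rewrite !mulr2n; lra.
Qed.

(** Lower bound for the sum of the logarithms of the k m mutual distances
    between two complementary subsets of a set of k + m integers, in terms of
    the logarithm of the associated dimension. *)
Definition cross_energy k m (L : R) : R :=
  k%:R * m%:R * (L *+ 2 - (k%:R ^+ 2 + m%:R ^+ 2) * ln 2) /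
     (((k + m)%:R ^+ 2 - k%:R * m%:R) *+ 2).

(** The two dimensions on the left involve the distances inside J and inside
    its complement, so their product is the big dimension divided by the cross
    distances. Those are bounded from below by [energy_cross] applied to J and
    to its complement, since together with the internal distances they make up
    the whole energy. *)
Lemma ln_schur_pair k m l (J : {set 'I_(k + m)}) :
  (0 < k)%N -> (0 < m)%N -> sdec (k + m) l -> #|J| = k ->
  ln (schur k (l \o eidx J) (fun=> 1 : R)) +
  ln (schur m (l \o eidx (~: J)) (fun=> 1 : R)) <=
  ln (schur (k + m) l (fun=> 1 : R)) + k%:R * m%:R * ln (k + m)%:R -
  cross_energy k m (ln (schur (k + m) l (fun=> 1 : R))).
Proof.
move=> k0 m0 lP cJ; rewrite /cross_energy.
have cK : #|~: J| = m by have := cardsC J; rewrite cJ card_ord; lia.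
have [_ hL] := ln_schur1 lP.
have := sdec_eidx (J := J) lP; rewrite cJ => /ln_schur1[_ hJ].
have := sdec_eidx (J := ~: J) lP; rewrite cK => /ln_schur1[_ hK].
have := energy_split J l.
have dJ : [disjoint J & ~: J] by rewrite -setI_eq0 finset.setICr.
have := energy_cross lP dJ; rewrite disjoint_sym in dJ.
have := energy_cross lP dJ; rewrite cJ cK.
have -> : \sum_(i in ~: J) \sum_(j in J) ldist (l i) (l j) =
          \sum_(i in J) \sum_(j in ~: J) ldist (l i) (l j).
  rewrite exchange_big; apply: eq_bigr => j _; apply: eq_bigr => i _.
  exact: ldistC.
have := energy_id k m.
have e0 : 0 <= energy (k + m) id.
  by apply: sumr_ge0 => i _; apply: sumr_ge0 => j _; apply: ldist_ge0.
move: (\sum_(i in J) _) e0 hL hJ hK => X.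
move: (energy (k + m) id) (energy k id) (energy m id).
move: (energy (k + m) l) (energy k _) (energy m _).
move: (ln (schur (k + m) _ _)) (ln (schur k _ _)) (ln (schur m _ _)).
have ln20 : 0 <= ln 2 :> R by rewrite ln_ge0 // ler1n.
move: (ln 2) ln20 (ln (k + m)%:R) => w w0 v.
have x0 : 0 < k%:R :> R by rewrite ltr0n.
have y0 : 0 < m%:R :> R by rewrite ltr0n.
rewrite natrD; move: (k%:R : R) (m%:R : R) x0 y0 => x y x0 y0.
move=> L LJ LK E EJ EK eN ek em eN0 hL hJ hK hid hKJ hJK hE.
have x1 : 0 < ((x + y) ^+ 2 - x * y) *+ 2 by rewrite mulr2n; nra.
suff : x * y * (L *+ 2 - (x ^+ 2 + y ^+ 2) * w) / (((x + y) ^+ 2 - x * y) *+ 2) <= X.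
  by rewrite !mulr2n in hL hJ hK hid hE *; lra.
rewrite ler_pdivrMr //.
(* The estimate for J is weighted by k, that for its complement by m. *)
have h1 : x * y * E <= x * y * (x ^+ 2 + y ^+ 2) * w +
   (x ^+ 2 + y ^+ 2 + x * y) * X *+ 2.
  have := ler_wpM2l (ltW x0) hJK; have := ler_wpM2l (ltW y0) hKJ.
  by rewrite hE !mulr2n; lra.
have h2 : x * y * (L *+ 2) <= x * y * E.
  by rewrite ler_pM2l ?mulr_gt0 // hL; lra.
have -> : X * (((x + y) ^+ 2 - x * y) *+ 2) = (x ^+ 2 + y ^+ 2 + x * y) * X *+ 2.
  by rewrite !mulr2n; ring.
by lra.
Qed.

End Energy.

(** * Splitting the spectrum into two separated parts *)

Section Clusters.
Variable R : realType.
Implicit Types (z w : R[i]) (e t : R).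

(** Mean value theorem: sin t = t cos c, with cos c >= cos t >= 1/2. *)
Lemma sin_ge t : `|t| < pi / 2 -> 2^-1 <= cos t -> `|t| <= 2 * `|sin t|.
Proof.
wlog t0 : t / 0 <= t => [h|].
  have [/h //|t0] := leP 0 t; rewrite -[`|t|]normrN -cosN -[`|sin t|]normrN -sinN.
  by apply: h; rewrite oppr_ge0 ltW.
rewrite ger0_norm // => t_lt tc.
have [c] := @MVT_segment R sin cos 0 t t0
  (fun y _ => is_derive_sin y) (continuous_subspaceT (@continuous_sin R)).
rewrite in_itv /= sin0 !subr0 => /andP[c0 ct] ->.
have p0 := pi_gt0 R.
have cc : cos t <= cos c.
  by rewrite leNgt ltr_cos ?in_itv /= -?leNgt ?c0 ?t0 /=; lra.
rewrite ger0_norm; last by rewrite mulr_ge0 //; lra.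
by nra.
Qed.

(** A chord of length e / 2 <= 1 / 2 subtends an angle at most e. *)
Lemma chord_arc (x e : R) w : e <= 1 -> cn w = 1 -> cn (cis x - w) <= e / 2 ->
  w \in Defs.arc (x - e) (e *+ 2).
Proof.
move=> e1 w1 xw; pose v := w * cis (- x).
have v1 : cn v = 1 by rewrite /v cnM w1 cn_cis mulr1.
have cx : cis x * cis (- x) = 1 by rewrite -cisD subrr cis0.
have ve : cn (v - 1) <= e / 2.
  have -> : v - 1 = - ((cis x - w) * cis (- x)).
    by rewrite mulrBl cx opprB.
  by rewrite cnN cnM cn_cis mulr1.
have hR := Re_le_cn (v - 1); have hI := Im_le_cn (v - 1).
rewrite raddfB /= in hR; rewrite raddfB /= subr0 in hI.
have Re2 : 2^-1 <= complex.Re v.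
  have := le_trans hR ve; rewrite ler_norml => /andP[h _].
  by move: h; lra.
have [t [tP vE]] := cis_surj_half v1 (lt_le_trans (ltac:(lra) : 0 < 2^-1 :> R) Re2).
have te : `|t| <= e.
  have := le_trans hI ve; move: Re2; rewrite vE /cis /= => c2 s2.
  have t2 : `|t| < pi / 2 by rewrite ltr_norml.
  by have := sin_ge t2 c2; lra.
rewrite inE /Defs.arc /=; exists (x + t).
  by move: te; rewrite ler_norml in_itv /= mulr2n => /andP[h1 h2]; apply/andP; split; lra.
have : cis (x + t) = w by rewrite cisD -vE /v mulrCA cx mulr1.
by [].
Qed.

(** Link the points at distance at most e / (2 n). A connected component is
    covered by chains of at most n steps, so it lies in an arc of length 2 e
    and has at most (1 - beta) n points. Take a union A of components, as
    large as possible with at most (1 - kappa) n points: if A had less than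
    kappa n points, a further component would have at most as many points as
    A, and could be added. *)
Lemma cluster_split n (z : 'I_n -> R[i]) (beta kappa e : R) :
  (0 < n)%N -> 0 < kappa -> kappa <= beta -> kappa *+ 3 <= 1 -> 0 < e -> e <= 1 ->
  (forall i, cn (z i) = 1) ->
  (forall a, #|[set i | z i \in Defs.arc a (e *+ 2)]|%:R <= (1 - beta) * n%:R) ->
  exists A : {set 'I_n}, [/\ kappa * n%:R <= #|A|%:R,
     #|A|%:R <= (1 - kappa) * n%:R &
     forall i j, i \in A -> j \notin A -> e / (n.*2)%:R <= cn (z i - z j)].
Proof.
move=> n0 k0 kb k3 e0 e1 z1 zarc.
pose dl := e / (n.*2)%:R.
have nR : 0 < n%:R :> R by rewrite ltr0n.
have n2 : (n.*2)%:R = n%:R * 2 :> R by rewrite -muln2 natrM.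
have dl0 : 0 < dl by rewrite divr_gt0 // n2; lra.
pose near i j := cn (z i - z j) <= dl.
pose cl (i : 'I_n) := [set j | connect near i j].
have chain i p : path near i p -> cn (z i - z (last i p)) <= (size p)%:R * dl.
  elim: p i => [|j p IH] i /=; first by rewrite subrr cn0 mul0r.
  move=> /andP[ij /IH h]; have -> : z i - z (last j p) = (z i - z j) + (z j - z (last j p)).
    by rewrite addrA subrK.
  apply: le_trans (cnD _ _) _; rewrite -natr1 mulrDl mul1r addrC.
  by apply: lerD.
have cl_small i : #|cl i|%:R <= (1 - beta) * n%:R.
  have [x xE] := cis_surj (z1 i).
  apply: le_trans (zarc (x - e)); rewrite ler_nat; apply: subset_leq_card.
  apply/fintype.subsetP => j; rewrite !finset.in_set => /connectP[p ip ->].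
  apply: chord_arc; rewrite ?z1 // -xE.
  move: ip => /shortenP[q iq uq _].
  apply: le_trans (chain _ _ iq) _.
  have sq : (size q <= n)%N.
    have := card_uniqP uq; rewrite /= => h.
    have := max_card (mem (i :: q)); rewrite h card_ord; lia.
  apply: (@le_trans _ _ (n%:R * dl)); first by rewrite ler_wpM2r ?ler_nat // ltW.
  by have -> : n%:R * dl = e / 2 by rewrite /dl n2; field; rewrite gt_eqF.
pose closed (A : {set 'I_n}) := [forall i, forall j, (near i j && (i \in A)) ==> (j \in A)].
have closedP (A : {set 'I_n}) : reflect (forall i j, near i j -> i \in A -> j \in A) (closed A).
  apply: (iffP forallP) => [h i j ij iA|h i].
    by have /forallP/(_ j) := h i; rewrite ij iA.
  by apply/forallP => j; apply/implyP => /andP[]; apply: h.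
have cl_closed i : closed (cl i).
  apply/closedP => j h jh; rewrite !inE => ij.
  exact: connect_trans ij (connect1 jh).
pose Q A := closed A && (#|A|%:R <= (1 - kappa) * n%:R).
have Q0 : Q finset.set0.
  apply/andP; split; first by apply/closedP => i j _; rewrite inE.
  by rewrite cards0 mulr_ge0 ?ltW //; lra.
have [A /andP[Acl Asz] Amax] := arg_maxnP (fun A : {set 'I_n} => #|A|) Q0.
exists A; split=> //; last first.
  move=> i j iA jA; rewrite leNgt; apply/negP => lt; case/negP: jA.
  by apply: (closedP _ Acl) iA; rewrite /near ltW.
rewrite leNgt; apply/negP => Alt.
have [i iA] : exists i, i \notin A.
  apply/existsP; rewrite -negb_forall; apply/negP => /forallP all.
  have : A = [set: 'I_n]%SET by apply/setP => i; rewrite all inE.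
  by move=> E; move: Alt; rewrite E cardsT card_ord; nra.
have iK : i \in cl i by rewrite inE.
have KA : (#|cl i| <= #|A|)%N.
  apply: Amax; rewrite /Q cl_closed /=; apply: le_trans (cl_small i) _.
  by rewrite ler_pM2r //; lra.
have UA : ~~ Q (A :|: cl i).
  apply/negP => /Amax /=; rewrite leqNgt => /negP; apply.
  apply: proper_card; apply/properP; split; first exact: finset.subsetUl.
  by exists i; rewrite // inE iK orbT.
move: UA; rewrite /Q negb_and => /orP[/negP[]|].
  apply/closedP => a b ab; rewrite !inE => /orP[aA|aK].
    by rewrite (closedP _ Acl _ _ ab aA).
  have := closedP _ (cl_closed i) _ _ ab; rewrite !inE => ->; rewrite ?orbT //.
rewrite -ltNge => lt.
have : (#|A :|: cl i|%:R : R) <= #|A|%:R + #|cl i|%:R.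
  by rewrite -natrD ler_nat cardsU leq_subr.
have : (#|cl i|%:R : R) <= #|A|%:R by rewrite ler_nat.
by move: lt Alt; rewrite !mulrS mulr0n in k3; nra.
Qed.

End Clusters.

(** * The character bound *)

Lemma bin_le_expn n k : ('C(n, k) <= n ^ k)%N.
Proof.
elim: k => [|k IH]; first by rewrite bin0.
have h := mul_bin_left n k.
have : (k.+1 * 'C(n, k.+1) <= n * n ^ k)%N by rewrite h leq_mul ?leq_subr.
by rewrite expnS; apply: leq_trans; rewrite leq_pmull.
Qed.

(** Compare both sides of [schur_laplace]. There are at most n ^ (k m) terms on
    the right, each of which is bounded by [ln_schur_pair]. *)
Lemma schur_bound (R : realType) n k m l (t : nat -> R[i]) (dl : R) :
  n = (k + m)%N -> (0 < k)%N -> (0 < m)%N -> sdec n l ->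
  (forall i, (i < n)%N -> `|t i| = 1) -> 0 < dl ->
  (forall i j, (i < k)%N -> (j < m)%N -> dl <= cn (t i - t (k + j)%N)) ->
  cn (schur n l t) <= expR (ln (schur n l (fun=> 1 : R)) +
     k%:R * m%:R * ln n%:R *+ 2 - k%:R * m%:R * ln dl -
     cross_energy k m (ln (schur n l (fun=> 1 : R)))).
Proof.
move=> nE k0 m0; rewrite nE => lP t1 dl0 tdl.
set L := ln (schur _ _ _); set x := k%:R; set y := m%:R.
pose B := L + x * y * ln (k + m)%:R - cross_energy k m L.
have [e] := schur_laplace t lP.
move=> /(congr1 (@cn R)); rewrite cnM => E.
have lnr : 0 <= ln (k + m)%:R :> R by rewrite ln_ge0 // ler1n; lia.
have lhs : cn (schur (k + m) l t) * expR (x * y * ln dl) <=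
  cn (schur (k + m) l t) * cn (\prod_(j < m) \prod_(i < k) (t i - t (k + j)%N)).
  rewrite ler_wpM2l ?cn_ge0 //.
  have -> : expR (x * y * ln dl) = \prod_(j < m) \prod_(i < k) dl.
    rewrite !prodr_const !card_ord -exprM -{2}[dl]lnK ?posrE // -expRM_natl.
    by congr expR; rewrite natrM.
  rewrite -lecR cnE normr_prod rmorph_prod; apply: ler_prod => j _.
  rewrite normr_prod rmorph_prod prodr_ge0 /=; last by move=> i _; rewrite ler0c ltW.
  by apply: ler_prod => i _; rewrite /= ler0c ltW //= -cnE lecR tdl.
have term (J : {set 'I_(k + m)}) : #|J| = k ->
   cn ((-1) ^+ e J * (schur k (l \o eidx J) t *
      schur m (l \o eidx (~: J)) (fun i => t (k + i)%N))) <= expR B.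
  move=> cJ; have cK : #|~: J| = m by have := cardsC J; rewrite cJ card_ord; lia.
  have := sdec_eidx (J := J) lP; rewrite cJ => /(ln_schur1 R)[p1 _].
  have := sdec_eidx (J := ~: J) lP; rewrite cK => /(ln_schur1 R)[p2 _].
  have nb p (l' : nat -> nat) (t' : nat -> R[i]) : (forall i, (i < p)%N -> `|t' i| = 1) ->
      cn (schur p l' t') <= schur p l' (fun=> 1 : R).
    move=> t'1; rewrite -lecR cnE; apply: le_trans (norm_schur _ t'1) _.
    rewrite (rmorph_schur (real_complex R)).
    by rewrite (@eq_schur _ _ _ _ (real_complex R \o fun=> 1)) // => i _ /=; rewrite rmorph1.
  have -> : cn ((-1) ^+ e J * (schur k (l \o eidx J) t *
      schur m (l \o eidx (~: J)) (fun i => t (k + i)%N))) =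
     cn (schur k (l \o eidx J) t) *
      cn (schur m (l \o eidx (~: J)) (fun i => t (k + i)%N)).
    by case: (e J); rewrite ?expr1 ?expr0 ?mulN1r ?mul1r ?cnN cnM.
  apply: (@le_trans _ _ (expR (ln (schur k (l \o eidx J) (fun=> 1 : R)) +
      ln (schur m (l \o eidx (~: J)) (fun=> 1 : R))))).
    rewrite expRD !lnK ?posrE //; apply: ler_pM; rewrite ?cn_ge0 // nb // => i hi.
      by apply: t1; rewrite ltn_addr.
    by apply: t1; rewrite ltn_add2l.
  by rewrite ler_expR; apply: ln_schur_pair.
have rhs : cn (schur (k + m) l t) * expR (x * y * ln dl) <=
    expR (x * y * ln (k + m)%:R) * expR B.
  apply: le_trans lhs _; rewrite E.
  apply: le_trans (cn_sum _ _ _) _.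
  apply: (@le_trans _ _ (\sum_(J : {set 'I_(k + m)} | #|J| == k) expR B)).
    by apply: ler_sum => J /eqP; apply: term.
  have -> : \sum_(J : {set 'I_(k + m)} | #|J| == k) expR B = 'C(k + m, k)%:R * expR B.
    rewrite mulr_natl -[in RHS](card_ord (k + m)) -card_draws -sumr_const.
    by apply: eq_bigl => J; rewrite inE.
  rewrite ler_wpM2r ?expR_ge0 //.
  apply: (@le_trans _ _ (((k + m) ^ (k * m))%N)%:R).
    rewrite ler_nat; apply: leq_trans (bin_le_expn _ _) _.
    by rewrite leq_pexp2l ?leq_pmulr //; lia.
  rewrite natrX -[X in X ^+ _]lnK ?posrE ?ltr0n ?addn_gt0 ?k0 // -expRM_natl natrM.
  by [].
have -> : L + x * y * ln (k + m)%:R *+ 2 - x * y * ln dl - cross_energy k m L =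
  x * y * ln (k + m)%:R + B - x * y * ln dl.
  by rewrite /B; move: (cross_energy _ _ _) => Z; rewrite mulr2n; ring.
by rewrite expRD expRN ler_pdivlMr ?expR_gt0 // expRD.
Qed.

(** The extreme case u = beta / 8 of [u_bound]. For beta <= 1/3 the hypothesis
    on q gives q >= beta (1 - beta), which is enough to first order in beta;
    for beta > 1/3 it gives q >= 2/9, and beta (2 - beta) / 8 <= 1/8 suffices. *)
Lemma q_bound (R : realFieldType) (beta q : R) : 0 < beta -> beta < 1 -> 0 <= q ->
  q <= 4^-1 -> Num.min beta 3^-1 * (1 - Num.min beta 3^-1) <= q ->
  (1 - q) * (beta * (2 - beta) / 8 + q * (beta * (2 - beta) / 8) + q * (beta / 2)) <=
    q * (1 - (1 - q *+ 2) * (beta / 16)).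
Proof.
move=> b0 b1 q0 q_le; rewrite -(mulr_natr q).
have c0 : 0 <= q ^+ 2 * beta by rewrite mulr_ge0 ?sqr_ge0 // ltW.
have c1 : 0 <= q ^+ 2 * (beta * (2 - beta)).
  by rewrite mulr_ge0 ?sqr_ge0 // mulr_ge0 ?ltW //; lra.
case: (leP beta 3^-1) => bk q_ge.
  have : 0 <= beta * ((1 - beta) * (1 - beta * 9 / 16) - (2 - beta) / 8).
    by apply: mulr_ge0; nra.
  have : 0 <= (q - beta * (1 - beta)) * (1 - beta * 9 / 16).
    by apply: mulr_ge0; lra.
  by lra.
have : 0 <= (1 - beta) ^+ 2 by apply: sqr_ge0.
have : 0 <= (1 - beta) * q by rewrite mulr_ge0 // subr_ge0 ltW.
by nra.
Qed.

(** The right-hand side minus the left-hand side decreases when u increases, so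
    u = beta L / 8 is the worst case. *)
Lemma u_bound (R : realFieldType) (beta q u L : R) :
  0 < beta -> beta < 1 -> 0 <= q -> q <= 4^-1 ->
  Num.min beta 3^-1 * (1 - Num.min beta 3^-1) <= q ->
  0 <= L -> u * 8 <= beta * L ->
  (1 - q) * (beta * (2 - beta) / 8 * L + q * (beta * (2 - beta) / 8 * L) + q * u *+ 4)
    <= q * (L - (1 - q *+ 2) * (u / 2)).
Proof.
move=> b0 b1 q0 q_le q_ge L0 uL.
have := q_bound b0 b1 q0 q_le q_ge; rewrite -(mulr_natr q) -(mulr_natr (q * u)).
move: (beta * (2 - beta) / 8) => g main.
have uB : 0 <= beta * L / 8 - u by lra.
have c0 : 0 <= (1 - q) * q * 4 + q * ((1 - q * 2) / 2).
  apply: addr_ge0; first by rewrite !mulr_ge0 //; lra.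
  by rewrite mulr_ge0 //; lra.
have h1 := mulr_ge0 c0 uB; have h2 := ler_wpM2l L0 main.
have -> : q * (L - (1 - q * 2) * (u / 2)) =
  L * (q * (1 - (1 - q * 2) * (beta / 16))) +
  q * ((1 - q * 2) / 2) * (beta * L / 8 - u) by field.
have -> : (1 - q) * (g * L + q * (g * L) + q * u * 4) =
  L * ((1 - q) * (g + q * g + q * (beta / 2))) - (1 - q) * q * 4 * (beta * L / 8 - u).
  by field.
by rewrite mulrDl in h1; lra.
Qed.

(** Here x, y, N stand for k, m, n, and v, w for ln n, ln 2; the term in
    parentheses is ln (eps / (2 n)). With q = x y / N^2 and u = N^2 v, and w
    estimated by v, the claim becomes [u_bound]. *)
Lemma exponent_bound (R : realFieldType) (beta kappa x y N L v w g : R) :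
  0 < beta -> beta < 1 -> kappa = Num.min beta 3^-1 ->
  0 < N -> x + y = N -> kappa * N <= x -> x <= (1 - kappa) * N ->
  0 <= w -> w <= v -> 8 / beta * N ^+ 2 * v < L ->
  g = beta * (2 - beta) / 8 ->
  L + x * y * v *+ 2 - x * y * (- (g / N ^+ 2 * L) - w - v) -
     x * y * (L *+ 2 - (x ^+ 2 + y ^+ 2) * w) / ((N ^+ 2 - x * y) *+ 2) <=
  (1 - g) * L.
Proof.
move=> b0 b1 kE N0 xy kx xk w0 wv vL gE.
have N2 : 0 < N ^+ 2 by rewrite exprn_gt0.
pose q := x * y / N ^+ 2; pose u := N ^+ 2 * v.
have uL : u * 8 <= beta * L.
  have : 8 / beta * N ^+ 2 * v * beta <= L * beta by rewrite ler_pM2r // ltW.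
  have -> : 8 / beta * N ^+ 2 * v * beta = u * 8.
    by rewrite /u; field; rewrite gt_eqF.
  by lra.
have u0 : 0 <= u by apply: mulr_ge0; [exact: ltW | lra].
have L0 : 0 <= L by move: (uL); nra.
have xyE : x * y = q * N ^+ 2 by rewrite divfK // gt_eqF.
have k3 : kappa <= 3^-1 by rewrite kE ge_min lexx orbT.
have kb : kappa <= beta by rewrite kE ge_min lexx.
have q_ge : kappa * (1 - kappa) <= q.
  have yk : kappa * N <= y by move: xk; nra.
  rewrite ler_pdivlMr //; have : 0 <= (x - kappa * N) * (y - kappa * N).
    by rewrite mulr_ge0 ?subr_ge0.
  have -> : kappa * (1 - kappa) * N ^+ 2 = kappa * N * (x + y) - kappa ^+ 2 * N ^+ 2.
    by rewrite xy; ring.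
  by nra.
have q_le : q <= 4^-1.
  rewrite ler_pdivrMr //; have := sqr_ge0 (x - y); rewrite -xy; nra.
have x2y2 : x ^+ 2 + y ^+ 2 = (1 - q *+ 2) * N ^+ 2.
  by rewrite mulrBl mul1r mulrnAl -xyE -xy mulr2n; ring.
have q1 : 0 < 1 - q by lra.
have -> : N ^+ 2 - x * y = (1 - q) * N ^+ 2 by rewrite xyE; ring.
have X_ge : q * (L *+ 2 - (1 - q *+ 2) * u) / ((1 - q) *+ 2) <=
   x * y * (L *+ 2 - (x ^+ 2 + y ^+ 2) * w) / (((1 - q) * N ^+ 2) *+ 2).
  rewrite x2y2 xyE.
  have -> : q * N ^+ 2 * (L *+ 2 - (1 - q *+ 2) * N ^+ 2 * w) / (((1 - q) * N ^+ 2) *+ 2)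
    = q * (L *+ 2 - (1 - q *+ 2) * (N ^+ 2 * w)) / ((1 - q) *+ 2).
    move: (1 - q) q1 (1 - q *+ 2) => c c0 b.
    rewrite -[b * _ * w]mulrA -[q * _ * _]mulrA [N ^+ 2 * (_ - _)]mulrC.
    rewrite [q * (_ * N ^+ 2)]mulrA.
    by rewrite -mulrnAl -mulf_div divff ?gt_eqF // mulr1.
  rewrite ler_pM2r ?invr_gt0 ?pmulrn_lgt0 //.
  have q0 : 0 <= q by move: q_ge k3; rewrite kE; case: (leP beta 3^-1); nra.
  rewrite ler_wpM2l // lerD2l lerN2 ler_wpM2l //; first by rewrite mulr2n; lra.
  by rewrite ler_pM2l.
apply: le_trans (_ : L + q * u *+ 2 + q * (g * L) + q * u *+ 2 -
   q * (L *+ 2 - (1 - q *+ 2) * u) / ((1 - q) *+ 2) <= _).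
  have -> : x * y * v = q * u by rewrite xyE /u; ring.
  have : x * y * (- (g / N ^+ 2 * L) - w - v) >= - (q * (g * L) + q * u *+ 2).
    have -> : x * y * (- (g / N ^+ 2 * L) - w - v) =
       - (q * (g * L)) - q * (N ^+ 2 * w) - q * u.
      by rewrite xyE /u; field; rewrite gt_eqF.
    have q0 : 0 <= q by move: q_ge k3; rewrite kE; case: (leP beta 3^-1); nra.
    have : q * (N ^+ 2 * w) <= q * u by rewrite ler_wpM2l // ler_pM2l.
    by rewrite mulr2n; lra.
  by lra.
have -> : q * (L *+ 2 - (1 - q *+ 2) * u) / ((1 - q) *+ 2) =
  q * (L - (1 - q *+ 2) * (u / 2)) / (1 - q).
  have -> : L *+ 2 - (1 - q *+ 2) * u = (L - (1 - q *+ 2) * (u / 2)) *+ 2.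
    by rewrite !mulr2n; field.
  have half2 (a c : R) : a *+ 2 / (c *+ 2) = a / c.
    by rewrite -(mulr_natr a) -(mulr_natr c) -mulf_div divff ?mulr1 // pnatr_eq0.
  by rewrite mulrnAr half2.
suff h : (1 - q) * (g * L + q * (g * L) + q * u *+ 4) <= q * (L - (1 - q *+ 2) * (u / 2)).
  have : g * L + q * (g * L) + q * u *+ 4 <= q * (L - (1 - q *+ 2) * (u / 2)) / (1 - q).
    by rewrite ler_pdivlMr // mulrC.
  by rewrite !mulrS mulr0n; lra.
have q0 : 0 <= q by move: q_ge k3; rewrite kE; case: (leP beta 3^-1); nra.
by rewrite gE; apply: u_bound => //; rewrite -?kE.
Qed.

Local Open Scope classical_set_scope.
Local Open Scope ring_scope.
Local Open Scope complex_scope.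

Theorem corollary3p8 (R : realType) (beta : R)
    (beta_gt0 : 0 < beta) (beta_lt1 : beta < 1)
    (n : nat) (n_ge2 : (2 <= n)%N)
    (rho : 'M[R[i]]_n -> R[i]) (rho_irr : irr_Un rho)
    (rho_deg : 2 `^ (8 / beta * n%:R ^+ 2 * log2 n%:R) < char_degree rho)
    (g : 'M[R[i]]_n) (g_unitary : g \is unitarymx)
    (g_spread :
       spread beta
         (char_degree rho `^ (- (1 / 8 * beta * (2 - beta) / n%:R ^+ 2))) g) :
  `|rho g| <= (char_degree rho `^ (1 - beta * (2 - beta) / 8))%:C.
Proof.
have [l [lP rhoD rhoS]] := character_schur rho_irr.
set D := char_degree rho in rho_deg g_spread rhoD *.
have n0 : (0 < n)%N by apply: ltn_trans n_ge2.
have nR : 0 < n%:R :> R by rewrite ltr0n.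
have D0 : 0 < D by rewrite rhoD; have [] := ln_schur1 R lP.
have powE (a x : R) : 0 < a -> a `^ x = expR (x * ln a).
  by move=> a0; rewrite /powR gt_eqF.
pose L := ln D; pose gam := beta * (2 - beta) / 8.
have ln2 : 0 < ln 2 :> R by rewrite ln_gt0 // ltr1n.
have ln2n : ln 2 <= ln n%:R :> R by rewrite ler_ln ?posrE // ler_nat.
have vL : 8 / beta * n%:R ^+ 2 * ln n%:R < L.
  move: rho_deg; rewrite powE ?ltr0n // -{1}[D]lnK ?posrE // ltr_expR.
  by rewrite /log2 mulrA divfK // gt_eqF.
have L0 : 0 < L.
  apply: le_lt_trans vL; rewrite mulr_ge0 //; last by lra.
  by rewrite mulr_ge0 ?exprn_ge0 // divr_ge0 // ltW.
have gam0 : 0 < gam by rewrite /gam; nra.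
pose eps := D `^ (- (1 / 8 * beta * (2 - beta) / n%:R ^+ 2)).
have epsE : eps = expR (- (gam / n%:R ^+ 2 * L)).
  have gE : 1 / 8 * beta * (2 - beta) = gam by rewrite /gam; field.
  by rewrite /eps powE // gE mulNr.
have eps0 : 0 < eps by rewrite epsE expR_gt0.
have eps1 : eps <= 1.
  rewrite epsE -[leRHS]expR0 ler_expR oppr_le0 ltW //.
  by apply: mulr_gt0 L0; apply: divr_gt0 gam0 _; apply: exprn_gt0.
rewrite -/eps in g_spread.
have [sz e1 _] := rhoS g g_unitary _ (perm_refl _).
pose ev := eigenvalues g; pose z (i : 'I_n) := ev`_i.
have evE : ev = [seq z i | i <- enum 'I_n].
  rewrite /z -[LHS](mkseq_nth 0) /mkseq sz -val_enum_ord -map_comp.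
  by [].
have z1 i : cn (z i) = 1 by apply: complexI; rewrite cnE e1.
(* Both parts of the spectrum will have at least kappa n elements. The bound
   by 1/3 makes room for a last cluster in the construction of the parts. *)
pose kappa : R := Num.min beta 3^-1.
have k0 : 0 < kappa by rewrite lt_min beta_gt0 invr_gt0 ltr0n.
have kb : kappa <= beta by rewrite ge_min lexx.
have k3 : kappa *+ 3 <= 1.
  have : kappa <= 3^-1 by rewrite ge_min lexx orbT.
  by rewrite -(mulr_natr kappa); lra.
have zarc (a : R) : #|[set i : 'I_n | z i \in Defs.arc a (eps *+ 2)]%SET|%:R <= (1 - beta) * n%:R.
  apply: le_trans (g_spread a); rewrite ler_nat -/ev evE count_map.
  rewrite enumT cardE /enum_mem size_filter; apply: eq_leq.
  by apply: eq_count => i /=; rewrite finset.inE.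
have [A [kA Ak Asep]] := cluster_split n0 k0 kb k3 eps0 eps1 z1 zarc.
pose k := #|A|; pose m := #|~: A|%SET.
have nkm : n = (k + m)%N by have := cardsC A; rewrite card_ord.
have k_gt0 : (0 < k)%N by rewrite -(ltr0n R); apply: lt_le_trans kA; apply: mulr_gt0.
have m_gt0 : (0 < m)%N.
  rewrite -(ltr0n R); move: Ak; have : n%:R = k%:R + m%:R :> R by rewrite -natrD -nkm.
  by rewrite -/k; nra.
(* The eigenvalues are reordered so that the first k are those in A. *)
pose s := [seq z i | i <- enum A ++ enum (~: A)%SET].
have s_ev : perm_eq s ev.
  rewrite evE; apply: perm_map; apply: uniq_perm; rewrite ?enum_uniq //.
    rewrite cat_uniq !enum_uniq andbT /=; apply/hasPn => x.
    by rewrite !mem_enum finset.inE.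
  by move=> x; rewrite mem_cat !mem_enum finset.inE orbN.
have [_ s1 ->] := rhoS g g_unitary s s_ev.
pose dl := eps / (n.*2)%:R.
have n20 : 0 < (n.*2)%:R :> R by rewrite ltr0n double_gt0.
have dl0 : 0 < dl by rewrite divr_gt0.
have sep i j : (i < k)%N -> (j < m)%N -> dl <= cn (s`_i - s`_(k + j)).
  move=> ik jm; have n' : 'I_n := Ordinal n0.
  have szs : size (enum A ++ enum (~: A)%SET) = n by rewrite size_cat -!cardE -/k -/m nkm.
  rewrite /s !(nth_map n') ?szs ?nkm ?ltn_add2l ?ltn_addr //.
  apply: Asep.
    by rewrite nth_cat -cardE ik -mem_enum mem_nth // -cardE.
  rewrite nth_cat -cardE -/k ltnNge leq_addr /= addKn.
  have : nth n' (enum (~: A)%SET) j \in (~: A)%SET by rewrite -mem_enum mem_nth // -cardE.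
  by rewrite finset.inE.
have := schur_bound nkm k_gt0 m_gt0 lP s1 dl0 sep.
rewrite -rhoD -/L -cnE lecR => /le_trans; apply.
rewrite powE // -/L ler_expR -/gam.
have -> : ln dl = - (gam / n%:R ^+ 2 * L) - ln 2 - ln n%:R.
  rewrite /dl -muln2 natrM lnM ?posrE ?invr_gt0 ?mulr_gt0 // lnV ?posrE ?mulr_gt0 //.
  by rewrite lnM ?posrE // epsE expRK opprD [- ln n%:R - _]addrC addrA.
rewrite /cross_energy -nkm.
apply: (exponent_bound (beta := beta) (kappa := kappa)) => //.
- by rewrite -natrD -nkm.
- exact: ltW.
Qed.
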